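(* Let $\mathcal{H}\subset\{h=1\}\subset\mathbb{R}^2$ be a maximal connected incomplete quartic generalised projective special real (GPSR) curve. Let $$U:=\frac{1}{24}\left(4+\left(31+3\sqrt{57}\right)\left(46+6\sqrt{57}\right)^{-1/3}+\left(100+12\sqrt{57}\right)\left(46+6\sqrt{57}\right)^{-2/3}\right).$$ Then $\mathcal{H}$ is equivalent to precisely one of the following maximal incomplete quartic GPSR curves in standard form (for each polynomial $h$ below, the curve is the connected component of $\{h=1\}\cap\{\text{hyperbolic points of }h\}$ containing $(x,y)=(1,0)$): a) $h=x^4-x^2y^2+Ky^4$ with $K>\frac14$; here $\{h=1\}\cap\{\text{hyperbolic points of }h\}$ has $4$ equivalent connected components and $G^h\cong\mathbb{Z}_2\ltimes\mathbb{Z}_2$. b) $h=x^4-x^2y^2+xy^3+Ky^4$ with $K\in\left(-\frac{25}{72},U\right)$; here $\{h=1\}\cap\{\text{hyperbolic points of }h\}$ has $4$ equivalent connected components and $G^h\cong\mathbb{Z}_2\times\mathbb{Z}_2$. c) $h=x^4-x^2y^2+xy^3-\frac{25}{72}y^4$; here $\{h=1\}\cap\{\text{hyperbolic points of }h\}$ has $4$ equivalent connected components and $G^h\cong\mathbb{Z}_2\times\mathbb{Z}_2$. d) $h=x^4-x^2y^2+xy^3+Uy^4$; here $\{h=1\}\cap\{\text{hyperbolic points of }h\}$ has $4$ equivalent connected components and $G^h\cong\mathbb{Z}_2\times\mathbb{Z}_2$. The curve d) is singular at infinity, and the curves a), b) and c) are not singular at infinity.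
   Context: Let $h:\mathbb{R}^{n+1}\to\mathbb{R}$, $n\ge1$, be a homogeneous polynomial. A point $p$ is a hyperbolic point of $h$ if $-\partial^2h_p$ (minus the Hessian bilinear form of $h$ at $p$) has Lorentzian signature (exactly one negative and $n$ positive eigenvalues). $h$ is hyperbolic if it has a hyperbolic point. A quartic GPSR manifold of dimension $n$ is a hypersurface $\mathcal{H}\subset\mathbb{R}^{n+1}$ contained in $\{h=1\}$ for a hyperbolic homogeneous polynomial $h$ of degree $4$ and consisting only of hyperbolic points of $h$; it is a curve if $n=1$. It carries the Riemannian metric $g_{\mathcal{H}}=-\frac14\partial^2h|_{T\mathcal{H}\times T\mathcal{H}}$ (centro-affine fundamental form), and is called incomplete if $g_{\mathcal{H}}$ is not geodesically complete; for maximal connected quartic GPSR curves this is equivalent to $\mathcal{H}$ not being closed in $\mathbb{R}^2$. $\mathcal{H}$ is maximal connected if it is one connected component of $\{h=1\}\cap\{\text{hyperbolic points of }h\}$. Two GPSR manifolds $\mathcal{H},\overline{\mathcal{H}}\subset\mathbb{R}^{n+1}$ of the same dimension with defining polynomials of the same degree are equivalent if there is $A\in\mathrm{GL}(n+1)$ with $A(\mathcal{H})=\overline{\mathcal{H}}$; connected components are called equivalent in the same sense. In a) and b), different values of $K$ count as different curves in the list. A quartic GPSR curve $\mathcal{H}\subset\{h=1\}$ is in standard form if $(x,y)=(1,0)\in\mathcal{H}$ and $h=x^4-x^2y^2+Lxy^3+Ky^4$ for some $L,K\in\mathbb{R}$. $G^h=\{A\in\mathrm{GL}(n+1):h\circ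 A=h\}$ is the linear automorphism group of $h$. $\mathcal{H}\subset\{h=1\}$ is singular at infinity if there is a point $p\in\partial(\mathbb{R}_{>0}\cdot\mathcal{H})\setminus\{0\}$ (boundary in $\mathbb{R}^{n+1}$ of the cone spanned by $\mathcal{H}$) with $h(p)=0$ and $dh_p=0$.
   Formalization: In a), G^h ≅ Z_2 ⋉ Z_2 (order 4) is false: with k^4 = K, G^h contains the eight maps (±x, ±y) and (±ky, ±x/k); the formal statement instead proves G^h ≅ Z_2 ⋉ (Z_2 × Z_2), with Z_2 exchanging the factors, the dihedral group of order 8. *)

(* Defs.v *)
From mathcomp Require Import all_boot all_order all_algebra all_fingroup.
From mathcomp Require Import all_classical all_reals all_analysis.
(* The notations of mpoly.v clash with those of mathcomp-analysis. *)
From mathcomp Require Import -(notations) mpoly.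

Set Implicit Arguments.
Unset Strict Implicit.
Unset Printing Implicit Defensive.

Import Order.TTheory GRing.Theory Num.Theory.
Import numFieldNormedType.Exports.

Local Open Scope classical_set_scope.
Local Open Scope ring_scope.

Section Hypersurfaces.
Variables (R : realType) (n : nat).
Implicit Types (h : mpoly n.+1 R) (p u v w : 'cV[R]_n.+1).
Implicit Types (A : 'M[R]_n.+1) (H : set 'cV[R]_n.+1).

Definition ev h p : R := meval (fun i => p i ord0) h.

Definition d1 h p u : R := \sum_i ev (mderiv i h) p * u i ord0.

Definition hessian h p : 'M[R]_n.+1 :=
  \matrix_(i, j) ev (mderiv j (mderiv i h)) p.

Definition d2 h p u v : R :=
  \sum_i \sum_j ev (mderiv j (mderiv i h)) p * u i ord0 * v j ord0.

Definition d3 h p u v w : R :=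
  \sum_i \sum_j \sum_k
    ev (mderiv k (mderiv j (mderiv i h))) p * u i ord0 * v j ord0 * w k ord0.

(* One negative and n positive eigenvalues, counted with multiplicity. *)
Definition lorentzian A : Prop :=
  exists s : seq R,
    [/\ char_poly A = \prod_(x <- s) ('X - x%:P),
        count (fun x => x < 0) s = 1%N & count (fun x => 0 < x) s = n].

Definition hyperbolic_point h p : Prop := lorentzian (- hessian h p).

Definition hyperbolic h : Prop := exists p, hyperbolic_point h p.

Definition hyperbolic_level h : set 'cV[R]_n.+1 :=
  [set p | ev h p = 1 /\ hyperbolic_point h p].

Definition components h : set (set 'cV[R]_n.+1) :=
  [set connected_component (hyperbolic_level h) p | p in hyperbolic_level h].

(* Such an H is a hypersurface of its own accord: it is open in {h = 1}, which
   is regular because dh_p(p) = 4 h(p). *)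
Definition maximal_quartic_gpsr h H : Prop :=
  [/\ h \is ishomog1 4 mdeg, hyperbolic h & components h H].

(* Geodesic equation, on the whole real line, of the Levi-Civita connection of
   the metric g = - d2 h / 4 restricted to TH. The metric is the restriction of
   an ambient Hessian tensor, whose Christoffel symbols of the first kind are
   half its (totally symmetric) first derivatives; so the covariant
   acceleration of gamma, paired with a tangent vector X, is
   - (d2 h (gamma'', X) + d3 h (gamma', gamma', X) / 2) / 4. *)
Definition geodesic h H (gamma : R -> 'cV[R]_n.+1) : Prop :=
  [/\ forall t, H (gamma t),
      forall t, derivable gamma t 1,
      forall t, derivable (derive1 gamma) t 1 &
      forall t X, d1 h (gamma t) X = 0 ->
        - 4^-1 * (d2 h (gamma t) (derive1 (derive1 gamma) t) X
                  + 2^-1 * d3 h (gamma t) (derive1 gamma t) (derive1 gamma t) X) = 0].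

Definition geodesically_complete h H : Prop :=
  forall p v, H p -> d1 h p v = 0 ->
    exists gamma, [/\ geodesic h H gamma, gamma 0 = p & derive1 gamma 0 = v].

Definition incomplete h H : Prop := ~ geodesically_complete h H.

Definition equivalent H1 H2 : Prop :=
  exists2 A, A \in unitmx & [set A *m p | p in H1] = H2.

Definition automorphisms h : set 'M[R]_n.+1 :=
  [set A | A \in unitmx /\ forall p, ev h (A *m p) = ev h p].

Definition cone H : set 'cV[R]_n.+1 :=
  [set q | exists r p, [/\ 0 < r, H p & q = r *: p]].

Definition singular_at_infinity h H : Prop :=
  exists p, [/\ (closure (cone H) `\` interior (cone H)) p, p != 0,
                ev h p = 0 & forall v, d1 h p v = 0].

(* The group G of matrices, under multiplication, is isomorphic to gT. *)
Definition isomorphic_to (G : set 'M[R]_n.+1) (gT : finGroupType) : Prop :=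
  exists f : gT -> 'M[R]_n.+1,
    [/\ injective f, range f = G & forall a b, f (a * b)%g = f a *m f b].

Definition four_equivalent_components h : Prop :=
  (components h #= `I_4)%card /\
  forall C1 C2, components h C1 -> components h C2 -> equivalent C1 C2.

End Hypersurfaces.

Section StandardForm.
Variable R : realType.

Definition std_quartic (L K : R) : mpoly 2 R :=
  let x := mpolyX R (mnm1 (@ord0 1)) in
  let y := mpolyX R (mnm1 (@ord_max 1)) in
  x ^+ 4 - x ^+ 2 * y ^+ 2 + L *: (x * y ^+ 3) + K *: y ^+ 4.

Definition e1 : 'cV[R]_2 := \col_i (i == ord0)%:R.

Definition std_curve (L K : R) : set 'cV[R]_2 :=
  connected_component (hyperbolic_level (std_quartic L K)) e1.

Definition in_standard_form (h : mpoly 2 R) (H : set 'cV[R]_2) : Prop :=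
  H e1 /\ exists L K, h = std_quartic L K.

Definition U : R :=
  let s := Num.sqrt 57 in
  24^-1 * (4 + (31 + 3 * s) * (46 + 6 * s) `^ (- (1 / 3))
             + (100 + 12 * s) * (46 + 6 * s) `^ (- (2 / 3))).

Definition listed (L K : R) : Prop :=
  [\/ L = 0 /\ 1 / 4 < K,
      L = 1 /\ - (25 / 72) < K < U,
      L = 1 /\ K = - (25 / 72)
    | L = 1 /\ K = U].

End StandardForm.

Arguments U {R}.

(* The action of Z_2 on Z_2 x Z_2 that exchanges the two factors. *)
Definition swap (u : ('Z_2 * 'Z_2)%type) (a : 'Z_2) : ('Z_2 * 'Z_2)%type :=
  if a == 0 then u else (u.2, u.1).

Lemma swap1 : swap^~ 1%g =1 id.
Proof. by []. Qed.

Lemma swapM u : act_morph swap u.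
Proof.
move=> a b; rewrite /swap; case: u => u1 u2.
by case: a => [[|[|//]] ?]; case: b => [[|[|//]] ?].
Qed.

Canonical swap_action := TotalAction swap1 swapM.

Lemma swap_is_groupAction :
  is_groupAction [set: ('Z_2 * 'Z_2)%type]%SET swap_action.
Proof.
move=> a _; rewrite inE; apply/andP; split.
  by apply/fintype.subsetP => u _; rewrite inE.
apply/morphicP => u v _ _; rewrite !actpermE /= /swap.
by case: ifP.
Qed.

Canonical swap_groupAction := GroupAction swap_is_groupAction.

Definition Z2xZ2 : finGroupType := ('Z_2 * 'Z_2)%type.

(* The external semidirect product of Z_2 and Z_2 x Z_2, dihedral of order 8.
   A semidirect product of two groups of order 2 is always direct, so the group
   written "Z_2 semidirect Z_2" of x^4 - x^2 y^2 + K y^4, K > 1/4, has to be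
   this one: it consists of diag(+-1, +-1) and of the maps
   (x, y) |-> (+- k y, +- x / k) with k^4 = K. *)
Definition Z2_sdprod_Z2xZ2 : finGroupType := sdprod_by swap_groupAction.

(* Main.v *)
(* In standard form H is the arc of slopes t between the two nearest points t0 < 0 < t1 at which
   f(t) = h(1, t) or its Hessian determinant vanishes; both exist since f^(1/4) is concave on H.
   If f vanishes at both ends, the unit-speed field on slopes decays linearly there and every
   geodesic is defined for all times. If the Hessian vanishes at an end with f > 0, a geodesic
   reaches it in finite time. So H is incomplete iff it has an end at a point P of {h = 1} where
   the Hessian degenerates. Taking P as (1, 0) and its tangent as the second axis,
   h = x^4 + 4 b x y^3 + c y^4 with J = - b^2 and I = c, where I and J are the invariants of
   binary quartics, and H starts at P towards y > 0; hence H is determined up to equivalence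
   by I^3 : J^2, with J <= 0. The listed curves realise each ratio exactly once, c) being J = 0
   and d) being I^3 = 27 J^2.

   Components, automorphisms and singularities are read off from the equivalent even forms
   x^4 + 6 m x^2 y^2 + e y^4, whose hyperbolic arcs are cut out by the open quadrants. *)

Require Import Defs.
From mathcomp Require Import all_boot all_order all_algebra all_fingroup.
From mathcomp Require Import all_classical all_reals all_analysis.
From mathcomp Require Import -(notations) mpoly.
From mathcomp Require Import ring lra.

Set Implicit Arguments.
Unset Strict Implicit.
Unset Printing Implicit Defensive.

Import Order.TTheory GRing.Theory Num.Theory.
Import numFieldNormedType.Exports.

Local Open Scope ring_scope.

(** * Binary quartics and their invariants *)

(** The tangent spaces are lines, so a nonconstant geodesic is the same as a curve of constant
    nonzero speed. The second-order equation thus reduces to an autonomous first-order equation for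
    the slope, which a quadrature solves for all times; incompleteness needs only the first integral
    of an arbitrary geodesic, no uniqueness. Comparing two curves is local: components of one level
    set that share a point are equal, so a linear map that carries one polynomial to the other and a
    germ of one flat end to a germ of the other carries the whole curve. The other end is never
    located, and the same comparison serves both the classification and the passage to even forms.
    The ratio I^3 : J^2 alone is not enough for this: it sees neither the side from which the curve
    leaves P nor the sign of I when J = 0. Both are recovered from hyperbolicity along the germ,
    which forces b < 0, or b = 0 and c < 0. *)

Record quartic (R : Type) := Quartic {q0 : R; q1 : R; q2 : R; q3 : R; q4 : R}.

(** The binomial weights make the coefficients the values of the symmetric four-linear form [polar]
    on basis vectors, and give the invariants their classical shape. *)
Definition qf (R : realType) (a : quartic R) (x y : R) : R :=
  q0 a * x ^+ 4 + 4 * q1 a * x ^+ 3 * y + 6 * q2 a * x ^+ 2 * y ^+ 2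
  + 4 * q3 a * x * y ^+ 3 + q4 a * y ^+ 4.

(** Complete polarisation of [qf]: the derivatives of order 1, 2, 3 are 4, 12, 24 times its values,
    so that local computations become polynomial identities. *)
Definition polar (R : realType) (a : quartic R) (u v w z : R * R) : R :=
  q0 a * (u.1 * v.1 * w.1 * z.1)
  + q1 a * (u.2 * v.1 * w.1 * z.1 + u.1 * v.2 * w.1 * z.1
            + u.1 * v.1 * w.2 * z.1 + u.1 * v.1 * w.1 * z.2)
  + q2 a * (u.2 * v.2 * w.1 * z.1 + u.2 * v.1 * w.2 * z.1
            + u.2 * v.1 * w.1 * z.2 + u.1 * v.2 * w.2 * z.1
            + u.1 * v.2 * w.1 * z.2 + u.1 * v.1 * w.2 * z.2)
  + q3 a * (u.1 * v.2 * w.2 * z.2 + u.2 * v.1 * w.2 * z.2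
            + u.2 * v.2 * w.1 * z.2 + u.2 * v.2 * w.2 * z.1)
  + q4 a * (u.2 * v.2 * w.2 * z.2).

(* The Hessian determinant divided by 144. *)
Definition qh (R : realType) (a : quartic R) (x y : R) : R :=
  (q0 a * x ^+ 2 + 2 * q1 a * x * y + q2 a * y ^+ 2)
  * (q2 a * x ^+ 2 + 2 * q3 a * x * y + q4 a * y ^+ 2)
  - (q1 a * x ^+ 2 + 2 * q2 a * x * y + q3 a * y ^+ 2) ^+ 2.

(* The generators of the ring of invariants; the discriminant is qI^3 - 27 qJ^2. *)
Definition qI (R : realType) (a : quartic R) : R :=
  q0 a * q4 a - 4 * q1 a * q3 a + 3 * q2 a ^+ 2.

Definition qJ (R : realType) (a : quartic R) : R :=
  q0 a * q2 a * q4 a + 2 * q1 a * q2 a * q3 a - q2 a ^+ 3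
  - q0 a * q3 a ^+ 2 - q1 a ^+ 2 * q4 a.

Definition qsubst (R : realType) (a : quartic R) (p q r s : R) : quartic R :=
  let u := (p, r) in let v := (q, s) in
  Quartic (polar a u u u u) (polar a u u u v) (polar a u u v v)
          (polar a u v v v) (polar a v v v v).

Lemma qf_subst (R : realType) (a : quartic R) (p q r s x y : R) :
  qf (qsubst a p q r s) x y = qf a (p * x + q * y) (r * x + s * y).
Proof. rewrite /qf /qsubst /polar /=; ring. Qed.

Lemma qh_subst (R : realType) (a : quartic R) (p q r s x y : R) :
  qh (qsubst a p q r s) x y =
  (p * s - q * r) ^+ 2 * qh a (p * x + q * y) (r * x + s * y).
Proof. rewrite /qh /qsubst /polar /=; ring. Qed.

Lemma qI_subst (R : realType) (a : quartic R) (p q r s : R) :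
  qI (qsubst a p q r s) = (p * s - q * r) ^+ 4 * qI a.
Proof. rewrite /qI /qsubst /polar /=; ring. Qed.

Lemma qJ_subst (R : realType) (a : quartic R) (p q r s : R) :
  qJ (qsubst a p q r s) = (p * s - q * r) ^+ 6 * qJ a.
Proof. rewrite /qJ /qsubst /polar /=; ring. Qed.

(** [polar a p p] is a quadratic form of discriminant [qh a] at [p], and this is its Gram
    determinant on [p, v]. For [v] tangent to [{qf = 1}] at [p] it gives the speed as [qh] times the
    square of the area spanned by [p] and [v]. *)
Lemma polar_hessian (R : realType) (a : quartic R) (p v : R * R) :
  polar a p p p p * polar a p p v v - polar a p p p v ^+ 2 =
  qh a p.1 p.2 * (p.1 * v.2 - p.2 * v.1) ^+ 2.
Proof. rewrite /qh /polar; ring. Qed.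

Lemma polar_diag (R : realType) (a : quartic R) (p : R * R) :
  polar a p p p p = qf a p.1 p.2.
Proof. rewrite /qf /polar; ring. Qed.

(** * Coefficients and derivatives of the polynomial *)

Definition mform (R : realType) (a : quartic R) : mpoly 2 R :=
  let x := mpolyX R (mnm1 (@ord0 1)) in
  let y := mpolyX R (mnm1 (@ord_max 1)) in
  q0 a *: x ^+ 4 + (4 * q1 a) *: (x ^+ 3 * y) + (6 * q2 a) *: (x ^+ 2 * y ^+ 2)
  + (4 * q3 a) *: (x * y ^+ 3) + q4 a *: y ^+ 4.

Definition coords (R : realType) (p : 'cV[R]_2) : R * R :=
  (p ord0 ord0, p ord_max ord0).

Definition vec (R : realType) (x y : R) : 'cV[R]_2 :=
  \col_i (if i == ord0 then x else y).

Lemma coords_vec (R : realType) (x y : R) : coords (vec x y) = (x, y).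
Proof. by rewrite /coords !mxE. Qed.

Lemma ord2E (i : 'I_2) : i = ord0 \/ i = ord_max.
Proof.
by case: i => [[|[|//]]] h; [left|right]; apply: val_inj.
Qed.

Lemma colP2 (R : realType) (p q : 'cV[R]_2) : coords p = coords q -> p = q.
Proof.
move=> [h0 h1]; apply/matrixP => i j; rewrite ord1.
by case: (ord2E i) => ->.
Qed.

Lemma sum_ord2 (R : realType) (F : 'I_2 -> R) :
  \sum_i F i = F ord0 + F ord_max.
Proof. by rewrite big_ord_recl big_ord1; congr (_ + F _); apply: val_inj. Qed.

Lemma mulmx_coords (R : realType) (A : 'M[R]_2) (p : 'cV[R]_2) :
  coords (A *m p) =
  (A ord0 ord0 * (coords p).1 + A ord0 ord_max * (coords p).2,
   A ord_max ord0 * (coords p).1 + A ord_max ord_max * (coords p).2).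
Proof. by rewrite /coords !mxE !sum_ord2. Qed.

Lemma ev_mform (R : realType) (a : quartic R) (p : 'cV[R]_2) :
  ev (mform a) p = qf a (coords p).1 (coords p).2.
Proof.
rewrite /ev /mform !exprS !expr0 !mulr1.
rewrite !mevalD.
rewrite !mevalZ.
rewrite !mevalM.
rewrite !mevalXU. rewrite /qf /=.
ring.
Qed.

Definition mnm2 (k : nat) : multinom 2 :=
  Multinom [tuple (if i == ord0 then 4 - k else k)%N | i < 2].

Lemma mdeg_mnm2 (k : nat) : (k <= 4)%N -> mdeg (mnm2 k) = 4%N.
Proof.
by move=> k4; rewrite mdegE big_ord_recl big_ord1 !mnmE /= subnK.
Qed.

Lemma mform_monomials (R : realType) (a : quartic R) :
  mform a = q0 a *: mpolyX R (mnm2 0) + (4 * q1 a) *: mpolyX R (mnm2 1)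
   + (6 * q2 a) *: mpolyX R (mnm2 2) + (4 * q3 a) *: mpolyX R (mnm2 3)
   + q4 a *: mpolyX R (mnm2 4).
Proof.
rewrite /mform !mpolyXn -!mpolyXD.
do !congr (_ + _); congr (_ *: mpolyX _ _); apply/mnmP => i;
  by rewrite ?mnmDE ?mulmnE !mnmE; case: (ord2E i) => ->.
Qed.

Lemma mcoeff_mform (R : realType) (a : quartic R) m :
  mcoeff m (mform a) = q0 a * (mnm2 0 == m)%:R + 4 * q1 a * (mnm2 1 == m)%:R
   + 6 * q2 a * (mnm2 2 == m)%:R + 4 * q3 a * (mnm2 3 == m)%:R
   + q4 a * (mnm2 4 == m)%:R.
Proof. by rewrite mform_monomials !mcoeffD !mcoeffZ !mcoeffX. Qed.

Definition basis2 (R : realType) (i : 'I_2) : R * R :=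
  ((i == ord0)%:R, (i == ord_max)%:R).

Lemma mevalX2 (R : realType) (v : 'I_2 -> R) m :
  meval v (mpolyX R m) = v ord0 ^+ m ord0 * v ord_max ^+ m ord_max.
Proof.
by rewrite mevalX big_ord_recl big_ord1; congr (_ * v _ ^+ m _); apply: val_inj.
Qed.

Lemma ev_mderiv1 (R : realType) (a : quartic R) (p : 'cV[R]_2) (i : 'I_2) :
  let P := coords p in
  ev (mderiv i (mform a)) p = 4 * polar a P P P (basis2 R i).
Proof.
rewrite /ev mform_monomials !(mderivD, mderivZ) !mderivX.
rewrite !(mevalD, mevalZ) !mevalX2 !(mnmBE, mnmE).
by case: (ord2E i) => ->; rewrite /= !(subn0, subSS, sub0n) /polar /=; ring.
Qed.

Lemma ev_mderiv2 (R : realType) (a : quartic R) (p : 'cV[R]_2) (i j : 'I_2) :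
  let P := coords p in
  ev (mderiv j (mderiv i (mform a))) p =
  12 * polar a P P (basis2 R i) (basis2 R j).
Proof.
rewrite /ev mform_monomials !(mderivD, mderivZ) !mderivX.
rewrite !(mderivD, mderivZ) !mderivX.
rewrite !(mevalD, mevalZ) !mevalX2 !(mnmBE, mnmE).
by case: (ord2E i) => ->; case: (ord2E j) => ->; rewrite /= !(subn0, subSS, sub0n) /polar /=; ring.
Qed.

Lemma ev_mderiv3 (R : realType) (a : quartic R) (p : 'cV[R]_2) (i j k : 'I_2) :
  ev (mderiv k (mderiv j (mderiv i (mform a)))) p =
  24 * polar a (coords p) (basis2 R i) (basis2 R j) (basis2 R k).
Proof.
rewrite /ev mform_monomials !(mderivD, mderivZ) !mderivX.
rewrite !(mderivD, mderivZ) !mderivX !(mderivD, mderivZ) !mderivX.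
rewrite !(mevalD, mevalZ) !mevalX2 !(mnmBE, mnmE).
by case: (ord2E i) => ->; case: (ord2E j) => ->; case: (ord2E k) => ->;
  rewrite /= !(subn0, subSS, sub0n) /polar /=; ring.
Qed.

Lemma d1_mform (R : realType) (a : quartic R) (p u : 'cV[R]_2) :
  d1 (mform a) p u = 4 * polar a (coords p) (coords p) (coords p) (coords u).
Proof. by rewrite /d1 sum_ord2 !ev_mderiv1 /polar /=; ring. Qed.

Lemma d2_mform (R : realType) (a : quartic R) (p u v : 'cV[R]_2) :
  d2 (mform a) p u v = 12 * polar a (coords p) (coords p) (coords u) (coords v).
Proof. by rewrite /d2 !sum_ord2 !ev_mderiv2 /polar /=; ring. Qed.

Lemma d3_mform (R : realType) (a : quartic R) (p u v w : 'cV[R]_2) :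
  d3 (mform a) p u v w =
  24 * polar a (coords p) (coords u) (coords v) (coords w).
Proof. by rewrite /d3 !sum_ord2 !ev_mderiv3 /polar /=; ring. Qed.

Lemma std_quarticE (R : realType) (L K : R) :
  std_quartic L K = mform (Quartic 1 0 (- 6^-1) (L / 4) K).
Proof.
rewrite /std_quartic /mform /= scale1r mulr0 scale0r addr0.
rewrite mulrN divff ?pnatr_eq0// scaleN1r (mulrC 4) divfK ?pnatr_eq0//.
Qed.

(** A bidegree of total 4 is determined by its exponent in y, so five coefficients describe [h]; the
    divisions undo the binomial weights. *)
Lemma homog_mform (R : realType) (h : mpoly 2 R) :
  h \is ishomog1 4 mdeg -> exists a, h = mform a.
Proof.
move=> hh; pose c k := mcoeff (mnm2 k) h.
exists (Quartic (c 0%N) (c 1%N / 4) (c 2%N / 6) (c 3%N / 4) (c 4%N)).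
apply/mpolyP => m; rewrite mcoeff_mform /=.
have [hm|hm] := eqVneq (mdeg m) 4%N; last first.
  have ne k : (k <= 4)%N -> (mnm2 k == m) = false.
    by move=> k4; apply: contraNF hm => /eqP <-; rewrite mdeg_mnm2.
  by rewrite !ne// (dhomog_nemf_coeff hh hm) /=; ring.
move: hm; rewrite mdegE big_ord_recl big_ord1.
set i1 := lift _ _; have -> : i1 = ord_max by apply: val_inj.
move=> hm.
have mE k : (k <= 4)%N -> (mnm2 k == m) = (m ord_max == k).
  move=> k4; apply/eqP/eqP => [<-|mk]; first by rewrite mnmE.
  apply/mnmP => i; rewrite mnmE; case: (ord2E i) => -> /=; last by rewrite mk.
  by rewrite -hm mk addnK.
have -> : mcoeff m h = c (m ord_max).
  by congr mcoeff; apply/esym/eqP; rewrite mE// -hm leq_addl.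
rewrite !mE//; have : (m ord_max <= 4)%N by rewrite -hm leq_addl.
have divK (k x : R) : k != 0 -> k * (x / k) = x by move=> k0; rewrite mulrC divfK.
rewrite !divK ?pnatr_eq0//.
clear -c; clearbody c; move: (m ord_max) => k.
by case: k => [|[|[|[|[|//]]]]] _ /=;
  rewrite !(mulr0, mulr1, add0r, addr0).
Qed.

Lemma mform_homog (R : realType) (a : quartic R) : mform a \is ishomog1 4 mdeg.
Proof.
apply/dhomogP => m; rewrite mcoeff_msupp mcoeff_mform; apply: contraNeq => hm.
have ne k : (k <= 4)%N -> (mnm2 k == m) = false.
  by move=> k4; apply: contraNF hm => /eqP <-; apply/eqP/mdeg_mnm2.
by rewrite !ne//=; apply/eqP; ring.
Qed.

(** * Lorentzian signature in dimension two *)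

Lemma det2 (K : comNzRingType) (A : 'M[K]_2) :
  \det A = A ord0 ord0 * A ord_max ord_max - A ord0 ord_max * A ord_max ord0.
Proof.
rewrite (expand_det_row _ ord0) big_ord_recl big_ord1 /cofactor !det_mx11 !mxE.
have -> : lift ord0 ord0 = ord_max :> 'I_2 by apply: val_inj.
have -> : lift ord_max ord0 = ord0 :> 'I_2 by apply: val_inj.
by rewrite /= expr0 expr1 mul1r mulN1r mulrN.
Qed.

Lemma char_poly2 (K : comNzRingType) (A : 'M[K]_2) :
  char_poly A =
  'X^2 - (A ord0 ord0 + A ord_max ord_max)%:P * 'X + (\det A)%:P.
Proof.
rewrite /char_poly !det2 !mxE /= !(mulr0n, mulr1n, polyCB, polyCD, polyCM).
ring.
Qed.

(** Two eigenvalues, one of each sign, have a negative product. Conversely a negative determinant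
    makes the discriminant of the characteristic polynomial nonnegative, and the roots are then
    [(b - r) / 2 < 0 < (b + r) / 2]. *)
Lemma lorentzian_det (R : realType) (A : 'M[R]_2) :
  A^T = A -> lorentzian A <-> \det A < 0.
Proof.
move=> At; have Asym : A ord_max ord0 = A ord0 ord_max by rewrite -{1}At mxE.
rewrite /lorentzian char_poly2; set b := A ord0 ord0 + A ord_max ord_max.
split.
  case=> s [sE].
  have : size s = 2%N.
    apply: succn_inj; rewrite -(size_prod_XsubC s idfun) -sE -char_poly2.
    by rewrite size_char_poly.
  case: s sE => [|x [|y [|]]]//=; rewrite !big_cons big_nil mulr1.
  move=> /(congr1 (fun p => p.[0])); rewrite !hornerE /= => dE _.
  have {dE} -> : \det A = x * y by move: dE; rewrite !expr0n /=; lra.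
  by have [x0|x0|->] := ltgtP x 0; have [y0|y0|->] := ltgtP y 0 => //= _ _; nra.
move=> d0; set d := \det A in d0 *.
have D0 : 0 <= b ^+ 2 - 4 * d by nra.
pose r := Num.sqrt (b ^+ 2 - 4 * d).
have rE : r ^+ 2 = b ^+ 2 - 4 * d by rewrite sqr_sqrtr.
have r0 : 0 <= r by rewrite sqrtr_ge0.
have [x [y [x0 y0 -> ->]]] :
    exists x y, [/\ x < 0, 0 < y, b = x + y & d = x * y].
  by exists ((b - r) / 2), ((b + r) / 2); split; [nra | nra | field | field: rE].
exists [:: x; y]; split.
- by rewrite !big_cons big_nil polyCD polyCM; ring.
- by rewrite /= x0 (lt_gtF y0).
- by rewrite /= y0 (lt_gtF x0).
Qed.

Lemma hyperbolic_pointE (R : realType) (a : quartic R) (p : 'cV[R]_2) :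
  hyperbolic_point (mform a) p <-> qh a (coords p).1 (coords p).2 < 0.
Proof.
rewrite /hyperbolic_point lorentzian_det; last first.
  by apply/matrixP => i j; rewrite !mxE !ev_mderiv2 /polar; ring.
have -> : \det (- hessian (mform a) p) =
          144 * qh a (coords p).1 (coords p).2.
  by rewrite det2 !mxE !ev_mderiv2 /polar /qh /=; ring.
by rewrite pmulr_rlt0.
Qed.

Local Open Scope classical_set_scope.

(** * Linear changes of coordinates *)

Lemma mx_continuous (T : topologicalType) (R : realType) (m n : nat)
    (f : T -> 'M[R]_(m, n)) (t : T) :
  (forall i j, {for t, continuous (fun x => f x i j)}) -> {for t, continuous f}.
Proof.
move=> fc A [P nP sPA]; rewrite /= nbhs_simpl.
apply: filterS sPA _ => //=.
suff : \forall x \near t, forall ij : 'I_m * 'I_n, P ij.1 ij.2 (f x ij.1 ij.2).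
  by apply: filterS => x Px i j; exact: (Px (i, j)).
by apply: filter_forall => -[i j]; exact: (fc i j).
Qed.

Lemma mulmx_continuous (R : realType) (A : 'M[R]_2) :
  continuous (fun p : 'cV[R]_2 => A *m p).
Proof.
move=> p; apply: mx_continuous => i j.
rewrite (_ : (fun q : 'cV[R]_2 => (A *m q) i j) =
  (fun q => A i ord0 * q ord0 j + A i ord_max * q ord_max j)); last first.
  by apply/funext => q; rewrite !mxE sum_ord2.
by apply: continuousD; (apply: continuousM; [exact: cst_continuous | exact: coord_continuous]).
Qed.

(** [C] is relatively open and closed in [S], so a connected part of [S] that meets it stays inside.
    For the arcs below, [O] and [F] are an open sector and the corresponding closed one. *)
Lemma connected_component_clopen (T : topologicalType) (S C O F : set T) (p : T) :
  C p -> connected C -> open O -> closed F -> C = S `&` O -> C = S `&` F ->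
  connected_component S p = C.
Proof.
move=> Cp Cc oO cF CO CF; apply/seteqP; split; last first.
  by apply: connected_component_max => //; rewrite CO => x [].
move=> x [B [Bp BS Bc Bx]].
suff BC : B `&` C = B by move: Bx; rewrite -BC => -[].
have BSE D : B `&` (S `&` D) = B `&` D by rewrite setIA (setIidl BS).
apply: Bc; first by exists p.
- by exists O => //; rewrite CO BSE.
- by exists F => //; rewrite CF BSE.
Qed.

Definition msubst (R : realType) (a : quartic R) (A : 'M[R]_2) : quartic R :=
  qsubst a (A ord0 ord0) (A ord0 ord_max) (A ord_max ord0) (A ord_max ord_max).

Lemma qf_msubst (R : realType) (a : quartic R) (A : 'M[R]_2) (p : 'cV[R]_2) :
  qf (msubst a A) (coords p).1 (coords p).2 =
  qf a (coords (A *m p)).1 (coords (A *m p)).2.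
Proof. by rewrite qf_subst mulmx_coords. Qed.

Lemma qh_msubst (R : realType) (a : quartic R) (A : 'M[R]_2) (p : 'cV[R]_2) :
  qh (msubst a A) (coords p).1 (coords p).2 =
  \det A ^+ 2 * qh a (coords (A *m p)).1 (coords (A *m p)).2.
Proof. by rewrite qh_subst mulmx_coords det2. Qed.

Lemma polar_msubst (R : realType) (a : quartic R) (A : 'M[R]_2)
    (u v w z : 'cV[R]_2) :
  polar (msubst a A) (coords u) (coords v) (coords w) (coords z) =
  polar a (coords (A *m u)) (coords (A *m v)) (coords (A *m w)) (coords (A *m z)).
Proof. rewrite !mulmx_coords /msubst /qsubst /polar /=; ring. Qed.

Lemma quartic_eq (R : realType) (a b : quartic R) :
  q0 a = q0 b -> q1 a = q1 b -> q2 a = q2 b -> q3 a = q3 b -> q4 a = q4 b -> a = b.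
Proof. by case: a b => ? ? ? ? ? [? ? ? ? ?] /= -> -> -> -> ->. Qed.

Lemma msubstM (R : realType) (a : quartic R) (A B : 'M[R]_2) :
  msubst (msubst a A) B = msubst a (A *m B).
Proof.
have mE i j : (A *m B) i j = A i ord0 * B ord0 j + A i ord_max * B ord_max j.
  by rewrite mxE sum_ord2.
by rewrite /msubst /qsubst !mE; apply: quartic_eq; rewrite /polar /=; ring.
Qed.

Lemma msubst1 (R : realType) (a : quartic R) : msubst a 1%:M = a.
Proof. by apply: quartic_eq; rewrite /= !mxE /= /polar /=; ring. Qed.

Lemma unitmx2 (R : realType) (A : 'M[R]_2) : (A \in unitmx) = (\det A != 0).
Proof. by rewrite unitmxE unitfE. Qed.

Lemma hyperbolic_levelE (R : realType) (a : quartic R) (p : 'cV[R]_2) :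
  hyperbolic_level (mform a) p <->
  qf a (coords p).1 (coords p).2 = 1 /\ qh a (coords p).1 (coords p).2 < 0.
Proof.
rewrite /hyperbolic_level /= ev_mform.
by split=> -[-> /hyperbolic_pointE].
Qed.

Lemma hyperbolic_level_msubst (R : realType) (a : quartic R) (A : 'M[R]_2)
    (p : 'cV[R]_2) : A \in unitmx ->
  hyperbolic_level (mform (msubst a A)) p <-> hyperbolic_level (mform a) (A *m p).
Proof.
rewrite unitmx2 => A0; rewrite !hyperbolic_levelE qf_msubst qh_msubst.
by rewrite pmulr_rlt0// exprn_even_gt0.
Qed.

Lemma image_mulmx_id (R : realType) (A B : 'M[R]_2) (H : set 'cV[R]_2) :
  A *m B = 1%:M -> [set A *m p | p in [set B *m p | p in H]] = H.
Proof.
move=> AB; rewrite image_comp -[RHS]image_id; apply: eq_imagel => p _ /=.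
by rewrite mulmxA AB mul1mx.
Qed.

Lemma connected_component_msubst_sub (R : realType) (a : quartic R)
    (A : 'M[R]_2) (p : 'cV[R]_2) : A \in unitmx ->
  hyperbolic_level (mform (msubst a A)) p ->
  [set A *m q | q in connected_component (hyperbolic_level (mform (msubst a A))) p]
  `<=` connected_component (hyperbolic_level (mform a)) (A *m p).
Proof.
move=> Au Sp; apply: connected_component_max.
- by exists p => //; exact: connected_component_refl.
- move=> _ [q /connected_component_sub Sq <-].
  exact: (iffLR (hyperbolic_level_msubst _ _ Au) Sq).
- apply: connected_continuous_connected; first exact: component_connected.
  exact/continuous_subspaceT/mulmx_continuous.
Qed.

(** The inclusion above, applied to [A] and to its inverse, gives both directions. *)
Lemma connected_component_msubst (R : realType) (a : quartic R)
    (A : 'M[R]_2) (p : 'cV[R]_2) : A \in unitmx ->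
  hyperbolic_level (mform (msubst a A)) p ->
  [set A *m q | q in connected_component (hyperbolic_level (mform (msubst a A))) p]
  = connected_component (hyperbolic_level (mform a)) (A *m p).
Proof.
move=> Au Sp; apply/seteqP; split; first exact: connected_component_msubst_sub.
have SAp : hyperbolic_level (mform a) (A *m p).
  exact: (iffLR (hyperbolic_level_msubst _ _ Au) Sp).
rewrite -[X in X `<=` _](@image_mulmx_id _ A (invmx A)) ?mulmxV//.
apply: image_subset.
have aE : a = msubst (msubst a A) (invmx A) by rewrite msubstM mulmxV// msubst1.
have := @connected_component_msubst_sub R (msubst a A) (invmx A) (A *m p).
by rewrite -aE mulKmx//; apply; rewrite ?unitmx_inv.
Qed.

Lemma components_msubst (R : realType) (a : quartic R) (A : 'M[R]_2)
    (H : set 'cV[R]_2) : A \in unitmx ->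
  components (mform (msubst a A)) H ->
  components (mform a) [set A *m q | q in H].
Proof.
move=> Au [p Sp <-]; exists (A *m p); first exact: (iffLR (hyperbolic_level_msubst _ _ Au) Sp).
by rewrite connected_component_msubst.
Qed.

Lemma components_eq (R : realType) (n : nat) (h : mpoly n.+1 R) (H1 H2 : set 'cV[R]_n.+1) p :
  components h H1 -> components h H2 -> H1 p -> H2 p -> H1 = H2.
Proof.
move=> [p1 S1 <-] [p2 S2 <-] /same_connected_component -> .
by move=> /same_connected_component ->.
Qed.

(** * Arcs of the level set and their ends *)

(** This is [f ^ (-1/4)], the factor that brings a vector of value [f] to the level 1. For [f <= 0]
    it is 0 by the conventions for square root and inverse, so that [pt] is then the origin and lies
    outside the level set; [level_pt_inv] relies on this. *)
Definition rad (R : realType) (f : R) : R := (Num.sqrt (Num.sqrt f))^-1.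

Lemma rad_gt0 (R : realType) (f : R) : 0 < f -> 0 < rad f.
Proof. by move=> f0; rewrite invr_gt0 !sqrtr_gt0. Qed.

Lemma rad4 (R : realType) (f : R) : 0 < f -> rad f ^+ 4 = f^-1.
Proof.
move=> f0; rewrite /rad exprVn; congr _^-1.
by rewrite (exprM _ 2 2) !sqr_sqrtr ?sqrtr_ge0 ?ltW.
Qed.

Definition pt (R : realType) (a : quartic R) (t : R) : 'cV[R]_2 :=
  let r := rad (qf a 1 t) in vec r (r * t).

Lemma qf_scale (R : realType) (a : quartic R) (r x y : R) :
  qf a (r * x) (r * y) = r ^+ 4 * qf a x y.
Proof. rewrite /qf; ring. Qed.

Lemma qh_scale (R : realType) (a : quartic R) (r x y : R) :
  qh a (r * x) (r * y) = r ^+ 4 * qh a x y.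
Proof. rewrite /qh; ring. Qed.

Lemma coords_pt (R : realType) (a : quartic R) (t : R) :
  coords (pt a t) = (rad (qf a 1 t) * 1, rad (qf a 1 t) * t).
Proof. by rewrite /pt coords_vec mulr1. Qed.

Lemma qf_pt (R : realType) (a : quartic R) (t : R) : 0 < qf a 1 t ->
  qf a (coords (pt a t)).1 (coords (pt a t)).2 = 1.
Proof. by move=> f0; rewrite coords_pt /= qf_scale rad4// mulVf// gt_eqF. Qed.

Lemma qh_pt (R : realType) (a : quartic R) (t : R) : 0 < qf a 1 t ->
  qh a (coords (pt a t)).1 (coords (pt a t)).2 = qh a 1 t / qf a 1 t.
Proof. by move=> f0; rewrite coords_pt /= qh_scale rad4// mulrC. Qed.

Lemma level_pt (R : realType) (a : quartic R) (t : R) :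
  0 < qf a 1 t -> qh a 1 t < 0 -> hyperbolic_level (mform a) (pt a t).
Proof.
move=> f0 h0; rewrite hyperbolic_levelE qf_pt// qh_pt//; split=> //.
by rewrite pmulr_llt0 ?invr_gt0.
Qed.

Lemma slope_scale (R : realType) (a : quartic R) (x y : R) : x != 0 ->
  qf a x y = x ^+ 4 * qf a 1 (y / x) /\ qh a x y = x ^+ 4 * qh a 1 (y / x).
Proof.
move=> x0; rewrite -qf_scale -qh_scale mulr1 mulrC divfK//.
Qed.

Lemma pt_slope (R : realType) (a : quartic R) (p : 'cV[R]_2) :
  0 < (coords p).1 -> qf a (coords p).1 (coords p).2 = 1 ->
  p = pt a ((coords p).2 / (coords p).1) /\
  0 < qf a 1 ((coords p).2 / (coords p).1).
Proof.
case E : (coords p) => [x y] /= x0.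
have [-> _] := slope_scale a y (lt0r_neq0 x0) => e.
set f := qf a 1 (y / x) in e *.
have x4 : 0 < x ^+ 4 by rewrite exprn_gt0.
have f0 : 0 < f by rewrite -(pmulr_rgt0 _ x4) e.
split=> //; apply: colP2; rewrite E coords_pt.
suff -> : rad (qf a 1 (y / x)) = x by rewrite mulr1 mulrC divfK ?gt_eqF.
apply/eqP; rewrite -(@eqrXn2 _ 4)// ?(ltW (rad_gt0 _)) ?(ltW x0)//.
by apply/eqP; apply: (mulIf (lt0r_neq0 f0)); rewrite -/f rad4// mulVf ?gt_eqF// e.
Qed.

Lemma level_slope (R : realType) (a : quartic R) (p : 'cV[R]_2) :
  0 < (coords p).1 -> hyperbolic_level (mform a) p ->
  let t := (coords p).2 / (coords p).1 in
  [/\ p = pt a t, 0 < qf a 1 t & qh a 1 t < 0].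
Proof.
move=> x0 /hyperbolic_levelE [e h] t; have [pE f0] := pt_slope x0 e.
split=> //; move: h; have [_ ->] := slope_scale a (coords p).2 (lt0r_neq0 x0).
by rewrite pmulr_rlt0// exprn_gt0.
Qed.

Lemma qf1_continuous (R : realType) (a : quartic R) : continuous (qf a 1).
Proof.
move=> t; rewrite (_ : qf a 1 = horner (Poly [:: q0 a; 4 * q1 a; 6 * q2 a; 4 * q3 a; q4 a])).
  exact: continuous_horner.
by apply/funext => x; rewrite /qf horner_Poly /=; ring.
Qed.

Lemma qh1_continuous (R : realType) (a : quartic R) : continuous (qh a 1).
Proof.
move=> t; rewrite (_ : qh a 1 = horner (
  ((q0 a)%:P + (2 * q1 a) *: 'X + q2 a *: 'X^2)
  * ((q2 a)%:P + (2 * q3 a) *: 'X + q4 a *: 'X^2)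
  - ((q1 a)%:P + (2 * q2 a) *: 'X + q3 a *: 'X^2) ^+ 2)).
  exact: continuous_horner.
by apply/funext => x; rewrite /qh !(hornerD, hornerN, hornerM, hornerZ, hornerX, hornerXn, hornerC) /=; ring.
Qed.

Lemma pt_continuous (R : realType) (a : quartic R) (t : R) :
  0 < qf a 1 t -> {for t, continuous (pt a)}.
Proof.
move=> f0.
have rc : {for t, continuous (fun t => rad (qf a 1 t))}.
  apply: continuousV; first by rewrite gt_eqF// !sqrtr_gt0.
  apply: continuous_comp; last exact: sqrt_continuous.
  apply: continuous_comp; last exact: sqrt_continuous.
  exact: qf1_continuous.
apply: mx_continuous => i j.
have [-> |->] := ord2E i.
  rewrite (_ : (fun t => pt a t ord0 j) = (fun t => rad (qf a 1 t)))//.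
  by apply/funext => x; rewrite mxE.
rewrite (_ : (fun t => pt a t ord_max j) = (fun t => rad (qf a 1 t) * t)).
  by apply: continuousM => //; exact: cvg_id.
by apply/funext => x; rewrite mxE.
Qed.

Lemma arc_connected (R : realType) (a : quartic R) (I : set R) :
  is_interval I -> (forall t, I t -> 0 < qf a 1 t) -> connected (pt a @` I).
Proof.
move=> Ii f0; apply: connected_continuous_connected.
  exact/connected_intervalP.
apply: continuous_in_subspaceT => t; rewrite inE => It.
exact: pt_continuous (f0 _ It).
Qed.

Lemma arc_sub_component (R : realType) (a : quartic R) (I : set R)
    (H : set 'cV[R]_2) (t0 : R) : is_interval I ->
  (forall t, I t -> 0 < qf a 1 t /\ qh a 1 t < 0) ->
  components (mform a) H -> I t0 -> H (pt a t0) ->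
  forall t, I t -> H (pt a t).
Proof.
move=> Ii fh [p Sp <-] It0 /same_connected_component -> t It.
suff : pt a @` I `<=` connected_component (hyperbolic_level (mform a)) (pt a t0).
  by apply; exists t.
apply: connected_component_max; first by exists t0.
- by move=> _ [s /fh[f0 h0] <-]; exact: level_pt.
- by apply: arc_connected => // s /fh[].
Qed.

Definition mx2 (R : realType) (p q r s : R) : 'M[R]_2 :=
  \matrix_(i, j) if j == ord0 then (if i == ord0 then p else r)
                 else (if i == ord0 then q else s).

Lemma msubst_mx2 (R : realType) (a : quartic R) (p q r s : R) :
  msubst a (mx2 p q r s) = qsubst a p q r s.
Proof. by rewrite /msubst !mxE. Qed.

Lemma det_mx2 (R : realType) (p q r s : R) : \det (mx2 p q r s) = p * s - q * r.
Proof. by rewrite det2 !mxE. Qed.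

(** On slopes [M] acts as a Moebius map; [0 < x] says that the image of the ray stays in the right
    half-plane, where the slope determines the ray. *)
Lemma mulmx_pt (R : realType) (a : quartic R) (M : 'M[R]_2) (s : R) :
  let x := M ord0 ord0 + M ord0 ord_max * s in
  let t := (M ord_max ord0 + M ord_max ord_max * s) / x in
  0 < x -> 0 < qf a 1 t ->
  M *m pt (msubst a M) s = pt a t /\ 0 < qf (msubst a M) 1 s.
Proof.
move=> x t x0 f0.
have fE : qf (msubst a M) 1 s = x ^+ 4 * qf a 1 t.
  by rewrite qf_subst !mulr1 -(slope_scale _ _ (lt0r_neq0 x0)).1.
have fM0 : 0 < qf (msubst a M) 1 s by rewrite fE mulr_gt0// exprn_gt0.
have r0 := rad_gt0 fM0.
split=> //; set p := M *m _.
have pE : coords p = (rad (qf (msubst a M) 1 s) * x,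
    rad (qf (msubst a M) 1 s) * (M ord_max ord0 + M ord_max ord_max * s)).
  rewrite /p mulmx_coords coords_pt /= /x; congr (_, _); ring.
have [| |-> _] := @pt_slope R a p.
- by rewrite pE mulr_gt0.
- by rewrite -qf_msubst qf_pt.
- by congr pt; rewrite pE /= -mulf_div divff ?mul1r// gt_eqF.
Qed.

(* H has an end at B e1, a point of {h = 1} with degenerate Hessian; the columns of B are this
   point and a tangent vector to the level curve. *)
Definition good_end (R : realType) (a : quartic R) (H : set 'cV[R]_2) : Prop :=
  exists B d, [/\ B \in unitmx, 0 < d,
    [/\ q0 (msubst a B) = 1, q1 (msubst a B) = 0 & q2 (msubst a B) = 0] &
    forall s, 0 < s < d -> H (B *m pt (msubst a B) s)].

(** In the frame formed by the end [P = (u, u t1)] and the tangent vector [(P2, - P1)], [q0] is the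
    value at [P], [q1] is proportional to the derivative along the tangent, and [q2] is then the
    Hessian determinant, which vanishes. The frame has determinant -1, so slopes just below [t1]
    correspond to small [s > 0]. *)
Lemma good_end_left_limit (R : realType) (a : quartic R) (H : set 'cV[R]_2)
    (t1 d : R) : 0 < d -> 0 < qf a 1 t1 -> qh a 1 t1 = 0 ->
  (forall t, t1 - d < t < t1 -> 0 < qf a 1 t /\ H (pt a t)) -> good_end a H.
Proof.
move=> d0 f0 h0 Ht.
pose u := rad (qf a 1 t1); have u0 : 0 < u by exact: rad_gt0.
pose P := (u, u * t1).
pose P1 := polar a P P P (1, 0); pose P2 := polar a P P P (0, 1).
have PE : u * P1 + u * t1 * P2 = 1.
  rewrite -(qf_pt f0) coords_pt -/u mulr1 /qf /P1 /P2 /polar /=; ring.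
pose B := mx2 u P2 (u * t1) (- P1).
have detE : u * - P1 - P2 * (u * t1) = -1 by rewrite -PE; ring.
have Bu : B \in unitmx by rewrite unitmx2 det_mx2 detE oppr_eq0 oner_eq0.
have aB0 : q0 (msubst a B) = 1.
  by rewrite msubst_mx2 /= -PE /P1 /P2 /P /polar /=; ring.
have aB1 : q1 (msubst a B) = 0.
  by rewrite msubst_mx2 /= /P1 /P2 /P /polar /=; ring.
have aB2 : q2 (msubst a B) = 0.
  have : qh (msubst a B) 1 0 = 0.
    rewrite msubst_mx2 qh_subst !mulr0 !addr0 (mulr1 (u * t1)) qh_scale h0; ring.
  by rewrite /qh aB0 aB1 => <-; ring.
have P2u : 0 < u / (2 * (`|P2| + 1)).
  by rewrite divr_gt0// mulr_gt0// ltr_wpDl.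
(* The first bound keeps the denominator [u + P2 s] above [u / 2]; the second then puts the slope
   within [d] of [t1]. *)
exists B, (Num.min (u / (2 * (`|P2| + 1))) (d * u ^+ 2 / 2)); split=> //.
  by rewrite lt_min P2u /= divr_gt0// mulr_gt0// exprn_gt0.
move=> s /andP[s0]; rewrite lt_min => /andP[s1 s2].
have xs : u / 2 < u + P2 * s.
  have : s * (2 * (`|P2| + 1)) < u.
    by rewrite -ltr_pdivlMr// mulr_gt0// ltr_wpDl.
  have : - `|P2| <= P2 by rewrite lerNl -normrN ler_norm.
  by nra.
have x0 : 0 < u + P2 * s by rewrite (lt_trans _ xs)// divr_gt0.
pose t := (u * t1 - P1 * s) / (u + P2 * s).
have tE : t1 - t = s / (u * (u + P2 * s)).
  have -> : t1 - t = s * (u * P1 + u * t1 * P2) / (u * (u + P2 * s)).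
    by rewrite /t; field; rewrite !gt_eqF.
  by rewrite PE mulr1.
have tt1 : 0 < t1 - t by rewrite tE divr_gt0// mulr_gt0.
have tt2 : t1 - t < d.
  rewrite tE ltr_pdivrMr ?mulr_gt0// (lt_trans s2)// ltr_pdivrMr// -!mulrA.
  rewrite ltr_pM2l// expr2 ltr_pM2l//; lra.
have [|f0t Htt] := Ht t; first by apply/andP; split; lra.
have [] := @mulmx_pt R a B s.
- by rewrite !mxE.
- by rewrite !mxE mulNr.
- by rewrite !mxE mulNr => -> _.
Qed.

Lemma cube_inj (R : realType) (x y : R) : x ^+ 3 = y ^+ 3 -> x = y.
Proof.
move=> e; have : (x - y) * (x ^+ 2 + x * y + y ^+ 2) = x ^+ 3 - y ^+ 3 by ring.
rewrite e subrr => /eqP; rewrite mulf_eq0 => /orP[|]; first by rewrite subr_eq0 => /eqP.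
move=> /eqP q0; have h1 := sqr_ge0 (y + x / 2); have h2 := sqr_ge0 (x + y / 2).
have x2 : x ^+ 2 <= 0 by nra.
have y2 : y ^+ 2 <= 0 by nra.
have zero z : z ^+ 2 <= 0 -> z = 0 :> R.
  by move=> z2; apply/eqP; rewrite -sqrf_eq0 eq_le z2 sqr_ge0.
by rewrite (zero x x2) (zero y y2).
Qed.

Lemma cbrt_exists (R : realType) (x : R) : 0 < x -> exists2 m, 0 < m & m ^+ 3 = x.
Proof.
move=> x0; exists (x `^ 3^-1); first exact: powR_gt0.
by rewrite -powR_mulrn ?powR_ge0// -powRrM mulVf ?pnatr_eq0// powRr1 ?ltW.
Qed.

Lemma fourth_root_exists (R : realType) (x : R) : 0 < x ->
  exists2 m, 0 < m & m ^+ 4 = x.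
Proof.
move=> x0; exists (Num.sqrt (Num.sqrt x)); first by rewrite !sqrtr_gt0.
by rewrite (exprM _ 2 2) !sqr_sqrtr ?sqrtr_ge0 ?ltW.
Qed.

Lemma good_end_invariants (R : realType) (a : quartic R) (H : set 'cV[R]_2)
    (B : 'M[R]_2) : B \in unitmx ->
  q0 (msubst a B) = 1 -> q1 (msubst a B) = 0 -> q2 (msubst a B) = 0 ->
  \det B ^+ 4 * qI a = q4 (msubst a B) /\
  \det B ^+ 6 * qJ a = - q3 (msubst a B) ^+ 2.
Proof.
move=> Bu b0 b1 b2; rewrite det2 -qI_subst -qJ_subst -/(msubst a B).
by rewrite /qI /qJ b0 b1 b2; split; ring.
Qed.

Lemma level_pt_inv (R : realType) (a : quartic R) (t : R) :
  hyperbolic_level (mform a) (pt a t) -> 0 < qf a 1 t /\ qh a 1 t < 0.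
Proof.
move=> /hyperbolic_levelE; have [f0|f0] := ltP 0 (qf a 1 t).
  rewrite qh_pt// pmulr_llt0 ?invr_gt0//; by case.
rewrite coords_pt /= qf_scale /rad (ler0_sqrtr f0) sqrtr0 invr0 expr0n mul0r.
by case=> /esym/eqP; rewrite oner_eq0.
Qed.

(** In the adapted frame [qh] at slope [s] is [2 q3 s + q4 s^2 - q3^2 s^4]; it has to be negative
    for all small [s > 0], so its first nonzero coefficient is negative. *)
Lemma good_end_sign (R : realType) (a : quartic R) (H : set 'cV[R]_2)
    (B : 'M[R]_2) (d : R) : components (mform a) H -> B \in unitmx -> 0 < d ->
  q0 (msubst a B) = 1 -> q1 (msubst a B) = 0 -> q2 (msubst a B) = 0 ->
  (forall s, 0 < s < d -> H (B *m pt (msubst a B) s)) ->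
  q3 (msubst a B) < 0 \/ q3 (msubst a B) = 0 /\ q4 (msubst a B) < 0.
Proof.
move=> [p Sp <-] Bu d0 b0 b1 b2 HB.
set b := msubst a B in b0 b1 b2 HB *.
have neg s : 0 < s < d -> s * (2 * q3 b + q4 b * s - q3 b ^+ 2 * s ^+ 3) < 0.
  move=> /HB /connected_component_sub.
  move=> /(iffRL (hyperbolic_level_msubst _ _ Bu)); rewrite -/b.
  by move=> /level_pt_inv[_]; rewrite /qh b0 b1 b2; congr (_ < 0); ring.
have [c3|c3|c3] := ltgtP (q3 b) 0; first by left.
(* Small enough that [q3] outweighs the two other terms of the bracket. *)
- pose s := Num.min (d / 2) (Num.min 1 (q3 b / (`|q4 b| + q3 b ^+ 2 + 1))).
  have D0 : 0 < `|q4 b| + q3 b ^+ 2 + 1 by rewrite ltr_wpDl// addr_ge0// sqr_ge0.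
  have s0 : 0 < s by rewrite !lt_min ltr01 !divr_gt0.
  have s1 : s <= 1 by rewrite !ge_min lexx orbT.
  have s2 : s < d by rewrite gt_min; apply/orP; left; lra.
  have s3 : s * (`|q4 b| + q3 b ^+ 2 + 1) <= q3 b.
    by rewrite -ler_pdivlMr// !ge_min lexx !orbT.
  have := neg s; rewrite s0 s2 => /(_ isT); rewrite pmulr_rlt0//.
  have h : - `|q4 b| <= q4 b by rewrite lerNl -normrN ler_norm.
  have h2 : q3 b ^+ 2 * s ^+ 3 <= q3 b ^+ 2 * s.
    by rewrite ler_wpM2l ?sqr_ge0// -[leRHS]expr1 ler_wiXn2l// ltW.
  by nra.
- right; split=> //; have := neg (d / 2); rewrite c3 !expr0n /=.
  by rewrite divr_gt0//= => /(_ ltac:(lra)) => h; nra.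
Qed.

(** The two adapted forms differ by [y -> m y] with [m > 0] once [q3 b = m^3 q3 b'] and
    [q4 b = m^4 q4 b']. If [q3] is nonzero, [m] is the cube root of the quotient of the [q3], and
    the equality of ratios gives the second equation after taking cubes; otherwise [m] is the fourth
    root of the quotient of the [q4], both negative. [B' D B^-1] then carries one germ to the other,
    and components with a common point coincide. *)
Lemma good_end_equiv (R : realType) (a a' : quartic R) (H H' : set 'cV[R]_2) :
  components (mform a) H -> components (mform a') H' ->
  good_end a H -> good_end a' H' ->
  qJ a ^+ 2 * qI a' ^+ 3 = qJ a' ^+ 2 * qI a ^+ 3 ->
  (qJ a == 0) = (qJ a' == 0) ->
  exists A : 'M[R]_2, [/\ A \in unitmx, msubst a' A = a &
                         H' = [set A *m p | p in H]].
Proof.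
move=> cH cH' [B [d [Bu d0 [b0 b1 b2] HB]]] [B' [d' [Bu' d0' [b0' b1' b2'] HB']]].
have [I1 J1] := good_end_invariants H Bu b0 b1 b2.
have [I2 J2] := good_end_invariants H' Bu' b0' b1' b2'.
have s1 := good_end_sign cH Bu d0 b0 b1 b2 HB.
have s2 := good_end_sign cH' Bu' d0' b0' b1' b2' HB'.
move=> eIJ eJ.
have dB : \det B != 0 by rewrite -unitmx2.
have dB' : \det B' != 0 by rewrite -unitmx2.
have jz : (q3 (msubst a B) == 0) = (q3 (msubst a' B') == 0).
  rewrite -[LHS]sqrf_eq0 -[RHS]sqrf_eq0 -oppr_eq0 -J1 -[RHS]oppr_eq0 -J2.
  by rewrite (mulf_eq0 (\det B ^+ 6)) (mulf_eq0 (\det B' ^+ 6)) !expf_eq0 /= (negPf dB) (negPf dB') eJ.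
set b := msubst a B in b0 b1 b2 HB I1 J1 s1 jz *.
set b' := msubst a' B' in b0' b1' b2' HB' I2 J2 s2 jz *.
have divn0 (x y : R) : x < 0 -> y < 0 -> 0 < x / y.
  by move=> x0 y0; rewrite nmulr_rgt0// invr_lt0.
have [m m0 [m3 m4]] : exists2 m, 0 < m & q3 b = m ^+ 3 * q3 b' /\ q4 b = m ^+ 4 * q4 b'.
  case: s1 => [c3|[c3 c4]].
    have c3' : q3 b' < 0.
      by case: s2 => [//|[c3' _]]; move: jz; rewrite c3' eqxx lt_eqF.
    have [m m0 mE] := @cbrt_exists R (q3 b / q3 b') (divn0 _ _ c3 c3').
    exists m => //; split; first by rewrite mE divfK// lt_eqF.
    apply: cube_inj; apply: (@mulfI _ (q3 b' ^+ 4)); first by rewrite expf_neq0// lt_eqF.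
    have -> : q3 b' ^+ 4 * (m ^+ 4 * q4 b') ^+ 3 = (m ^+ 3 * q3 b') ^+ 4 * q4 b' ^+ 3 by ring.
    rewrite mE divfK ?lt_eqF//.
    have -> : q3 b' ^+ 4 = (- q3 b' ^+ 2) ^+ 2 by ring.
    have -> : q3 b ^+ 4 = (- q3 b ^+ 2) ^+ 2 by ring.
    rewrite -J1 -J2 -I1 -I2.
    transitivity (\det B ^+ 12 * \det B' ^+ 12 * (qJ a' ^+ 2 * qI a ^+ 3)); first by ring.
    by rewrite -eIJ; ring.
  move: jz; rewrite c3 eqxx => /esym/eqP c3'.
  have c4' : q4 b' < 0 by case: s2 => [|[]//]; rewrite c3' ltxx.
  have [m m0 mE] := @fourth_root_exists R (q4 b / q4 b') (divn0 _ _ c4 c4').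
  by exists m => //; split; rewrite ?c3' ?mulr0// mE divfK ?lt_eqF.
pose D := mx2 1 0 0 m.
have Du : D \in unitmx by rewrite unitmx2 det_mx2 mul1r mulr0 subr0 gt_eqF.
have bD : msubst b' D = b.
  clear -b0 b1 b2 m3 m4 b0' b1' b2'; clearbody b b'; rewrite /D msubst_mx2.
  by apply: quartic_eq; rewrite ?b0 ?b1 ?b2 ?m3 ?m4 /= /polar /= ?b0' ?b1' ?b2'; ring.
have AE : msubst a' (B' *m D *m invmx B) = a.
  by rewrite -!msubstM -/b' bD /b msubstM mulmxV// msubst1.
exists (B' *m D *m invmx B); split=> //.
  by rewrite !unitmx_mul Bu' Du unitmx_inv.
(* A common point: [s] is in the first germ and [m s] in the second. *)
pose s := Num.min (d / 2) (d' / (2 * m)).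
have s0 : 0 < s by rewrite lt_min !divr_gt0// mulr_gt0.
have sd : 0 < s < d by rewrite s0 gt_min; apply/orP; left; lra.
have ms : 0 < m * s < d'.
  rewrite mulr_gt0//=; have : s * (2 * m) <= d'.
    by rewrite -ler_pdivlMr ?mulr_gt0// ge_min lexx orbT.
  by have := mulr_gt0 m0 s0; lra.
apply: (@components_eq R 1 (mform a') _ _ (B' *m pt b' (m * s))) => //.
- rewrite -[X in components (mform X) _]AE in cH.
  by apply: components_msubst cH; rewrite !unitmx_mul Bu' Du unitmx_inv.
- exact: HB'.
- exists (B *m pt b s); first exact: HB.
  rewrite -!mulmxA mulKmx// -bD; congr (_ *m _).
  have f0 : 0 < qf b' 1 (m * s).
    have [p Sp pE] := cH'; have := HB' _ ms; rewrite -pE.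
    move=> /connected_component_sub /(iffRL (hyperbolic_level_msubst _ _ Bu')).
    by move=> /level_pt_inv[].
  have [] := @mulmx_pt R b' D s; rewrite !mxE /= mul0r addr0 ?add0r ?divr1//.
Qed.

(** * The standard form *)

Lemma mean_value (R : realType) (f df : R -> R) (a b : R) : a < b ->
  (forall x, a <= x <= b -> is_derive x 1 f (df x)) ->
  exists c, a < c < b /\ f b - f a = df c * (b - a).
Proof.
move=> ab fd; have [||c cab fE] := @MVT R f df a b ab.
- by move=> x; rewrite in_itv /= => /andP[ax xb]; apply: fd; rewrite !ltW.
- apply: derivable_within_continuous => x; rewrite in_itv /= => xab.
  exact: (@ex_derive _ _ _ _ _ _ _ (fd x xab)).
- by exists c; split=> //; move: cab; rewrite in_itv.
Qed.

(** [t1] is the infimum of the points of [[0, T]] with [g <= 0]. If [g t1] were positive, no such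
    point would be near [t1]; if it were negative, [g] would be negative just before [t1]. *)
Lemma first_zero (R : realType) (g : R -> R) (T : R) : continuous g ->
  0 < T -> 0 < g 0 -> g T <= 0 ->
  exists t1, [/\ 0 < t1, t1 <= T, g t1 = 0 & forall t, 0 <= t < t1 -> 0 < g t].
Proof.
move=> gc T0 g0 gT; pose Z := [set t | 0 <= t <= T /\ g t <= 0].
have ZT : Z T by split=> //; rewrite lexx ltW.
have Zlb : has_lbound Z by exists 0 => t [/andP[]].
have Zinf : has_inf Z by split; first by exists T.
pose t1 := inf Z.
have t1_ge0 : 0 <= t1 by apply: lb_le_inf => [|t [/andP[]]]; first by exists T.
have t1T : t1 <= T by exact: ge_inf.
have before t : 0 <= t < t1 -> 0 < g t.
  move=> /andP[t0 tt1]; rewrite ltNge; apply/negP => gt.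
  have Zt : Z t by split=> //; rewrite t0 ltW// (lt_le_trans tt1).
  by have := ge_inf Zlb Zt; rewrite leNgt tt1.
have sign (e : R) : 0 < e * g t1 ->
    exists2 d, 0 < d & forall t, `|t1 - t| < d -> 0 < e * g t.
  move=> eg; have gce : {for t1, continuous (fun t => e * g t)}.
    by apply: continuousM; [exact: cst_continuous | exact: gc].
  have /nbhs_ballP[d d0 dP] := gce _ (open_nbhs_nbhs (conj (@open_gt R 0) eg)).
  by exists d.
have gt1 : g t1 = 0.
  have [|gn|//] := ltgtP (g t1) 0; last first.
    have [|d d0 dP] := sign 1; first by rewrite mul1r.
    have [z Zz zd] := inf_adherent d0 Zinf.
    have zt1 : t1 <= z by exact: ge_inf.
    have := dP z; rewrite mul1r => /(_ _)/[dup]; case: Zz => _; rewrite leNgt => /negP gz.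
    rewrite ler0_norm ?subr_le0// => h; exfalso; apply: gz; apply: h.
    by rewrite opprB ltrBlDl.
  move=> gn; have [|d d0 dP] := sign (-1); first by rewrite mulN1r oppr_gt0.
  have t1_gt0 : 0 < t1.
    by rewrite lt_neqAle t1_ge0 andbT; apply: contraTneq gn => <-; rewrite -leNgt ltW.
  pose t := t1 - Num.min (d / 2) (t1 / 2).
  have m0 : 0 < Num.min (d / 2) (t1 / 2) by rewrite lt_min !divr_gt0.
  have m1 : Num.min (d / 2) (t1 / 2) <= d / 2 by rewrite ge_min lexx.
  have m2 : Num.min (d / 2) (t1 / 2) <= t1 / 2 by rewrite ge_min lexx orbT.
  have := before t; rewrite /t => /(_ ltac:(apply/andP; split; lra)) => h1.
  have := dP t; rewrite /t mulN1r oppr_gt0 ger0_norm; last lra.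
  by move=> /(_ ltac:(lra)) => h2; lra.
exists t1; split=> //; rewrite lt_neqAle t1_ge0 andbT; apply: contraTneq g0 => t10.
by rewrite [X in g X]t10 gt1 ltxx.
Qed.

Definition stdq (R : realType) (L K : R) : quartic R := Quartic 1 0 (- 6^-1) (L / 4) K.

(* Where f = h(1, t) > 0, hyperbolicity means that f^(1/4) is strictly concave; since f'(0) = 0,
   this cannot hold for all t > 0. *)
Lemma stdq_exit (R : realType) (L K : R) :
  exists2 T, 0 < T & qf (stdq L K) 1 T <= 0 \/ 0 <= qh (stdq L K) 1 T.
Proof.
apply: contrapT => noT.
pose f (t : R) : R := 1 - t ^+ 2 + L * t ^+ 3 + K * t ^+ 4.
pose f1 (t : R) : R := - (2 * t) + 3 * L * t ^+ 2 + 4 * K * t ^+ 3.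
pose f2 (t : R) : R := - 2 + 6 * L * t + 12 * K * t ^+ 2.
have fE t : qf (stdq L K) 1 t = f t by rewrite /qf /f /=; field.
have hE t : 3 * f1 t ^+ 2 - 4 * f t * f2 t = - 48 * qh (stdq L K) 1 t.
  by rewrite /qh /f /f1 /f2 /=; field.
have pos t : 0 <= t -> 0 < f t /\ 4 * f t * f2 t < 3 * f1 t ^+ 2.
  rewrite le_eqVlt => /orP[/eqP <-|t0]; first by rewrite /f /f1 /f2; split; lra.
  have f0 : 0 < f t.
    by rewrite -fE ltNge; apply/negP => h; apply: noT; exists t => //; left.
  have h0 : qh (stdq L K) 1 t < 0.
    by rewrite ltNge; apply/negP => h; apply: noT; exists t => //; right.
  by split=> //; have := hE t; lra.
have df (t : R) : is_derive t 1 f (f1 t).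
  by apply: is_derive_eq; rewrite /f1 /GRing.scale /=; ring.
have df1 (t : R) : is_derive t 1 f1 (f2 t).
  by apply: is_derive_eq; rewrite /f2 /GRing.scale /=; ring.
(* The logarithmic derivative [f1 / f] vanishes at 0 and has derivative [(f f2 - f1^2) / f^2], which
   is negative because [4 f f2 < 3 f1^2]. *)
have f1_neg t : 0 < t -> f1 t < 0.
  move=> t0.
  have [x /andP[x0 xt]|c [/andP[c0 ct] cE]] := @mean_value R (fun t => f1 t / f t)
    (fun t => (f2 t * f t - f1 t ^+ 2) / f t ^+ 2) 0 t t0.
    have [fx _] := pos x x0.
    have fx' : f x != 0 by rewrite gt_eqF.
    have := is_deriveV fx' (df x) => dV.
    apply: is_derive_eq; rewrite /GRing.scale /=; field.
    exact: fx'.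
  have [fc hc] := pos c (ltW c0); have [ft _] := pos t (ltW t0).
  have : f1 t / f t < 0.
    move: cE; rewrite {2}/f1 !(mulr0, expr0n) /= oppr0 !addr0 mul0r !subr0 => ->.
    rewrite pmulr_llt0// pmulr_llt0 ?invr_gt0 ?exprn_gt0//.
    by have := sqr_ge0 (f1 c); nra.
  by rewrite pmulr_llt0// invr_gt0.
(* [f / f1] has derivative [1 - f f2 / f1^2 > 1/4], so this negative function would reach 0 no later
   than at the [T] chosen below. *)
have psi t : 1 < t -> f 1 / f1 1 + (t - 1) / 4 <= f t / f1 t.
  move=> t1.
  have [x /andP[x1 xt]|c [/andP[c1 ct] cE]] := @mean_value R (fun t => f t / f1 t)
    (fun t => (f1 t ^+ 2 - f t * f2 t) / f1 t ^+ 2) 1 t t1.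
    have fx' : f1 x != 0 by rewrite lt_eqF// f1_neg// (lt_le_trans _ x1).
    have := is_deriveV fx' (df1 x) => dV.
    apply: is_derive_eq; rewrite /GRing.scale /=; field.
    exact: fx'.
  have c0 : 0 < c by rewrite (lt_trans _ c1).
  have [fc hc] := pos c (ltW c0).
  have n0 : 0 < f1 c ^+ 2 by rewrite exprn_even_gt0//= lt_eqF// f1_neg.
  have : 4^-1 <= (f1 c ^+ 2 - f c * f2 c) / f1 c ^+ 2.
    by rewrite ler_pdivlMr//; lra.
  by nra.
have [f10 _] := pos 1 ler01; have f110 := f1_neg 1 ltr01.
have q0 : f 1 / f1 1 < 0 by rewrite pmulr_rlt0// invr_lt0.
pose T := 1 - 4 * (f 1 / f1 1).
have T1 : 1 < T by rewrite /T; lra.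
have T0 : 0 < T by lra.
have [fT _] := pos T (ltW T0).
have := psi T T1; have : f T / f1 T < 0 by rewrite pmulr_rlt0// invr_lt0 f1_neg.
have TE : T - 1 = - 4 * (f 1 / f1 1) by rewrite /T; ring.
by rewrite TE; lra.
Qed.

Lemma stdq_exit_point (R : realType) (L K : R) :
  exists t1, [/\ 0 < t1,
    forall t, 0 <= t < t1 -> 0 < qf (stdq L K) 1 t /\ qh (stdq L K) 1 t < 0,
    0 <= qf (stdq L K) 1 t1, qh (stdq L K) 1 t1 <= 0 &
    qf (stdq L K) 1 t1 = 0 \/ qh (stdq L K) 1 t1 = 0].
Proof.
have [T T0 TE] := stdq_exit L K.
(* Positive exactly where both conditions hold, so its first zero is the first slope at which one of
   them fails. *)
pose g (t : R) : R := Num.min (qf (stdq L K) 1 t) (- qh (stdq L K) 1 t).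
have gc : continuous g.
  move=> t; apply: continuous_min; first exact: qf1_continuous.
  by apply: continuousN; exact: qh1_continuous.
have g0 : 0 < g 0 by rewrite lt_min /qf /qh /=; apply/andP; split; lra.
have gT : g T <= 0 by rewrite ge_min oppr_le0; apply/orP.
have [t1 [t10 t1T gt1 before]] := first_zero gc T0 g0 gT.
have : 0 <= g t1 by rewrite gt1.
rewrite le_min oppr_ge0 => /andP[f1 h1].
exists t1; split=> //.
  by move=> t /before; rewrite lt_min oppr_gt0 => /andP[].
move: gt1; rewrite /g; case: (leP (qf (stdq L K) 1 t1) (- qh (stdq L K) 1 t1)) => _ e.
  by left.
by right; apply/eqP; rewrite -oppr_eq0 e.
Qed.

Lemma qf_stdq_opp (R : realType) (L K t : R) : qf (stdq L K) 1 (- t) = qf (stdq (- L) K) 1 t.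
Proof. by rewrite /qf /=; ring. Qed.

Lemma qh_stdq_opp (R : realType) (L K t : R) : qh (stdq L K) 1 (- t) = qh (stdq (- L) K) 1 t.
Proof. by rewrite /qh /=; ring. Qed.

Lemma stdq_arc (R : realType) (L K : R) :
  exists t0 t1, [/\ t0 < 0, 0 < t1,
    forall t, t0 < t < t1 -> 0 < qf (stdq L K) 1 t /\ qh (stdq L K) 1 t < 0,
    [/\ 0 <= qf (stdq L K) 1 t0, qh (stdq L K) 1 t0 <= 0 &
    qf (stdq L K) 1 t0 = 0 \/ qh (stdq L K) 1 t0 = 0] &
    [/\ 0 <= qf (stdq L K) 1 t1, qh (stdq L K) 1 t1 <= 0 &
    qf (stdq L K) 1 t1 = 0 \/ qh (stdq L K) 1 t1 = 0]].
Proof.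
have [t1 [t10 ht1 f1 h1 e1]] := stdq_exit_point L K.
have [s [s0 hs fs hs' es]] := stdq_exit_point (- L) K.
exists (- s), t1; rewrite qf_stdq_opp qh_stdq_opp; split=> //; first by rewrite oppr_lt0.
move=> t /andP[ts tt1]; have [t0|t0] := leP 0 t; first by apply: ht1; rewrite t0.
by rewrite -[t]opprK qf_stdq_opp qh_stdq_opp; apply: hs; apply/andP; split; lra.
Qed.

Lemma halfplane_open (R : realType) (al be : R) :
  open [set p : 'cV[R]_2 | 0 < al * (coords p).1 + be * (coords p).2].
Proof.
apply: (@open_comp _ _ (fun p : 'cV[R]_2 => al * p ord0 ord0 + be * p ord_max ord0)
  [set x | 0 < x]); last exact: open_gt.
move=> p _; suff : {for p, continuous (fun p : 'cV[R]_2 =>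
  al * p ord0 ord0 + be * p ord_max ord0)} by [].
by apply: continuousD;
  (apply: continuousM; [exact: cst_continuous | exact: coord_continuous]).
Qed.

Lemma halfplane_closed (R : realType) (al be : R) :
  closed [set p : 'cV[R]_2 | 0 <= al * (coords p).1 + be * (coords p).2].
Proof.
have -> : [set p : 'cV[R]_2 | 0 <= al * (coords p).1 + be * (coords p).2] =
    ~` [set p | 0 < (- al) * (coords p).1 + (- be) * (coords p).2].
  apply/seteqP; split=> p /=; first by move=> ? ?; lra.
  by move=> /negP; rewrite -leNgt => ?; lra.
exact: open_closedC (@halfplane_open _ _ _).
Qed.

(** If the boundary of the sector [O] carries no point of the level set, then [O] cuts out of [S] a
    relatively open and closed set; this set is the image under [pt] of an interval of slopes, hence
    connected. *)
Lemma cone_component (R : realType) (a : quartic R) (O F : set 'cV[R]_2) :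
  let S := hyperbolic_level (mform a) in
  open O -> closed F -> O `<=` F -> S `&` F `<=` O ->
  (forall p, O p -> 0 < (coords p).1 /\ O (vec 1 ((coords p).2 / (coords p).1))) ->
  (forall t, O (vec 1 t) -> 0 < qf a 1 t -> O (pt a t)) ->
  is_interval [set t | [/\ O (vec 1 t), 0 < qf a 1 t & qh a 1 t < 0]] ->
  forall p, S p -> O p -> connected_component S p = S `&` O.
Proof.
move=> S oO cF OF SFO Opos Opt Ii p Sp Op.
apply: connected_component_clopen oO cF _ _ => //; last first.
  apply/seteqP; split=> q [Sq]; first by move=> /OF.
  by move=> Fq; split=> //; exact: SFO.
suff -> : S `&` O = pt a @` [set t | [/\ O (vec 1 t), 0 < qf a 1 t & qh a 1 t < 0]].
  by apply: arc_connected => // t [].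
apply/seteqP; split=> [q [Sq Oq]|_ [t [Ot f0 h0] <-]]; last first.
  by split; [exact: level_pt | exact: Opt].
have [x0 Ov] := Opos q Oq; have [qE f0 h0] := level_slope x0 Sq.
by exists ((coords q).2 / (coords q).1).
Qed.

Lemma stdq_component (R : realType) (L K t0 t1 : R) : t0 < 0 -> 0 < t1 ->
  (forall t, t0 < t < t1 -> 0 < qf (stdq L K) 1 t /\ qh (stdq L K) 1 t < 0) ->
  ~ (0 < qf (stdq L K) 1 t0 /\ qh (stdq L K) 1 t0 < 0) ->
  ~ (0 < qf (stdq L K) 1 t1 /\ qh (stdq L K) 1 t1 < 0) ->
  forall p, connected_component (hyperbolic_level (mform (stdq L K))) (vec 1 0) p ->
  0 < (coords p).1 /\ t0 < (coords p).2 / (coords p).1 < t1.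
Proof.
move=> t00 t10 fh n0 n1.
pose O := [set p : 'cV[R]_2 | 0 < 1 * (coords p).1 + 0 * (coords p).2] `&`
  ([set p | 0 < (- t0) * (coords p).1 + 1 * (coords p).2] `&`
   [set p | 0 < t1 * (coords p).1 + (- 1) * (coords p).2]).
pose F := [set p : 'cV[R]_2 | 0 <= 1 * (coords p).1 + 0 * (coords p).2] `&`
  ([set p | 0 <= (- t0) * (coords p).1 + 1 * (coords p).2] `&`
   [set p | 0 <= t1 * (coords p).1 + (- 1) * (coords p).2]).
have OE p : O p <-> [/\ 0 < (coords p).1, t0 * (coords p).1 < (coords p).2 &
    (coords p).2 < t1 * (coords p).1].
  rewrite /O /setI /mkset /=; case: (coords p) => x y /=.
  by split=> [[? [? ?]]|[? ? ?]]; do ?split; lra.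
have FE p : F p <-> [/\ 0 <= (coords p).1, t0 * (coords p).1 <= (coords p).2 &
    (coords p).2 <= t1 * (coords p).1].
  rewrite /F /setI /mkset /=; case: (coords p) => x y /=.
  by split=> [[? [? ?]]|[? ? ?]]; do ?split; lra.
have slope p : 0 < (coords p).1 -> (t0 < (coords p).2 / (coords p).1 < t1) =
    (t0 * (coords p).1 < (coords p).2 < t1 * (coords p).1).
  by move=> x0; rewrite ltr_pdivlMr// ltr_pdivrMr.
have S10 : hyperbolic_level (mform (stdq L K)) (vec 1 0).
  by apply/hyperbolic_levelE; rewrite coords_vec /qf /qh /=; split; lra.
rewrite (@cone_component _ _ O F); first last.
- by rewrite OE coords_vec /=; split; lra.
- by [].
- move=> x y [/OE + _ _] [/OE + _ _] t /andP[xt ty]; rewrite !coords_vec /= => -[_ x1 x2] [_ y1 y2].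
  have t1t : t0 < t < t1 by apply/andP; split; lra.
  by have [ft ht] := fh t t1t; split=> //; rewrite OE coords_vec /=; split; lra.
- move=> t /OE; rewrite OE coords_vec coords_pt /= => -[_ ? ?] ft.
  by have := rad_gt0 ft; set r := rad _ => r0; split; nra.
- move=> p /OE [x0 y0 y1]; split=> //; apply/OE; rewrite coords_vec /= !mulr1.
  by split=> //; rewrite ?ltr_pdivlMr// ltr_pdivrMr.
- move=> p [Sp /FE[x0 y0 y1]]; apply/OE.
  (* In the closed sector [x = 0] forces the origin, where the form is 0. The boundary rays are
     excluded afterwards, because one of the two inequalities fails at [t0] and at [t1]. *)
  have x_gt0 : 0 < (coords p).1.
    have [//|xn|xz] := ltgtP 0 (coords p).1; first by lra.
    move: Sp => /hyperbolic_levelE[]; have yz : (coords p).2 = 0 by rewrite -xz in y0 y1; lra.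
    rewrite -xz yz /qf !(expr0n, mulr0, mul0r, addr0) /= => /esym/eqP.
    by rewrite oner_eq0.
  have [_ f0 h0] := level_slope x_gt0 Sp.
  have ne t : ~ (0 < qf (stdq L K) 1 t /\ qh (stdq L K) 1 t < 0) ->
      (coords p).2 != t * (coords p).1.
    by move=> n; apply/eqP => e; apply: n; move: f0 h0; rewrite e mulfK// gt_eqF.
  split=> //.
    by have := ne _ n0; rewrite lt_neqAle eq_sym => ->; lra.
  by have := ne _ n1; rewrite lt_neqAle => ->; lra.
- by move=> p /OE[? ? ?]; apply/FE; split; apply/ltW.
- by apply: closedI; [|apply: closedI]; exact: halfplane_closed.
- by apply: openI; [|apply: openI]; exact: halfplane_open.
by move=> p [_ /OE[x0 y0 y1]]; split=> //; rewrite slope// y0.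
Qed.

(** * Geodesics *)

Lemma is_derive_continuous (R : realType) (f : R -> R) (x d : R) :
  is_derive x 1 f d -> {for x, continuous f}.
Proof.
by move=> fd; apply/differentiable_continuous/derivable1_diffP; exact: ex_derive.
Qed.

(** The fundamental theorem of calculus gives primitives on the intervals []-n, n[]; normalised to
    vanish at 0 they agree where both are defined, and they are glued by letting the index grow with
    the absolute value of [x]. *)
Lemma primitive_exists (R : realType) (rho : R -> R) : continuous rho ->
  exists s : R -> R, forall x : R, is_derive x 1 s (rho x).
Proof.
move=> rc.
pose F (n : nat) (x : R) : R := (\int[lebesgue_measure]_(t in `[- n%:R, x]) rho t)%R.
have dF n (x : R) : - n%:R < x < n%:R -> is_derive x 1 (F n) (rho x).
  move=> /andP[nx xn].
  have [|//||dFx FE] := @continuous_FTC1 R rho (BLeft (- n%:R)) x n%:R xn.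
  - apply: continuous_compact_integrable; first exact: segment_compact.
    exact: continuous_subspaceT.
  - exact: rc.
  - by apply: DeriveDef; [exact: dFx | rewrite -derive1E; exact: FE].
pose G n x := F n x - F n 0.
have dG n (x : R) : - n%:R < x < n%:R -> is_derive x 1 (G n) (rho x).
  move=> xn; have dFn := dF n x xn.
  by apply: is_derive_eq; rewrite subr0.
have GG n m (x : R) : (n <= m)%N -> - n%:R < x < n%:R -> G n x = G m x.
  move=> nm /andP[nx xn].
  have nm' : n%:R <= m%:R :> R by rewrite ler_nat.
  have d0 (y : R) : - n%:R < y < n%:R -> is_derive y 1 (fun x => G n x - G m x) 0.
    move=> /andP[ny yn]; have d1 : is_derive y 1 (G n) (rho y) by apply: dG; rewrite ny.
    have d2 : is_derive y 1 (G m) (rho y) by apply: dG; apply/andP; split; lra.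
    by apply: is_derive_eq; rewrite subrr.
  have G0 k : G k 0 = 0 by rewrite /G subrr.
  have [x0|x0|->] := ltgtP x 0; last by rewrite !G0.
  - have [y /andP[xy y0]|c [_]] := @mean_value R (fun x => G n x - G m x) (fun=> 0) x 0 x0.
      by apply: d0; apply/andP; split; lra.
    by rewrite !G0 mul0r; lra.
  - have [y /andP[xy y0]|c [_]] := @mean_value R (fun x => G n x - G m x) (fun=> 0) 0 x x0.
      by apply: d0; apply/andP; split; lra.
    by rewrite !G0 mul0r; lra.
pose N (x : R) := (Num.trunc `|x|).+1.
have Nlt (x : R) : `|x| < (N x)%:R by exact: truncnS_gt.
exists (fun x => G (N x) x) => x.
(* One index has to serve for a whole neighbourhood of [x]: the bound [N x + 1] still exceeds the
   absolute value of every [y] at distance less than 1. *)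
have Nx1 : `|x| + 1 < (N x).+1%:R by rewrite -addn1 natrD ltrD2r.
have dGx : is_derive x 1 (G (N x).+1) (rho x).
  by apply: dG; rewrite -ltr_norml (lt_trans _ Nx1)// ltrDl.
apply: (near_eq_is_derive _ dGx).
near=> y.
have yx : `|y - x| < 1.
  by rewrite distrC; near: y; exact: (@cvgr_dist_lt _ _ _ _ _ id x).
have yN : `|y| < (N x).+1%:R.
  by rewrite (le_lt_trans _ Nx1)// -lerBlDl (le_trans (lerB_dist _ _))// ltW.
apply/esym; apply: GG; last by rewrite -ltr_norml.
by rewrite /N ltnS -ltnS -(@ltr_nat R); apply: le_lt_trans yN; rewrite truncn_le.
Unshelve. all: by end_near. Qed.

(** A derivative bounded below by [e > 0] makes [s] injective and unbounded in both directions,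
    hence a bijection of the line. *)
Lemma increasing_inverse (R : realType) (s rho : R -> R) (e : R) : 0 < e ->
  (forall x : R, is_derive x 1 s (rho x)) -> (forall x, e <= rho x) ->
  exists g : R -> R, forall y, s (g y) = y /\ is_derive y 1 g (rho (g y))^-1.
Proof.
move=> e0 ds re.
have sc : continuous s by move=> x; exact: is_derive_continuous (ds x).
have grow x y : x < y -> e * (y - x) <= s y - s x.
  move=> xy; have [c [_ ->]] := mean_value xy (fun x _ => ds x).
  by rewrite ler_pM2r ?re// subr_gt0.
have inj : injective s.
  move=> x y sxy; have [xy|xy|//] := ltgtP x y; exfalso.
    by have := grow _ _ xy; rewrite sxy subrr leNgt mulr_gt0// subr_gt0.
  by have := grow _ _ xy; rewrite sxy subrr leNgt mulr_gt0// subr_gt0.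
have surj y : exists x, s x = y.
  pose b := (`|y - s 0| + 1) / e.
  have b0 : 0 < b by rewrite divr_gt0// ltr_wpDl.
  have eb : e * b = `|y - s 0| + 1 by rewrite /b mulrC divfK// gt_eqF.
  have h1 := grow _ _ b0.
  have nb0 : - b < 0 by rewrite oppr_lt0.
  have h2 := grow _ _ nb0.
  rewrite subr0 eb in h1; rewrite sub0r opprK eb in h2.
  have l1 : y - s 0 <= `|y - s 0| by exact: ler_norm.
  have l2 : - (y - s 0) <= `|y - s 0| by rewrite -normrN; exact: ler_norm.
  have [|||x _ <-] := @IVT R s (- b) b y; last by exists x.
  - lra.
  - exact: continuous_subspaceT.
  - by rewrite ge_min le_max; apply/andP; split; apply/orP; [left|right]; lra.
pose g y := sval (cid (surj y)).
have sg y : s (g y) = y by rewrite /g; case: cid.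
have gs x : g (s x) = x by apply: inj; rewrite sg.
exists g => y; split=> //.
rewrite -{1}(sg y); apply: is_derive_inverse.
- by near=> z; exact: gs.
- by near=> z; exact: sc.
- by rewrite gt_eqF// (lt_le_trans e0).
Unshelve. all: by end_near. Qed.

(* Substituting t = (t0 + t1 e^z) / (1 + e^z) moves the end points to infinity. *)
Lemma autonomous_flow (R : realType) (t0 t1 C : R) (w : R -> R) : t0 < t1 ->
  (forall t, t0 < t < t1 -> {for t, continuous w}) ->
  (forall t, t0 < t < t1 -> 0 < w t <= C * ((t - t0) * (t1 - t))) ->
  forall tp c, t0 < tp < t1 ->
  exists T : R -> R, [/\ T 0 = tp, forall u, t0 < T u < t1 &
    forall u : R, is_derive u 1 T (c * w (T u))].
Proof.
move=> t01 wc wb tp c tpi.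
pose tau (z : R) : R := (t0 + t1 * expR z) / (1 + expR z).
have ez (z : R) : 0 < 1 + expR z by rewrite ltr_wpDl// expR_gt0.
have ez' (z : R) : 1 + expR z != 0 by rewrite gt_eqF.
have tau0 z : tau z - t0 = (t1 - t0) * expR z / (1 + expR z).
  by rewrite /tau; field.
have tau1 z : t1 - tau z = (t1 - t0) / (1 + expR z).
  by rewrite /tau; field.
have taui z : t0 < tau z < t1.
  rewrite -subr_gt0 -[_ < t1]subr_gt0 tau0 tau1 !divr_gt0 ?mulr_gt0 ?subr_gt0//.
  exact: expR_gt0.
pose dtau z := (tau z - t0) * (t1 - tau z) / (t1 - t0).
have dtauP (z : R) : is_derive z 1 tau (dtau z).
  have dE : is_derive z 1 (fun z => 1 + expR z) (expR z).
    rewrite -[X in is_derive _ _ _ X]add0r; exact: is_deriveD.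
  have dV := @is_deriveV _ (fun z => 1 + expR z) _ _ _ (ez' z) dE.
  apply: is_derive_eq; rewrite /GRing.scale /= /dtau tau0 tau1.
  have t10 : t1 - t0 != 0 by rewrite subr_eq0 gt_eqF.
  by field; rewrite ez' t10.
have dtau_gt0 z : 0 < dtau z.
  have /andP[h1 h2] := taui z.
  by rewrite divr_gt0 ?mulr_gt0 ?subr_gt0.
(* In the coordinate [z] the equation reads [z' = c / rho z], so a primitive [s] of [rho] satisfies
   [s (z u) = c u + s zp]. The upper bound on [w] keeps [rho] away from 0, so that [s] maps onto the
   whole line and the solution exists for all times. *)
pose rho z := dtau z / w (tau z).
have rc : continuous rho.
  move=> z; have tc := is_derive_continuous (dtauP z).
  have /andP[w0 _] := wb _ (taui z).
  apply: continuousM.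
    apply: continuousM; last exact: cst_continuous.
    apply: continuousM; apply: continuousB => //; exact: cst_continuous.
  apply: continuousV; first by rewrite gt_eqF.
  by apply: continuous_comp => //; exact: wc.
have C0 : 0 < C.
  have /andP[w0 wC] := wb _ tpi; have := lt_le_trans w0 wC; rewrite pmulr_lgt0//.
  by move/andP: tpi => [? ?]; rewrite mulr_gt0// subr_gt0.
have t10 : 0 < t1 - t0 by rewrite subr_gt0.
pose e := (C * (t1 - t0))^-1.
have e0 : 0 < e by rewrite invr_gt0 mulr_gt0.
have re z : e <= rho z.
  have /andP[w0 wC] := wb _ (taui z).
  rewrite /rho ler_pdivlMr// /e ler_pdivrMl ?mulr_gt0// /dtau.
  rewrite (le_trans wC)//; set p := (X in _ <= X).
  suff -> : p = C * ((tau z - t0) * (t1 - tau z)) by [].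
  by rewrite /p; field; rewrite gt_eqF.
have [s ds] := primitive_exists rc.
have [g gP] := increasing_inverse e0 ds re.
have [zp zpE] : exists z, tau z = tp.
  move/andP: tpi => [h0 h1]; exists (ln ((tp - t0) / (t1 - tp))).
  rewrite /tau lnK; last by rewrite posrE divr_gt0// subr_gt0.
  by field; rewrite subr_eq0 gt_eqF//= (_ : _ - _ + _ = t1 - t0) ?gt_eqF//; ring.
have sinj x y : s x = s y -> x = y.
  move=> sxy; apply/eqP; apply: contraT => /lt_total.
  suff grow a b : a < b -> s a < s b.
    by move=> /orP[] /grow; rewrite sxy ltxx.
  move=> ab; have [c0 [_ sE]] := mean_value ab (fun x _ => ds x).
  by rewrite -subr_gt0 sE mulr_gt0 ?subr_gt0// (lt_le_trans e0).
exists (fun u => tau (g (c * u + s zp))); split=> [|u|u].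
- by rewrite mulr0 add0r (_ : g (s zp) = zp)//; apply: sinj; have [] := gP (s zp).
- exact: taui.
- set y := c * u + s zp; have [_ dg] := gP y.
  have dy : is_derive u 1 (fun u => c * u + s zp) c.
    by apply: is_derive_eq; rewrite /GRing.scale /= mulr1 addr0.
  have dgy := @is_derive1_comp _ g (fun u => c * u + s zp) u _ _ dg dy.
  have dt := @is_derive1_comp _ tau _ u _ _ (dtauP _) dgy.
  apply: (is_derive_eq dt); rewrite /= -/y /rho invf_div.
  by field; rewrite gt_eqF.
Qed.

Lemma is_derive_vec (R : realType) (x y : R -> R) (t dx dy : R) :
  is_derive t 1 x dx -> is_derive t 1 y dy ->
  derivable (fun t => vec (x t) (y t)) t 1 /\
  derive1 (fun t => vec (x t) (y t)) t = vec dx dy.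
Proof.
move=> xd yd.
have d : derivable (fun t => vec (x t) (y t)) t 1.
  apply/derivable_mxP => i j; case: (ord2E i) => ->.
    rewrite (_ : (fun t => vec (x t) (y t) ord0 j) = x); first exact: ex_derive.
    by apply/funext => u; rewrite mxE.
  rewrite (_ : (fun t => vec (x t) (y t) ord_max j) = y); first exact: ex_derive.
  by apply/funext => u; rewrite mxE.
split=> //; rewrite derive1E derive_mx//; apply/matrixP => i j; rewrite !mxE.
case: (ord2E i) => -> /=.
  rewrite (_ : (fun t => vec (x t) (y t) ord0 j) = x); first exact: derive_val.
  by apply/funext => u; rewrite mxE.
rewrite (_ : (fun t => vec (x t) (y t) ord_max j) = y); first exact: derive_val.
by apply/funext => u; rewrite mxE.
Qed.

Lemma is_derive_coords (R : realType) (g : R -> 'cV[R]_2) (t : R) :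
  derivable g t 1 ->
  is_derive t 1 (fun t => (coords (g t)).1) (coords (derive1 g t)).1 /\
  is_derive t 1 (fun t => (coords (g t)).2) (coords (derive1 g t)).2.
Proof.
move=> gd; have gij := iffLR (derivable_mxP g t 1) gd.
rewrite derive1E derive_mx// /coords /= !mxE.
by split; exact: derivableP.
Qed.

Lemma derive1_mulmx (R : realType) (A : 'M[R]_2) (g : R -> 'cV[R]_2) (t : R) :
  derivable g t 1 ->
  derivable (fun t => A *m g t) t 1 /\
  derive1 (fun t => A *m g t) t = A *m derive1 g t.
Proof.
move=> gd; have [d1 d2] := is_derive_coords gd.
have -> : (fun t => A *m g t) = (fun t => vec
  (A ord0 ord0 * (coords (g t)).1 + A ord0 ord_max * (coords (g t)).2)
  (A ord_max ord0 * (coords (g t)).1 + A ord_max ord_max * (coords (g t)).2)).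
  by apply/funext => u; apply: colP2; rewrite mulmx_coords coords_vec.
have [] := @is_derive_vec R
  (fun t => A ord0 ord0 * (coords (g t)).1 + A ord0 ord_max * (coords (g t)).2)
  (fun t => A ord_max ord0 * (coords (g t)).1 + A ord_max ord_max * (coords (g t)).2)
  t _ _ (is_deriveD (is_deriveZ _ d1) (is_deriveZ _ d2))
   (is_deriveD (is_deriveZ _ d1) (is_deriveZ _ d2)).
move=> d e; split; first exact: d.
by rewrite e; apply: colP2; rewrite mulmx_coords coords_vec.
Qed.

Lemma geodesically_complete_msubst (R : realType) (a : quartic R) (A : 'M[R]_2)
    (H : set 'cV[R]_2) : A \in unitmx ->
  geodesically_complete (mform (msubst a A)) H ->
  geodesically_complete (mform a) [set A *m p | p in H].
Proof.
move=> Au Hc _ v [p Hp <-] hv.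
have d1A q u : d1 (mform (msubst a A)) q u = d1 (mform a) (A *m q) (A *m u).
  by rewrite !d1_mform polar_msubst.
have [|g [[gH gd gdd geq] g0 g1]] := Hc p (invmx A *m v) Hp.
  by rewrite d1A mulKVmx.
have dg t := derive1_mulmx A (gd t).
have dE : derive1 (fun t => A *m g t) = (fun t => A *m derive1 g t).
  by apply/funext => t; have [] := dg t.
have ddg t := derive1_mulmx A (gdd t).
exists (fun t => A *m g t); split; last 2 first.
- by rewrite g0.
- by rewrite dE g1 mulKVmx.
split=> [t|t|t|t X].
- by exists (g t).
- by have [] := dg t.
- by rewrite dE; have [] := ddg t.
- move=> hX; have := geq t (invmx A *m X); rewrite d1A mulKVmx// => /(_ hX).
  rewrite dE (ddg t).2 !d2_mform !d3_mform !polar_msubst !mulKVmx//.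
Qed.

(** * Geodesics as curves of constant speed *)

Definition wedge (R : realType) (u v : R * R) : R := u.1 * v.2 - u.2 * v.1.

Lemma tangent_of_level (R : realType) (a : quartic R) (g : R -> 'cV[R]_2) :
  (forall t, qf a (coords (g t)).1 (coords (g t)).2 = 1) ->
  (forall t, derivable g t 1) ->
  forall t, polar a (coords (g t)) (coords (g t)) (coords (g t))
                  (coords (derive1 g t)) = 0.
Proof.
move=> g1 gd t; have [dx dy] := is_derive_coords (gd t).
set x := (fun t => (coords (g t)).1) in dx.
set y := (fun t => (coords (g t)).2) in dy.
have d : is_derive t 1 (fun t => qf a (x t) (y t))
    (4 * polar a (x t, y t) (x t, y t) (x t, y t) (coords (derive1 g t))).
  by rewrite /qf; apply: is_derive_eq; rewrite /polar /GRing.scale /=; ring.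
have e : (fun t => qf a (x t) (y t)) = cst 1 by apply/funext => u; exact: g1.
have := @derive_val _ _ _ _ _ _ _ d; rewrite e derive_cst => /esym/eqP.
by rewrite mulf_eq0 pnatr_eq0 /= => /eqP; rewrite -surjective_pairing.
Qed.

(** The derivative is, up to a constant factor, the geodesic expression paired with
    [X = derive1 g t]. *)
Lemma is_derive_speed (R : realType) (a : quartic R) (g : R -> 'cV[R]_2) (t : R) :
  derivable g t 1 -> derivable (derive1 g) t 1 ->
  let P := coords (g t) in let V := coords (derive1 g t) in
  is_derive t 1 (fun t => let P := coords (g t) in
                          let V := coords (derive1 g t) in polar a P P V V)
    (2 * (polar a P V V V + polar a P P (coords (derive1 (derive1 g) t)) V)).
Proof.
move=> gd gdd P V.
have [dx dy] := is_derive_coords gd; have [dx1 dy1] := is_derive_coords gdd.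
rewrite {}/P {}/V; move: dx1 dy1.
generalize (coords (derive1 (derive1 g) t)) => A dx1 dy1.
set x := (fun t => (coords (g t)).1) in dx.
set y := (fun t => (coords (g t)).2) in dy.
set x1 := (fun t => (coords (derive1 g t)).1) in dx1.
set y1 := (fun t => (coords (derive1 g t)).2) in dy1.
rewrite /= (_ : coords (g t) = (x t, y t)); last by rewrite -surjective_pairing.
rewrite (_ : coords (derive1 g t) = (x1 t, y1 t)); last by rewrite -surjective_pairing.
rewrite -/(x1 t) -/(y1 t) in dx dy.
rewrite (_ : (fun t => _) = (fun t => polar a (x t, y t) (x t, y t) (x1 t, y1 t) (x1 t, y1 t))); last first.
  by apply/funext => u; rewrite -!surjective_pairing.
by rewrite /polar /=; apply: is_derive_eq; rewrite /GRing.scale /=; ring.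
Qed.

Lemma polarZr (R : realType) (a : quartic R) (u v w z : R * R) (c : R) :
  polar a u v w (c * z.1, c * z.2) = c * polar a u v w z.
Proof. rewrite /polar /=; ring. Qed.

(** The tangent space at [P] is a line, so two tangent vectors are proportional; their areas with
    [P] measure the ratio, here without division. *)
Lemma tangent_line (R : realType) (a : quartic R) (P V X : R * R) :
  polar a P P P P = 1 -> polar a P P P V = 0 -> polar a P P P X = 0 ->
  wedge P V * X.1 = wedge P X * V.1 /\ wedge P V * X.2 = wedge P X * V.2.
Proof.
move=> h1 hV hX.
have h0 : wedge X V = 0.
  have : wedge P V * polar a P P P X =
      wedge P X * polar a P P P V + wedge X V * polar a P P P P.
    by rewrite /wedge /polar; ring.
  by rewrite hX hV h1 !mulr0 add0r mulr1.
have e1 : wedge P V * X.1 = wedge P X * V.1 + wedge X V * P.1 by rewrite /wedge; ring.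
have e2 : wedge P V * X.2 = wedge P X * V.2 + wedge X V * P.2 by rewrite /wedge; ring.
by rewrite e1 e2 h0 !mul0r !addr0.
Qed.

(** Constant speed is the geodesic equation tested on the velocity. As [k] is nonzero, so is the
    velocity, and every tangent [X] is a multiple of it by [tangent_line]. *)
Lemma geodesic_of_speed (R : realType) (a : quartic R) (H : set 'cV[R]_2)
    (g : R -> 'cV[R]_2) (k : R) : H `<=` hyperbolic_level (mform a) -> k != 0 ->
  (forall t, H (g t)) -> (forall t, derivable g t 1) ->
  (forall t, derivable (derive1 g) t 1) ->
  (forall t, let P := coords (g t) in let V := coords (derive1 g t) in
             polar a P P V V = k) ->
  geodesic (mform a) H g.
Proof.
move=> HS k0 Hg gd gdd speed; split=> // t X hX.
have lev u : qf a (coords (g u)).1 (coords (g u)).2 = 1.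
  by have /hyperbolic_levelE[] := HS _ (Hg u).
have h1 : polar a (coords (g t)) (coords (g t)) (coords (g t)) (coords (g t)) = 1.
  by rewrite polar_diag.
have hV := tangent_of_level lev gd t.
move: hX; rewrite d1_mform => /eqP; rewrite mulf_eq0 pnatr_eq0 /= => /eqP hX.
have [e1 e2] := tangent_line h1 hV hX.
have ds := is_derive_speed a (gd t) (gdd t).
have cs : (fun t => let P := coords (g t) in let V := coords (derive1 g t) in
    polar a P P V V) = cst k by apply/funext => u; exact: speed.
have := @derive_val _ _ _ _ _ _ _ ds; rewrite cs derive_cst => /esym/eqP.
rewrite mulf_eq0 pnatr_eq0 /= => /eqP e0.
have w0 : wedge (coords (g t)) (coords (derive1 g t)) != 0.
  apply: contra_neq k0 => w0; rewrite -(speed t) /=.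
  have := polar_hessian a (coords (g t)) (coords (derive1 g t)).
  rewrite h1 hV expr0n subr0 mul1r => ->.
  by rewrite -/(wedge _ _) w0 expr0n mulr0.
rewrite d2_mform d3_mform.
set P := coords (g t) in e0 e1 e2 w0 *; set V := coords (derive1 g t) in e0 e1 e2 w0 *.
set A := coords (derive1 (derive1 g) t) in e0 *; set Y := coords X in e1 e2 *.
apply: (mulfI w0); rewrite mulr0.
have eY u v w : wedge P V * polar a u v w Y = wedge P Y * polar a u v w V.
  by rewrite -!polarZr e1 e2.
move: (eY P P A) (eY P V V) e0.
move: (polar a P P A Y) (polar a P V V Y) (polar a P P A V) (polar a P V V V).
move=> q1 q2 q3 q4 h2 h3 e0.
have -> : wedge P V * (- 4^-1 * (12 * q1 + 2^-1 * (24 * q2)))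
   = - 3 * (wedge P V * q1 + wedge P V * q2) by field.
by rewrite h2 h3 -mulrDr addrC e0 !mulr0.
Qed.

(** Testing the geodesic equation on the velocity makes the speed constant; [polar_hessian] rewrites
    it as [qh] times a squared area. *)
Lemma geodesic_speed (R : realType) (a : quartic R) (H : set 'cV[R]_2)
    (g : R -> 'cV[R]_2) : H `<=` hyperbolic_level (mform a) ->
  geodesic (mform a) H g ->
  forall t, let P := coords (g t) in let V := coords (derive1 g t) in
   [/\ polar a P P P P = 1, polar a P P P V = 0 &
    qh a P.1 P.2 * wedge P V ^+ 2 =
    polar a (coords (g 0)) (coords (g 0)) (coords (derive1 g 0)) (coords (derive1 g 0))].
Proof.
move=> HS [Hg gd gdd geq] t P V.
have lev u : qf a (coords (g u)).1 (coords (g u)).2 = 1.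
  by have /hyperbolic_levelE[] := HS _ (Hg u).
have hP : polar a P P P P = 1 by rewrite polar_diag; exact: lev.
have hV := tangent_of_level lev gd.
split=> //; first exact: hV.
have := polar_hessian a P V; rewrite hP hV expr0n subr0 mul1r -/(wedge P V) => <-.
have ds (u : R) : is_derive u 1 (fun t => let P := coords (g t) in
                          let V := coords (derive1 g t) in polar a P P V V) 0.
  apply: is_derive_eq (is_derive_speed a (gd u) (gdd u)) _.
  have := geq u (derive1 g u); rewrite d1_mform hV mulr0 => /(_ erefl).
  rewrite d2_mform d3_mform => /eqP; rewrite mulf_eq0 oppr_eq0 invr_eq0 pnatr_eq0 /=.
  move: (polar a _ _ _ _) (polar a _ _ _ _) => X Y /eqP; lra.
exact: (is_derive_0_is_cst t 0 ds).
Qed.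

(** * Completeness and incompleteness *)

Lemma dominated_near_0 (R : realType) (E k : R -> R) : continuous E ->
  continuous k -> 0 < E 0 ->
  exists e d, [/\ 0 < e, 0 < d & forall r, 0 < r < d -> e * k r ^+ 2 <= E r].
Proof.
move=> Ec kc E0; pose e := E 0 / (2 * (k 0 ^+ 2 + 1)).
have K0 : 0 < k 0 ^+ 2 + 1 by rewrite ltr_wpDl// sqr_ge0.
have e0 : 0 < e by rewrite divr_gt0// mulr_gt0.
pose f r := E r - e * (k r * k r).
have fc : {for 0, continuous f}.
  apply: continuousB; first exact: Ec.
  apply: continuousM; first exact: cst_continuous.
  by apply: continuousM; exact: kc.
have f0 : 0 < f 0.
  have eE : e * (2 * (k 0 ^+ 2 + 1)) = E 0.
    by rewrite divfK// mulf_neq0// gt_eqF.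
  by rewrite /f subr_gt0 -eE ltr_pM2l//; have := sqr_ge0 (k 0); lra.
have /nbhs_ballP[d d0 dP] := fc _ (open_nbhs_nbhs (conj (@open_gt R 0) f0)).
exists e, d; split=> // r /andP[r0 rd].
have : ball (0 : R) d r by rewrite /ball /= sub0r normrN gtr0_norm.
by move=> /dP; rewrite /= /f subr_gt0 => /ltW; rewrite expr2.
Qed.

(* The unit-speed field on slopes is qf / sqrt (- qh), so this says that it is at most linear in
   the distance r to the end. *)
Lemma end_estimate (R : realType) (b : quartic R) (rho : R) : q0 b = 0 -> 0 < rho ->
  (forall r, 0 < r < rho -> qh b 1 r < 0) ->
  exists e d, [/\ 0 < e, 0 < d & forall r, 0 < r < d ->
    e * qf b 1 r ^+ 2 <= r ^+ 2 * - qh b 1 r].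
Proof.
move=> b0 rho0 hneg.
have cont (f : R -> R) : (forall r : R, exists d : R, is_derive r 1 f d) -> continuous f.
  by move=> fd r; have [d dr] := fd r; exact: is_derive_continuous dr.
(* [i + 1] is the multiplicity of the zero of [qf] at [r = 0], and [- qh] vanishes there to order
   [2 i], so both sides carry [r ^ (2 i + 2)]. Multiplicity 4 is excluded by [qh < 0]. *)
suff [i [E [k [Ec kc E0 kE EE]]]] : exists (i : nat) (E k : R -> R),
    [/\ continuous E, continuous k, 0 < E 0,
     forall r, qf b 1 r = r ^+ i.+1 * k r & forall r, - qh b 1 r = r ^+ (2 * i) * E r].
  have [e [d [e0 d0 H]]] := dominated_near_0 Ec kc E0.
  exists e, d; split=> // r rd; have /andP[r0 _] := rd; rewrite kE EE.
  have -> : e * (r ^+ i.+1 * k r) ^+ 2 = r ^+ (2 * i.+1) * (e * k r ^+ 2).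
    by rewrite exprMn -exprM mulnC; ring.
  rewrite [leRHS]mulrA -exprD mulnS ler_pM2l ?exprn_gt0//; exact: H.
have [b1|b1] := eqVneq (q1 b) 0; last first.
  exists 0%N, (fun r => q1 b ^+ 2 + 2 * q1 b * q2 b * r
      + (3 * q2 b ^+ 2 - 2 * q1 b * q3 b) * r ^+ 2
      - 2 * (q1 b * q4 b - q2 b * q3 b) * r ^+ 3
      - (q2 b * q4 b - q3 b ^+ 2) * r ^+ 4),
    (fun r => 4 * q1 b + 6 * q2 b * r + 4 * q3 b * r ^+ 2 + q4 b * r ^+ 3).
  split.
  - by apply: cont => r; eexists.
  - by apply: cont => r; eexists.
  - by rewrite !expr0n /= !mulr0 !addr0 !subr0 exprn_even_gt0.
  - by move=> r; rewrite /qf b0; ring.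
  - by move=> r; rewrite /qh b0; ring.
have [b2|b2] := eqVneq (q2 b) 0; last first.
  exists 1%N, (fun r => 3 * q2 b ^+ 2 + 2 * (q2 b * q3 b) * r
      - (q2 b * q4 b - q3 b ^+ 2) * r ^+ 2),
    (fun r => 6 * q2 b + 4 * q3 b * r + q4 b * r ^+ 2).
  split.
  - by apply: cont => r; eexists.
  - by apply: cont => r; eexists.
  - by rewrite !expr0n /= !mulr0 !addr0 !subr0 mulr_gt0// exprn_even_gt0.
  - by move=> r; rewrite /qf b0 b1; ring.
  - by move=> r; rewrite /qh b0 b1; ring.
exists 2, (fun r => q3 b ^+ 2), (fun r => 4 * q3 b + q4 b * r).
split.
- by move=> r; exact: cst_continuous.
- by apply: cont => r; eexists.
- have := hneg (rho / 2) ltac:(lra).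
  rewrite /qh b0 b1 b2 => h; rewrite exprn_even_gt0//=.
  by apply: contraTneq h => ->; rewrite -leNgt; rewrite le_eqVlt; apply/orP; left; apply/eqP; ring.
- by move=> r; rewrite /qf b0 b1 b2; ring.
- by move=> r; rewrite /qh b0 b1 b2; ring.
Qed.

(** The sign [s] lets one statement serve the left and the right end, with [r] measured inwards. *)
Lemma arc_end_estimate (R : realType) (a : quartic R) (t1 d : R) (s : R) :
  s ^+ 2 = 1 -> 0 < d -> qf a 1 t1 = 0 ->
  (forall r, 0 < r < d -> qh a 1 (t1 + s * r) < 0) ->
  exists e d, [/\ 0 < e, 0 < d & forall r, 0 < r < d ->
    e * qf a 1 (t1 + s * r) ^+ 2 <= r ^+ 2 * - qh a 1 (t1 + s * r)].
Proof.
move=> s1 d0 f1 hneg; pose b := qsubst a 1 0 t1 s.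
have fE r : qf b 1 r = qf a 1 (t1 + s * r).
  by rewrite qf_subst !mulr1 mul0r addr0.
have hE r : qh b 1 r = qh a 1 (t1 + s * r).
  by rewrite qh_subst !mulr1 !mul0r mul1r !addr0 subr0 s1 mul1r.
have [||e [d' [e0 d'0 H]]] := @end_estimate R b d _ d0.
- by rewrite -f1 /qf /= /polar /=; ring.
- by move=> r rd; rewrite hE; exact: hneg.
- by exists e, d'; split=> // r rd; rewrite -fE -hE; exact: H.
Qed.

(** Near each end the bound at that end applies, the distance to the other end being at least
    [D / 2]; on the compact middle part the quotient [v] has a positive minimum. *)
Lemma arc_estimate (R : realType) (a : quartic R) (t0 t1 : R) : t0 < t1 ->
  (forall t, t0 < t < t1 -> 0 < qf a 1 t /\ qh a 1 t < 0) ->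
  qf a 1 t0 = 0 -> qf a 1 t1 = 0 ->
  exists2 e, 0 < e & forall t, t0 < t < t1 ->
    e * qf a 1 t ^+ 2 <= ((t - t0) * (t1 - t)) ^+ 2 * - qh a 1 t.
Proof.
move=> t01 fh f0 f1; pose D := t1 - t0; have D0 : 0 < D by rewrite subr_gt0.
have [|||r r0|e1 [d1 [e10 d10 H1]]] := @arc_end_estimate R a t1 D (-1).
- by rewrite sqrrN expr1n.
- by [].
- by [].
- by apply: (fh _ _).2; rewrite /D in r0; lra.
have [|||r r0|e0 [d0 [e00 d00 H0]]] := @arc_end_estimate R a t0 D 1.
- by rewrite expr1n.
- by [].
- by [].
- by apply: (fh _ _).2; rewrite /D in r0; lra.
pose d := Num.min (D / 2) (Num.min d0 d1).
have dd : 0 < d by rewrite !lt_min d00 d10 divr_gt0.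
have [dD dd0 dd1] : [/\ d <= D / 2, d <= d0 & d <= d1].
  by rewrite !ge_min !lexx !orbT.
have comb (x u y : R) : D / 2 <= x -> 0 <= u -> u <= y ->
    (D / 2) ^+ 2 * u <= x ^+ 2 * y.
  move=> Dx u0 uy; have D2 : 0 <= D / 2 by rewrite divr_ge0// ltW.
  by apply: ler_pM; rewrite ?sqr_ge0// ler_sqr ?nnegrE// (le_trans D2).
have near1 t : t1 - d < t < t1 ->
    e1 * (D / 2) ^+ 2 * qf a 1 t ^+ 2 <= ((t - t0) * (t1 - t)) ^+ 2 * - qh a 1 t.
  move=> /andP[td tt1]; have := H1 (t1 - t) ltac:(lra).
  rewrite (_ : t1 + -1 * (t1 - t) = t); last by ring.
  move=> h; have tt0 : D / 2 <= t - t0 by rewrite /D in dD *; lra.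
  have -> : e1 * (D / 2) ^+ 2 * qf a 1 t ^+ 2 = (D / 2) ^+ 2 * (e1 * qf a 1 t ^+ 2) by ring.
  by rewrite [in leRHS]exprMn -[leRHS]mulrA; apply: comb => //; rewrite mulr_ge0 ?sqr_ge0 ?ltW.
have near0 t : t0 < t < t0 + d ->
    e0 * (D / 2) ^+ 2 * qf a 1 t ^+ 2 <= ((t - t0) * (t1 - t)) ^+ 2 * - qh a 1 t.
  move=> /andP[td tt1]; have := H0 (t - t0) ltac:(lra).
  rewrite (_ : t0 + 1 * (t - t0) = t); last by ring.
  move=> h; have tt0 : D / 2 <= t1 - t by rewrite /D in dD *; lra.
  have -> : e0 * (D / 2) ^+ 2 * qf a 1 t ^+ 2 = (D / 2) ^+ 2 * (e0 * qf a 1 t ^+ 2) by ring.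
  rewrite [(t - t0) * _]mulrC [in leRHS]exprMn -[leRHS]mulrA.
  by apply: comb => //; rewrite mulr_ge0 ?sqr_ge0 ?ltW.
pose v t := ((t - t0) * (t1 - t)) * ((t - t0) * (t1 - t)) * - qh a 1 t / (qf a 1 t * qf a 1 t).
pose u0 := t0 + d / 2; pose u1 := t1 - d / 2.
have u01 : u0 <= u1 by rewrite /u0 /u1; rewrite /D in dD; lra.
have uin t : t \in `[u0, u1]%R -> t0 < t < t1.
  by rewrite in_itv /= /u0 /u1 => h; lra.
have vc : {within `[u0, u1], continuous v}.
  apply: continuous_in_subspaceT => t; rewrite inE /= => tu.
  have [ft _] := fh t (uin t tu).
  have Pc : {for t, continuous (fun t => (t - t0) * (t1 - t))}.
    by apply: continuousM; apply: continuousB; (exact: cst_continuous || exact: cvg_id).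
  suff : {for t, continuous v} by [].
  apply: continuousM.
    apply: continuousM; first exact: continuousM.
    by apply: continuousN; exact: qh1_continuous.
  apply: continuousV; first by rewrite gt_eqF// mulr_gt0.
  by apply: continuousM; exact: qf1_continuous.
have [c cu cmin] := EVT_min u01 vc.
have vpos t : t0 < t < t1 -> 0 < v t.
  move=> tt; have [ft ht] := fh t tt; have /andP[h0 h1] := tt.
  by rewrite !(mulr_gt0, invr_gt0, oppr_gt0)// subr_gt0.
have vc0 := vpos c (uin c cu).
pose e := Num.min (v c) (Num.min (e1 * (D / 2) ^+ 2) (e0 * (D / 2) ^+ 2)).
have De k : 0 < k -> 0 < k * (D / 2) ^+ 2 by move=> k0; rewrite mulr_gt0// exprn_gt0// divr_gt0.
exists e; first by rewrite !lt_min vc0 !De.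
have [ec ee1 ee0] : [/\ e <= v c, e <= e1 * (D / 2) ^+ 2 & e <= e0 * (D / 2) ^+ 2].
  by rewrite !ge_min !lexx !orbT.
move=> t tt; have f2 := sqr_ge0 (qf a 1 t).
have [tu0|tu0] := ltP t u0.
  apply: le_trans (near0 t _); last by rewrite /u0 in tu0; lra.
  exact: ler_wpM2r.
have [tu1|tu1] := ltP u1 t.
  apply: le_trans (near1 t _); last by rewrite /u1 in tu1; lra.
  exact: ler_wpM2r.
have [ft ht] := fh t tt.
have tu : t \in `[u0, u1]%R by rewrite in_itv /= tu0.
have := le_trans ec (cmin t tu).
by rewrite /v ler_pdivlMr ?mulr_gt0// -!expr2.
Qed.

Lemma is_derive_rad (R : realType) (f : R) : 0 < f ->
  is_derive f 1 (@rad R) (- rad f / (4 * f)).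
Proof.
move=> f0; have s0 : 0 < Num.sqrt f by rewrite sqrtr_gt0.
have ss0 : 0 < Num.sqrt (Num.sqrt f) by rewrite sqrtr_gt0.
have d2 := is_derive1_comp (is_derive1_sqrt s0) (is_derive1_sqrt f0).
have d3 := @is_deriveV _ (Num.sqrt \o Num.sqrt) _ _ _ (lt0r_neq0 ss0) d2.
apply: (is_derive_eq d3); rewrite /rad /GRing.scale /=.
have := sqr_sqrtr (ltW f0); have := sqr_sqrtr (ltW s0).
move: s0 ss0; set s := Num.sqrt f; set u := Num.sqrt s => s0 ss0 us sf.
rewrite -sf -us; field; exact: lt0r_neq0.
Qed.

Lemma tangent_wedge0 (R : realType) (a : quartic R) (P V : R * R) :
  polar a P P P P = 1 -> polar a P P P V = 0 -> wedge P V = 0 -> V = (0, 0).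
Proof.
move=> h1 hV w0; rewrite [V]surjective_pairing; congr (_, _).
  have : V.1 * polar a P P P P = P.1 * polar a P P P V
      - polar a P P P (0, 1) * wedge P V by rewrite /wedge /polar /=; ring.
  by rewrite h1 hV w0 !mulr0 subr0 mulr1.
have : V.2 * polar a P P P P = P.2 * polar a P P P V
    + polar a P P P (1, 0) * wedge P V by rewrite /wedge /polar /=; ring.
by rewrite h1 hV w0 !mulr0 addr0 mulr1.
Qed.

(** For [P = (r, r T)] the area [wedge P P'] is [r^2 T']. With [T' = c qf / sqrt (- qh)] and
    [r^4 = 1 / qf], the speed, [qh] at [P] times the squared area, is then the constant [- c^2]. *)
Lemma unit_speed_curve (R : realType) (a : quartic R) (t0 t1 c : R) (T : R -> R) :
  (forall t, t0 < t < t1 -> 0 < qf a 1 t /\ qh a 1 t < 0) ->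
  (forall u, t0 < T u < t1) ->
  (forall u : R, is_derive u 1 T (c * (qf a 1 (T u) / Num.sqrt (- qh a 1 (T u))))) ->
  let g := fun u => pt a (T u) in
  [/\ forall u, derivable g u 1, forall u, derivable (derive1 g) u 1 &
    forall u, wedge (coords (g u)) (coords (derive1 g u)) =
      c * (qf a 1 (T u) / Num.sqrt (- qh a 1 (T u)) * rad (qf a 1 (T u)) ^+ 2)].
Proof.
move=> fh Ti dT g.
pose f t : R := qf a 1 t; pose h t : R := qh a 1 t.
pose df t : R := 4 * (q1 a + 3 * q2 a * t + 3 * q3 a * t ^+ 2 + q4 a * t ^+ 3).
have fd (t : R) : is_derive t 1 f (df t).
  by rewrite /f /qf; apply: is_derive_eq; rewrite /df /GRing.scale /=; ring.
have dfd (t : R) : exists d : R, is_derive t 1 df d by rewrite /df; eexists.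
have hd (t : R) : exists d : R, is_derive t 1 h d.
  by rewrite /h /qh /=; eexists.
pose w t : R := f t * (Num.sqrt (- h t))^-1.
pose rho t : R := rad (f t).
pose drho t : R := - rad (f t) * (4 * f t)^-1 * df t.
have rhod (t : R) : t0 < t < t1 -> is_derive t 1 rho (drho t).
  by move=> /fh[f0 _]; exact: (is_derive1_comp (is_derive_rad f0) (fd t)).
have wd (t : R) : t0 < t < t1 -> exists d : R, is_derive t 1 w d.
  move=> /fh[f0 h0]; have [d hd'] := hd t.
  have nh : 0 < - h t by rewrite oppr_gt0.
  have nd : is_derive t 1 (fun t => - h t) (- d) by exact: is_deriveN.
  have sd := @is_derive1_comp _ Num.sqrt (fun t => - h t) t _ _ (is_derive1_sqrt nh) nd.
  have s0 : Num.sqrt (- h t) != 0 by rewrite gt_eqF// sqrtr_gt0.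
  have sV := @is_deriveV _ (Num.sqrt \o (fun t => - h t)) _ _ _ s0 sd.
  by eexists; apply: (is_deriveM (fd t) sV).
pose V1 t := w t * drho t; pose V2 t := t * V1 t + w t * rho t.
have V1d (t : R) : t0 < t < t1 -> exists d : R, is_derive t 1 V1 d.
  move=> tt; have [dw wd'] := wd t tt; have [ddf dfd'] := dfd t.
  have f0 : 4 * f t != 0 by rewrite mulf_neq0 ?pnatr_eq0// gt_eqF//; apply: (fh t tt).1.
  have fV := @is_deriveV _ (fun t => 4 * f t) _ _ _ f0 (is_deriveZ 4 (fd t)).
  by eexists; apply: (is_deriveM wd' (is_deriveM (is_deriveM (is_deriveN (rhod t tt)) fV) dfd')).
have V2d (t : R) : t0 < t < t1 -> exists d : R, is_derive t 1 V2 d.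
  move=> tt; have [dw wd'] := wd t tt; have [dV Vd] := V1d t tt.
  by eexists; apply: (is_deriveD (is_deriveM (is_derive_id t 1) Vd) (is_deriveM wd' (rhod t tt))).
have dg u : derivable g u 1 /\ derive1 g u = vec (c * V1 (T u)) (c * V2 (T u)).
  have d1 := is_derive1_comp (rhod _ (Ti u)) (dT u).
  have d2 := is_deriveM d1 (dT u).
  have [dgu e] := is_derive_vec d1 d2.
  split; first exact: dgu.
  apply: (etrans e); rewrite /GRing.scale /= -/(f (T u)) -/(h (T u)) -/(w (T u)).
  by rewrite -/(rho (T u)) /V2 /V1; congr vec; ring.
have dgE : derive1 g = (fun u => vec (c * V1 (T u)) (c * V2 (T u))).
  by apply/funext => u; have [] := dg u.
split=> u; first by have [] := dg u.
  have [d1 V1d'] := V1d _ (Ti u); have [d2 V2d'] := V2d _ (Ti u).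
  have e1 := is_deriveZ c (is_derive1_comp V1d' (dT u)).
  have e2 := is_deriveZ c (is_derive1_comp V2d' (dT u)).
  have [dd _] := is_derive_vec e1 e2.
  by rewrite dgE; exact: dd.
rewrite dgE coords_vec /g coords_pt /wedge /= -/(f (T u)) -/(h (T u)) -/(w (T u)) -/(rho (T u)).
by rewrite /V2; ring.
Qed.

Lemma stdq_complete (R : realType) (L K t0 t1 : R) : t0 < 0 -> 0 < t1 ->
  (forall t, t0 < t < t1 -> 0 < qf (stdq L K) 1 t /\ qh (stdq L K) 1 t < 0) ->
  qf (stdq L K) 1 t0 = 0 -> qf (stdq L K) 1 t1 = 0 ->
  geodesically_complete (mform (stdq L K))
    (connected_component (hyperbolic_level (mform (stdq L K))) (vec 1 0)).
Proof.
set a := stdq L K => t00 t10 fh f0 f1.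
set S := hyperbolic_level (mform a); set H := connected_component S _.
have HS : H `<=` S by exact: connected_component_sub.
have t01 : t0 < t1 by exact: lt_trans t10.
move=> p v Hp hv.
have [x0 tpi] : 0 < (coords p).1 /\ t0 < (coords p).2 / (coords p).1 < t1.
  by apply: stdq_component Hp => //; rewrite ?f0 ?f1 ltxx => -[].
set tp := (coords p).2 / (coords p).1 in tpi.
have [pE fp hp] := level_slope x0 (HS _ Hp).
have hP : polar a (coords p) (coords p) (coords p) (coords p) = 1.
  by rewrite polar_diag; have /hyperbolic_levelE[] := HS _ Hp.
move: hv; rewrite d1_mform => /eqP; rewrite mulf_eq0 pnatr_eq0 /= => /eqP hv.
(* A zero velocity is treated apart: its geodesic is constant, of speed 0, which [geodesic_of_speed]
   does not cover. *)
have [v0|v0] := eqVneq (wedge (coords p) (coords v)) 0.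
  have v00 : v = 0.
    by apply: colP2; rewrite (tangent_wedge0 hP hv v0) /coords !mxE.
  exists (cst p); rewrite v00.
  have dc (q : 'cV[R]_2) : derive1 (cst q : R -> 'cV[R]_2) = cst 0.
    by apply/funext => t; rewrite derive1_cst.
  split=> //; last by rewrite dc.
  split=> [t|t|t|t X _]; rewrite ?dc ?dc//.
  by rewrite d2_mform d3_mform /coords /= !mxE /polar /=; ring.
have [e e0 He] := arc_estimate t01 fh f0 f1.
pose w t : R := qf a 1 t / Num.sqrt (- qh a 1 t).
have w0 t : t0 < t < t1 -> 0 < w t.
  by move=> /fh[ft ht]; rewrite divr_gt0// sqrtr_gt0 oppr_gt0.
pose C := (Num.sqrt e)^-1.
have C0 : 0 < C by rewrite invr_gt0 sqrtr_gt0.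
have wb t : t0 < t < t1 -> 0 < w t <= C * ((t - t0) * (t1 - t)).
  move=> tt; rewrite w0//=; have [ft ht] := fh t tt; have /andP[h0 h1] := tt.
  have P0 : 0 <= (t - t0) * (t1 - t) by rewrite mulr_ge0 ?subr_ge0 ?ltW.
  rewrite /w ler_pdivrMr ?sqrtr_gt0 ?oppr_gt0//.
  rewrite /C -mulrA ler_pdivlMl ?sqrtr_gt0//.
  rewrite -(@ler_sqr R) ?nnegrE ?(mulr_ge0 (sqrtr_ge0 _) (ltW ft)) ?(mulr_ge0 P0 (sqrtr_ge0 _))//.
  by rewrite !exprMn !sqr_sqrtr ?oppr_ge0 ?(ltW e0) ?(ltW ht)// -exprMn; exact: He.
have wc t : t0 < t < t1 -> {for t, continuous w}.
  move=> /fh[ft ht]; apply: continuousM; first exact: qf1_continuous.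
  apply: continuousV; first by rewrite gt_eqF// sqrtr_gt0 oppr_gt0.
  apply: continuous_comp; last exact: sqrt_continuous.
  by apply: continuousN; exact: qh1_continuous.
set r := rad (qf a 1 tp); have r0 : 0 < r by exact: rad_gt0.
(* This [c] gives the initial velocity the same area with [p] as [v], and a tangent vector at [p] is
   determined by that area. *)
pose c := wedge (coords p) (coords v) / (w tp * r ^+ 2).
have wr0 : w tp * r ^+ 2 != 0 by rewrite mulf_neq0 ?gt_eqF ?exprn_gt0 ?w0.
have c0 : c != 0 by rewrite mulf_neq0// invr_eq0.
have [T [T0 Ti dT]] := autonomous_flow t01 wc wb c tpi.
have [dg ddg wg] := unit_speed_curve fh Ti dT.
set g := (fun u => pt a (T u)) in dg ddg wg.
have Hg u : H (g u).
  apply: (@arc_sub_component R a [set t | t0 < t < t1] H 0).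
  - by move=> x y /= /andP[? ?] /andP[? ?] z /andP[? ?]; apply/andP; split; lra.
  - by [].
  - exists (vec 1 0) => //; apply/hyperbolic_levelE.
    by rewrite coords_vec /qf /qh /=; split; lra.
  - by rewrite /= t00.
  - have -> : pt a 0 = vec 1 0.
      apply: colP2; rewrite coords_pt coords_vec mulr0 mulr1 /rad.
      by rewrite (_ : qf a 1 0 = 1) ?sqrtr1 ?invr1// /qf /=; ring.
    apply: connected_component_refl; apply/hyperbolic_levelE.
    by rewrite coords_vec /qf /qh /=; split; lra.
  - exact: Ti.
have lev u : qf a (coords (g u)).1 (coords (g u)).2 = 1.
  by have /hyperbolic_levelE[] := HS _ (Hg u).
have tang := tangent_of_level lev dg.
have g0 : g 0 = p by rewrite pE /g T0.
exists g; split=> //.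
  apply: (@geodesic_of_speed _ _ _ _ (- c ^+ 2)) => //; first by rewrite oppr_eq0 expf_neq0.
  move=> u P V; have [ft ht] := fh _ (Ti u).
  have := polar_hessian a P V; rewrite polar_diag lev tang expr0n subr0 mul1r => ->.
  rewrite -/(wedge P V) wg /P qh_pt//.
  have -> : (c * (qf a 1 (T u) / Num.sqrt (- qh a 1 (T u)) * rad (qf a 1 (T u)) ^+ 2)) ^+ 2
    = c ^+ 2 * qf a 1 (T u) ^+ 2 / Num.sqrt (- qh a 1 (T u)) ^+ 2 * rad (qf a 1 (T u)) ^+ 4.
    by field; rewrite gt_eqF// sqrtr_gt0 oppr_gt0.
  rewrite rad4// sqr_sqrtr ?oppr_ge0 ?ltW//.
  by field; rewrite ?(gt_eqF ft) ?(lt_eqF ht).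
apply: colP2.
have := tang 0; rewrite g0 => tang0; have [] := tangent_line hP tang0 hv.
have -> : wedge (coords p) (coords (derive1 g 0)) = wedge (coords p) (coords v).
  rewrite -{1}g0 wg T0 -/(w tp) -/r /c divfK//.
move=> e1 e2; rewrite [LHS]surjective_pairing [RHS]surjective_pairing.
by congr (_, _); apply: (mulfI v0).
Qed.

(** * Incompleteness at a flat end *)

Lemma constant_sign (R : realType) (f : R -> R) : continuous f ->
  (forall x, f x != 0) -> 0 < f 0 -> forall x, 0 < f x.
Proof.
move=> fc f0 f00 x; rewrite ltNge; apply/negP => fx.
have ivt a b : a <= b -> Num.min (f a) (f b) <= 0 <= Num.max (f a) (f b) -> False.
  move=> ab fab; have [|c _ fc0] := @IVT R f a b 0 ab _ fab.
    exact: continuous_subspaceT.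
  by have := f0 c; rewrite fc0 eqxx.
have [x0|x0] := leP 0 x.
  by apply: (ivt 0 x) => //; rewrite ge_min le_max fx (ltW f00) orbT.
by apply: (ivt x 0); [exact: ltW | rewrite ge_min le_max fx (ltW f00) orbT].
Qed.

(* On a geodesic pt b s(u) the quantity - qh * wedge^2 is constant, which bounds |s'| away from 0
   near the end, so that s leaves ]0, s0] in finite time. *)
Lemma flat_end_incomplete (R : realType) (b : quartic R) (H : set 'cV[R]_2) (d : R) :
  q0 b = 1 -> q1 b = 0 -> q2 b = 0 -> components (mform b) H -> 0 < d ->
  (forall s, 0 < s < d -> H (pt b s)) -> incomplete (mform b) H.
Proof.
move=> b0 b1 b2 [p0 Sp0 HE] d0 Hd comp.
have HS : H `<=` hyperbolic_level (mform b) by rewrite -HE; exact: connected_component_sub.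
(* [s0] is chosen from [N] so that [4 q3 s^3 + q4 s^4 >= - 1/2] for [0 < s <= s0]. *)
pose N := 4 * `|q3 b| + `|q4 b| + 1.
have N1 : 1 <= N by rewrite /N lerDr addr_ge0// mulr_ge0.
pose s0 := Num.min (d / 2) (2 * N)^-1.
have s00 : 0 < s0 by rewrite lt_min divr_gt0// invr_gt0 mulr_gt0// (lt_le_trans _ N1).
have s0d : s0 < d by rewrite gt_min; apply/orP; left; lra.
have s0N : s0 * (2 * N) <= 1.
  rewrite -ler_pdivlMr ?mul1r; first by rewrite ge_min lexx orbT.
  by rewrite mulr_gt0// (lt_le_trans _ N1).
have s01 : s0 <= 1 by nra.
have fge s : 0 < s <= s0 -> 2^-1 <= qf b 1 s.
  move=> /andP[sp ss]; rewrite /qf b0 b1 b2.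
  have s1 : s <= 1 by exact: le_trans s01.
  have s3 : s ^+ 3 <= s by rewrite -[leRHS]expr1 ler_wiXn2l// ltW.
  have s4 : s ^+ 4 <= s by rewrite -[leRHS]expr1 ler_wiXn2l// ltW.
  have s3' : 0 <= s ^+ 3 by rewrite exprn_ge0// ltW.
  have s4' : 0 <= s ^+ 4 by rewrite exprn_ge0// ltW.
  have h3 : - `|q3 b| <= q3 b by rewrite lerNl -normrN ler_norm.
  have h4 : - `|q4 b| <= q4 b by rewrite lerNl -normrN ler_norm.
  have m3 : - `|q3 b| * s <= q3 b * s ^+ 3.
    by have := normr_ge0 (q3 b); nra.
  have m4 : - `|q4 b| * s <= q4 b * s ^+ 4.
    by have := normr_ge0 (q4 b); nra.
  have sN : s * (2 * N) <= 1 by rewrite (le_trans _ s0N)// ler_wpM2r// mulr_ge0// (le_trans _ N1).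
  by rewrite /N in sN; nra.
pose M := 2 * `|q3 b| + `|q4 b| + q3 b ^+ 2 + 1.
have M0 : 0 < M by rewrite ltr_wpDl// !addr_ge0// ?sqr_ge0// mulr_ge0.
have hle s : 0 < s <= s0 -> - qh b 1 s <= M.
  move=> /andP[sp ss]; rewrite /qh b0 b1 b2.
  have s1 : s <= 1 by exact: le_trans s01.
  have s2 : s ^+ 2 <= 1 by rewrite exprn_ile1// ltW.
  have s4 : s ^+ 4 <= 1 by rewrite exprn_ile1// ltW.
  have s2' : 0 <= s ^+ 2 by exact: sqr_ge0.
  have h3 : - q3 b <= `|q3 b| by rewrite -normrN ler_norm.
  have h4 : - q4 b <= `|q4 b| by rewrite -normrN ler_norm.
  have m3 : - q3 b * s <= `|q3 b| by have := normr_ge0 (q3 b); nra.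
  have m4 : - q4 b * s ^+ 2 <= `|q4 b| by have := normr_ge0 (q4 b); nra.
  have m5 : q3 b ^+ 2 * s ^+ 4 <= q3 b ^+ 2 by rewrite ler_piMr// sqr_ge0.
  by rewrite /M; lra.
have s0d' : 0 < s0 < d by rewrite s00.
set p := pt b s0; have Hp : H p by exact: Hd.
have [f0 h0] := level_pt_inv (HS _ Hp).
set P := coords p.
have hP : polar b P P P P = 1 by rewrite polar_diag qf_pt.
pose P1 := polar b P P P (1, 0); pose P2 := polar b P P P (0, 1).
(* The tangent vector at [p] that points towards the flat end, normalised to area -1. *)
pose v := vec P2 (- P1).
have vt : polar b P P P (coords v) = 0.
  by rewrite coords_vec /P1 /P2 /polar /=; ring.
have wv : wedge P (coords v) = -1.
  by rewrite -hP coords_vec /wedge /P1 /P2 /polar /=; ring.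
have [|g [gg g0 g1]] := comp p v Hp; first by rewrite d1_mform vt mulr0.
have speed := geodesic_speed HS gg.
have [Hg gd gdd _] := gg.
pose x t := (coords (g t)).1; pose y t := (coords (g t)).2.
pose x1 t := (coords (derive1 g t)).1; pose y1 t := (coords (derive1 g t)).2.
have dx (t : R) : is_derive t 1 x (x1 t) by have [] := is_derive_coords (gd t).
have dy (t : R) : is_derive t 1 y (y1 t) by have [] := is_derive_coords (gd t).
have cx : continuous x by move=> t; exact: is_derive_continuous (dx t).
have cy : continuous y by move=> t; exact: is_derive_continuous (dy t).
have cx1 : continuous x1.
  by move=> t; have [h _] := is_derive_coords (gdd t); exact: is_derive_continuous h.
have cy1 : continuous y1.
  by move=> t; have [_ h] := is_derive_coords (gdd t); exact: is_derive_continuous h.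
pose w t := x t * y1 t - y t * x1 t.
pose k := qh b P.1 P.2.
have k0 : k < 0 by have /hyperbolic_levelE[] := HS _ Hp.
have speedE t : qh b (x t) (y t) * w t ^+ 2 = k.
  have [_ _ ->] := speed t; rewrite g0 g1.
  have := polar_hessian b P (coords v); rewrite hP vt expr0n subr0 mul1r => ->.
  by rewrite -/(wedge P (coords v)) wv sqrrN expr1n mulr1.
have w_neq0 t : - w t != 0.
  rewrite oppr_eq0; apply: contra_ltN k0 => /eqP w0.
  by rewrite -(speedE t) w0 expr0n mulr0.
have cw : continuous w.
  move=> u; apply: (@continuousB _ _ _ (fun t => x t * y1 t) (fun t => y t * x1 t));
    by apply: continuousM; [exact: cx || exact: cy | exact: cx1 || exact: cy1].
have wneg t : 0 < - w t.
  apply: (@constant_sign R (fun t => - w t)) => //.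
    by move=> u; apply: (@continuousN _ _ _ w); exact: cw.
  suff -> : w 0 = -1 by rewrite opprK.
  by rewrite /w /x /y /x1 /y1 g0 g1 -wv.
have levE t : qf b (x t) (y t) = 1 /\ qh b (x t) (y t) < 0.
  by have /hyperbolic_levelE := HS _ (Hg t).
(* The geodesic never crosses the first axis, because [qh] vanishes there. *)
have y0 t : 0 < y t.
  apply: (@constant_sign R y) => // [u|].
    have [_ hu] := levE u; apply: contraTneq hu => ->; rewrite -leNgt.
    by rewrite /qh b1 b2 le_eqVlt; apply/orP; left; apply/eqP; ring.
  by rewrite /y g0 coords_pt /= mulr_gt0// rad_gt0.
(* [x / y] rather than the slope [y / x]: so far only [y] is known not to vanish. As [x / y]
   increases, [x] stays positive for [t >= 0], and the slope becomes available. *)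
pose z t := x t / y t.
have dz (t : R) : is_derive t 1 z (- w t / y t ^+ 2).
  have y0' : y t != 0 by rewrite gt_eqF.
  apply: (is_derive_eq (is_deriveM (dx t) (@is_deriveV _ y _ _ _ y0' (dy t)))).
  by rewrite /GRing.scale /= /w; field.
have z0 : z 0 = s0^-1.
  rewrite /z /x /y g0 coords_pt /= mulr1 invfM mulrA divff ?mul1r//.
  by rewrite gt_eqF// rad_gt0.
have zge t : 0 <= t -> s0^-1 <= z t.
  rewrite le_eqVlt => /orP[/eqP <-|t0]; first by rewrite z0.
  have [c [_ zE]] := mean_value t0 (fun u _ => dz u).
  rewrite -z0 -subr_ge0 zE mulr_ge0 ?subr0 ?(ltW t0)//.
  by rewrite ltW// divr_gt0// exprn_gt0.
have x_gt0 t : 0 <= t -> 0 < x t.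
  move=> /zge h; have : 0 < z t by rewrite (lt_le_trans _ h)// invr_gt0.
  by rewrite /z pmulr_lgt0// invr_gt0.
pose s t := y t / x t.
have sin t : 0 <= t -> 0 < s t <= s0.
  move=> t0; rewrite divr_gt0 ?x_gt0//=.
  rewrite -[s t]invrK /s invf_div -[s0]invrK lef_pV2 ?posrE ?invr_gt0//; first exact: zge.
  by rewrite divr_gt0// x_gt0.
(* From [s'^2 = - k qf^2 / (- qh)] with [qf >= 1/2] and [- qh <= M]. *)
pose kap := Num.sqrt (- k / (4 * M)).
have kk0 : 0 < - k / (4 * M) by rewrite divr_gt0 ?oppr_gt0// mulr_gt0.
have kap0 : 0 < kap by rewrite sqrtr_gt0.
have sd (t : R) : 0 <= t -> is_derive t 1 s (w t / x t ^+ 2).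
  move=> t0; have x0' : x t != 0 by rewrite gt_eqF// x_gt0.
  apply: (is_derive_eq (is_deriveM (dy t) (@is_deriveV _ x _ _ _ x0' (dx t)))).
  by rewrite /GRing.scale /= /w; field.
have sdle t : 0 <= t -> w t / x t ^+ 2 <= - kap.
  move=> t0; have x0 := x_gt0 t t0; have st := sin t t0.
  have x20 : 0 < x t ^+ 2 by rewrite exprn_gt0.
  rewrite -lerN2 opprK -mulNr.
  have h1 : 0 <= - w t / x t ^+ 2 by rewrite divr_ge0// ltW.
  rewrite -(@ler_sqr R) ?nnegrE ?(ltW kap0)// sqr_sqrtr ?(ltW kk0)//.
  have [fs hs] := slope_scale b (y t) (lt0r_neq0 x0); rewrite -/(s t) in fs hs.
  have [lf lh] := levE t; rewrite lf in fs.
  have fg := fge _ st; have hl := hle _ st.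
  have hneg : qh b 1 (s t) < 0 by move: lh; rewrite hs pmulr_rlt0// exprn_gt0.
  have x40 : 0 < x t ^+ 4 by rewrite exprn_gt0.
  have -> : (- w t / x t ^+ 2) ^+ 2 = - k * qf b 1 (s t) ^+ 2 / - qh b 1 (s t).
    have fE : qf b 1 (s t) = (x t ^+ 4)^-1.
      by apply: (mulfI (lt0r_neq0 x40)); rewrite -fs divff// gt_eqF.
    rewrite fE -(speedE t) hs; field.
    by rewrite (lt_eqF hneg) (gt_eqF x0).
  rewrite ler_pdivlMr ?oppr_gt0// mulrAC ler_pdivrMr ?mulr_gt0//.
  rewrite -[leRHS]mulrA ler_pM2l ?oppr_gt0//.
  apply: (le_trans hl); have f2 : 4^-1 <= qf b 1 (s t) ^+ 2 by nra.
  have M4 : 0 <= 4 * M by rewrite mulr_ge0// ltW.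
  by have := ler_wpM2r M4 f2; rewrite mulKf.
(* The time by which a slope that starts at [s0] and decreases at rate at least [kap] would have
   reached 0. *)
pose t := s0 / kap; have t0 : 0 < t by rewrite divr_gt0.
have [u /andP[u0 _]|c [/andP[c0 _] sE]] := @mean_value R s (fun t => w t / x t ^+ 2) 0 t t0.
  exact: sd.
have s0E : s 0 = s0 by rewrite /s -[y 0 / x 0]invrK invf_div -/(z 0) z0 invrK.
have := sdle c (ltW c0); have /andP[st _] := sin t (ltW t0).
have kt : kap * t = s0 by rewrite /t mulrC divfK// gt_eqF.
move: sE; rewrite subr0 s0E; nra.
Qed.

Lemma good_end_incomplete (R : realType) (a : quartic R) (H : set 'cV[R]_2) :
  components (mform a) H -> good_end a H -> incomplete (mform a) H.
Proof.
move=> cH [B [d [Bu d0 [b0 b1 b2] HB]]] comp.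
set b := msubst a B in b0 b1 b2 HB.
have Vu : invmx B \in unitmx by rewrite unitmx_inv.
have aE : msubst b (invmx B) = a by rewrite msubstM mulmxV// msubst1.
have := flat_end_incomplete b0 b1 b2 (H := [set invmx B *m p | p in H]) _ d0; apply.
- by have := @components_msubst R b (invmx B) H Vu; rewrite aE; exact.
- by move=> s /HB Hs; exists (B *m pt b s) => //; rewrite mulKmx.
- by have := @geodesically_complete_msubst R b (invmx B) H Vu; rewrite aE; exact.
Qed.

Lemma good_end_msubst (R : realType) (a : quartic R) (A : 'M[R]_2)
    (H : set 'cV[R]_2) : A \in unitmx ->
  good_end (msubst a A) H -> good_end a [set A *m p | p in H].
Proof.
move=> Au [B [d [Bu d0 [b0 b1 b2] HB]]]; rewrite msubstM in b0 b1 b2 HB.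
exists (A *m B), d; split=> //; first by rewrite unitmx_mul Au.
by move=> s /HB Hs; exists (B *m pt (msubst a (A *m B)) s); rewrite ?mulmxA.
Qed.

Lemma std_curveE (R : realType) (L K : R) :
  std_curve L K = connected_component (hyperbolic_level (mform (stdq L K))) (vec 1 0).
Proof.
rewrite /std_curve std_quarticE; congr connected_component.
by apply: colP2; rewrite coords_vec /coords !mxE.
Qed.

Lemma stdq_level_e1 (R : realType) (L K : R) :
  hyperbolic_level (mform (stdq L K)) (vec 1 0).
Proof. by apply/hyperbolic_levelE; rewrite coords_vec /qf /qh /=; split; lra. Qed.

Lemma components_std_curve (R : realType) (L K : R) :
  components (mform (stdq L K)) (std_curve L K).
Proof. by rewrite std_curveE; exists (vec 1 0) => //; exact: stdq_level_e1. Qed.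

(** The second column is a tangent vector at [p] rescaled by [m]. Once [q0 = 1] and [q1 = 0], [q2]
    is the Hessian determinant in the new frame, that is [m^2] times [qh] at [p]; so
    [m^2 = - 1 / (6 qh)] yields the coefficient -1 of [x^2 y^2]. *)
Lemma standard_form (R : realType) (a : quartic R) (H : set 'cV[R]_2) :
  components (mform a) H ->
  exists A L K, [/\ A \in unitmx, msubst a A = stdq L K &
    H = [set A *m p | p in std_curve L K]].
Proof.
move=> [p Sp HE].
have /hyperbolic_levelE[f1 h0] := Sp.
case PE : (coords p) f1 h0 => [x y] /= f1 h0.
pose P := (x, y).
pose P1 := polar a P P P (1, 0); pose P2 := polar a P P P (0, 1).
have PP : x * P1 + y * P2 = 1 by rewrite -f1 /qf /P1 /P2 /polar /=; ring.
pose m := Num.sqrt (- (6 * qh a x y)^-1).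
have m2 : m ^+ 2 = - (6 * qh a x y)^-1.
  by rewrite sqr_sqrtr// oppr_ge0 invr_le0 pmulr_rle0// ltW.
have m0 : m != 0.
  by rewrite -sqrf_eq0 m2 oppr_eq0 invr_eq0 mulf_neq0 ?pnatr_eq0// lt_eqF.
pose A := mx2 x (m * P2) y (- (m * P1)).
have detE : x * - (m * P1) - m * P2 * y = - m.
  by rewrite -[RHS]mulr1 -PP; ring.
have Au : A \in unitmx by rewrite unitmx2 det_mx2 detE oppr_eq0.
have A0 : q0 (msubst a A) = 1 by rewrite msubst_mx2 /= -f1 /qf /polar /=; ring.
have A1 : q1 (msubst a A) = 0.
  by rewrite msubst_mx2 /= /P1 /P2 /P /polar /=; ring.
have A2 : q2 (msubst a A) = - 6^-1.
  have : qh (msubst a A) 1 0 = - 6^-1.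
    rewrite msubst_mx2 qh_subst !mulr0 !addr0 !mulr1 detE sqrrN m2.
    by field; rewrite lt_eqF.
  by rewrite /qh A0 A1 => <-; ring.
exists A, (4 * q3 (msubst a A)), (q4 (msubst a A)).
have AE : msubst a A = stdq (4 * q3 (msubst a A)) (q4 (msubst a A)).
  by apply: quartic_eq => //=; rewrite mulrC mulKf.
split=> //; rewrite std_curveE -AE connected_component_msubst//; last first.
  by rewrite AE; exact: stdq_level_e1.
rewrite -HE; congr connected_component; apply: colP2.
by rewrite mulmx_coords coords_vec !mxE /= !mulr1 !mulr0 !addr0.
Qed.

Lemma msubst_flip (R : realType) (L K : R) :
  msubst (stdq L K) (mx2 1 0 0 (-1)) = stdq (- L) K.
Proof. rewrite msubst_mx2; apply: quartic_eq; rewrite /= /polar /=; ring. Qed.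

Lemma unitmx_flip (R : realType) : mx2 1 0 0 (-1) \in @unitmx R 2.
Proof. by rewrite unitmx2 det_mx2 mul1r mulr0 subr0 oppr_eq0 oner_eq0. Qed.

Lemma std_curve_flip (R : realType) (L K : R) :
  std_curve L K = [set mx2 1 0 0 (-1) *m p | p in std_curve (- L) K].
Proof.
rewrite !std_curveE -msubst_flip connected_component_msubst ?unitmx_flip//.
  congr connected_component; apply: colP2.
  by rewrite mulmx_coords coords_vec !mxE /= !mulr1 !mulr0 !addr0.
by rewrite msubst_flip; exact: stdq_level_e1.
Qed.

Lemma stdq_curve_pt (R : realType) (L K t0 t1 : R) : t0 < 0 -> 0 < t1 ->
  (forall t, t0 < t < t1 -> 0 < qf (stdq L K) 1 t /\ qh (stdq L K) 1 t < 0) ->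
  forall t, t0 < t < t1 -> std_curve L K (pt (stdq L K) t).
Proof.
move=> t00 t10 fh; rewrite std_curveE.
apply: (@arc_sub_component R (stdq L K) [set t | t0 < t < t1] _ 0).
- by move=> x y /= /andP[? ?] /andP[? ?] z /andP[? ?]; apply/andP; split; lra.
- by [].
- by exists (vec 1 0) => //; exact: stdq_level_e1.
- by rewrite /= t00.
- have -> : pt (stdq L K) 0 = vec 1 0.
    apply: colP2; rewrite coords_pt coords_vec mulr0 mulr1 /rad.
    by rewrite (_ : qf (stdq L K) 1 0 = 1) ?sqrtr1 ?invr1// /qf /=; ring.
  exact/connected_component_refl/stdq_level_e1.
Qed.

Lemma stdq_good_end (R : realType) (L K t0 t1 : R) : t0 < 0 -> 0 < t1 ->
  (forall t, t0 < t < t1 -> 0 < qf (stdq L K) 1 t /\ qh (stdq L K) 1 t < 0) ->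
  0 < qf (stdq L K) 1 t1 -> qh (stdq L K) 1 t1 = 0 ->
  good_end (stdq L K) (std_curve L K).
Proof.
move=> t00 t10 fh f1 h1; apply: (@good_end_left_limit _ _ _ t1 t1) => // t.
rewrite subrr => /andP[t0' tt1]; have tt : t0 < t < t1 by rewrite (lt_trans t00).
by split; [have [] := fh t tt | exact: stdq_curve_pt tt].
Qed.

Lemma incomplete_good_end (R : realType) (a : quartic R) (H : set 'cV[R]_2) :
  components (mform a) H -> incomplete (mform a) H -> good_end a H.
Proof.
move=> cH incH; have [A [L [K [Au AE HE]]]] := standard_form cH.
rewrite HE; apply: good_end_msubst => //; rewrite AE.
have [t0 [t1 [t00 t10 fh [f0 h0 e0] [f1 h1 e1]]]] := stdq_arc L K.
have [f1p|f1z] := ltP 0 (qf (stdq L K) 1 t1).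
  by apply: (stdq_good_end t00 t10 fh f1p); case: e1 => // e; rewrite e ltxx in f1p.
(* The reflection [y -> - y] turns the left end into a right end of [stdq (- L) K]. *)
have [f0p|f0z] := ltP 0 (qf (stdq L K) 1 t0).
  have opp t : qf (stdq (- L) K) 1 t = qf (stdq L K) 1 (- t) by rewrite qf_stdq_opp.
  have opph t : qh (stdq (- L) K) 1 t = qh (stdq L K) 1 (- t) by rewrite qh_stdq_opp.
  rewrite std_curve_flip; apply: good_end_msubst; first exact: unitmx_flip.
  rewrite msubst_flip.
  apply: (@stdq_good_end _ _ _ (- t1) (- t0)); rewrite ?oppr_lt0 ?oppr_gt0//.
  - move=> t tt; rewrite opp opph; apply: fh; lra.
  - by rewrite opp opprK.
  - by rewrite opph opprK; case: e0 => // e; rewrite e ltxx in f0p.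
exfalso; apply: incH; rewrite HE; apply: geodesically_complete_msubst => //.
rewrite AE std_curveE; apply: (@stdq_complete _ _ _ t0 t1) => //.
- by apply/eqP; rewrite eq_le f0z f0.
- by apply/eqP; rewrite eq_le f1z f1.
Qed.

(** * Invariants of the listed curves *)

Lemma qI_stdq (R : realType) (L K : R) : qI (stdq L K) = K + 12^-1.
Proof. by rewrite /qI /=; field. Qed.

Lemma qJ_stdq (R : realType) (L K : R) :
  qJ (stdq L K) = - (K / 6) + 216^-1 - L ^+ 2 / 16.
Proof. by rewrite /qJ /=; field. Qed.

Lemma qJ_stdq1 (R : realType) (K : R) : qJ (stdq 1 K) = - (K + 25 / 72) / 6.
Proof. by rewrite qJ_stdq; field. Qed.

Lemma qJ_stdq0 (R : realType) (K : R) : qJ (stdq 0 K) = - (K - 36^-1) / 6.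
Proof. by rewrite qJ_stdq; field. Qed.

Lemma is_derive_cont (R : realType) (f : R -> R) :
  (forall r : R, exists d : R, is_derive r 1 f d) -> continuous f.
Proof. by move=> fd r; have [d dr] := fd r; exact: is_derive_continuous dr. Qed.

(** The sign changes between 0 and the Cauchy bound [N], where the leading term outweighs the
    others. *)
Lemma cubic_pos_root (R : realType) (c3 c2 c1 c0 : R) : 0 < c3 -> c0 < 0 ->
  exists2 n, 0 < n & c3 * n ^+ 3 + c2 * n ^+ 2 + c1 * n + c0 = 0.
Proof.
move=> c30 c00; pose f n := c3 * n ^+ 3 + c2 * n ^+ 2 + c1 * n + c0.
have fc : continuous f by apply: is_derive_cont => r; eexists.
pose S := `|c2| + `|c1| + `|c0|; pose N := 1 + S / c3.
have S0 : 0 <= S by rewrite !addr_ge0.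
have N1 : 1 <= N by rewrite lerDl divr_ge0// ltW.
have NE : c3 * N = c3 + S by rewrite /N mulrDr mulr1 [c3 * (_ / _)]mulrC divfK// gt_eqF.
have fN : 0 <= f N.
  have h2 : - `|c2| <= c2 by rewrite lerNl -normrN ler_norm.
  have h1 : - `|c1| <= c1 by rewrite lerNl -normrN ler_norm.
  have h0 : - `|c0| <= c0 by rewrite lerNl -normrN ler_norm.
  have N2 : 0 <= N ^+ 2 by exact: sqr_ge0.
  have N12 : 1 <= N ^+ 2 by rewrite exprn_ege1.
  have NN2 : N <= N ^+ 2 by rewrite expr2 ler_peMl// (le_trans ler01).
  have -> : f N = (c3 + S + c2) * N ^+ 2 + c1 * N + c0 by rewrite /f -NE; ring.
  have m2 : - `|c2| * N ^+ 2 <= c2 * N ^+ 2 by exact: ler_wpM2r.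
  have m1 : - `|c1| * N ^+ 2 <= c1 * N.
    have k1 : - `|c1| * N ^+ 2 <= - `|c1| * N.
      by rewrite !mulNr lerN2 ler_wpM2l.
    by apply: (le_trans k1); rewrite ler_wpM2r// (le_trans ler01).
  have m0 : - `|c0| * N ^+ 2 <= c0.
    have k0 : - `|c0| * N ^+ 2 <= - `|c0|.
      by rewrite mulNr lerN2 ler_peMr.
    exact: le_trans h0.
  have m3 : 0 <= c3 * N ^+ 2 by rewrite mulr_ge0// ltW.
  by rewrite /S; lra.
have f0 : f 0 < 0 by rewrite /f !expr0n /= !mulr0 !add0r.
have N0 : 0 <= N by exact: le_trans N1.
have [||n] := @IVT R f 0 N 0 N0.
- exact: continuous_subspaceT.
- by rewrite ge_min le_max fN (ltW f0) orbT.
rewrite in_itv /= => /andP[n0 _] fn; exists n => //.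
by rewrite lt_neqAle n0 andbT; apply: contraTneq f0 => n0'; rewrite [X in f X]n0' fn ltxx.
Qed.

(* Cardano: 24 K - 4 is a root of this cubic iff x^4 - x^2 y^2 + x y^3 + K y^4 has discriminant 0. *)
Lemma U_cubic (R : realType) : let V := 24 * (U : R) - 4 in
  [/\ V ^+ 3 = 336 * V + 2522, 0 < V & 448 < V ^+ 2].
Proof.
pose s : R := Num.sqrt 57.
have s2 : s ^+ 2 = 57 by rewrite sqr_sqrtr.
have s0 : 0 <= s by rewrite sqrtr_ge0.
have b0 : 0 < 46 + 6 * s by lra.
pose A := (46 + 6 * s) `^ (- (1 / 3)).
have A0 : 0 < A by exact: powR_gt0.
(* [(46 + 6 s) (46 - 6 s) = 64]. *)
have A3 : A ^+ 3 = (46 - 6 * s) / 64.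
  rewrite -powR_mulrn ?(ltW A0)// /A -powRrM.
  rewrite (_ : - (1 / 3) * 3%:R = - 1); last by field.
  rewrite powR_inv1 ?(ltW b0)//; apply: (mulfI (lt0r_neq0 b0)).
  by rewrite divff ?gt_eqF//; field: s2.
have B : (46 + 6 * s) `^ (- (2 / 3)) = A ^+ 2.
  by rewrite -powR_mulrn ?(ltW A0)// /A -powRrM; congr powR; field.
move=> V.
have VE : V = (31 + 3 * s) * A + (100 + 12 * s) * A ^+ 2.
  by rewrite /V /U -/s -/A B; field.
have V0 : 0 < V.
  by rewrite VE; have := mulr_gt0 A0 A0; nra.
have V3 : V ^+ 3 = 336 * V + 2522.
  have e1 : V ^+ 3 = (31 + 3 * s) ^+ 3 * A ^+ 3 + (100 + 12 * s) ^+ 3 * (A ^+ 3) ^+ 2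
       + 3 * (31 + 3 * s) * (100 + 12 * s) * A ^+ 3 * V by rewrite VE; ring.
  by rewrite e1 A3; field: s2.
(* [V^2 <= 448] would give [2522 = V (V^2 - 336) <= 112 V], hence [V > 22] and [V^2 > 448]. The
   value 448 is where [W^2 + W V + V^2 - 336] has discriminant 0 in [W]. *)
by split=> //; rewrite ltNge; apply/negP => V2; nra.
Qed.

(** Up to the factor [24^3] the discriminant is a monic cubic in [W = 24 K - 4] with root
    [V = 24 U - 4]; the cofactor of [W - V] is positive because [V^2 > 448]. *)
Lemma U_disc (R : realType) (K : R) : - (25 / 72) < K ->
  [/\ (K < U) = (qI (stdq 1 K) ^+ 3 < 27 * qJ (stdq 1 K) ^+ 2) &
      (K == U) = (qI (stdq 1 K) ^+ 3 == 27 * qJ (stdq 1 K) ^+ 2)].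
Proof.
move=> K0; have [V3 V0 V2] := U_cubic R.
set V := 24 * U - 4 in V3 V0 V2.
pose W := 24 * K - 4; have W0 : - 37 / 3 < W by rewrite /W; lra.
have e : (qI (stdq 1 K) ^+ 3 - 27 * qJ (stdq 1 K) ^+ 2) * 13824 =
    (W - V) * (W ^+ 2 + W * V + V ^+ 2 - 336).
  rewrite qI_stdq qJ_stdq1 /W.
  have -> : (24 * K - 4 - V) * ((24 * K - 4) ^+ 2 + (24 * K - 4) * V + V ^+ 2 - 336) =
    (24 * K - 4) ^+ 3 - 336 * (24 * K - 4) - (V ^+ 3 - 336 * V) by ring.
  by rewrite V3; field.
have Q0 : 0 < W ^+ 2 + W * V + V ^+ 2 - 336.
  have -> : W ^+ 2 + W * V + V ^+ 2 - 336 = (W + V / 2) ^+ 2 + 3 / 4 * (V ^+ 2 - 448) by field.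
  apply: ltr_wpDl; first exact: sqr_ge0.
  by apply: mulr_gt0; [rewrite divr_gt0 | rewrite subr_gt0].
have KU : K - U = (W - V) / 24 by rewrite /W /V; field.
set d := qI _ ^+ 3 in e *; set d' := 27 * _ in e *.
have c0 : 0 < 13824 :> R by rewrite ltr0n.
split.
  rewrite -subr_lt0 -[RHS]subr_lt0 KU pmulr_llt0 ?invr_gt0//.
  by rewrite -(pmulr_llt0 (d - d') c0) e pmulr_llt0.
rewrite -subr_eq0 -[RHS]subr_eq0 KU mulf_eq0 invr_eq0 pnatr_eq0 orbF.
rewrite -(mulIr_eq0 (d - d') (mulIf (lt0r_neq0 c0))) e mulf_eq0.
by rewrite (gt_eqF Q0) orbF.
Qed.

(** Equality of the ratios [I^3 : J^2], cross-multiplied so as to admit [J = 0]. The second clause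
    does not follow from the first, which is void when [I] and [J] of one form both vanish. *)
Definition same_invariants (R : realType) (a b : quartic R) : Prop :=
  qJ a ^+ 2 * qI b ^+ 3 = qJ b ^+ 2 * qI a ^+ 3 /\ (qJ a == 0) = (qJ b == 0).

Lemma listed_exists (R : realType) (a : quartic R) : qJ a <= 0 ->
  exists L K, listed L K /\ same_invariants a (stdq L K).
Proof.
move=> J0; have [J_eq0|J_neq0] := eqVneq (qJ a) 0.
  have Jc : qJ (stdq 1 (- (25 / 72))) = 0 :> R by rewrite qJ_stdq1; field.
  exists 1, (- (25 / 72)); split; first by apply: Or43.
  by split; rewrite J_eq0 Jc ?eqxx// !expr0n !mul0r.
have Jneg : qJ a < 0 by rewrite lt_neqAle J_neq0.
have J2 : 0 < qJ a ^+ 2 by rewrite exprn_even_gt0.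
set I := qI a; set J := qJ a in J0 J_neq0 Jneg J2.
have [disc|disc|disc] := ltgtP (I ^+ 3) (27 * J ^+ 2).
(* At [- 25/72] the invariant [J] of the listed curve vanishes while its [I] is [- 19/72], and at
   [U] its discriminant vanishes; with [I^3 < 27 J^2] this gives [g] opposite signs at the two
   ends. *)
- pose g K : R := (K + 12^-1) ^+ 3 * J ^+ 2 - I ^+ 3 * ((K + 25 / 72) / 6) ^+ 2.
  have gc : continuous g by apply: is_derive_cont => r; eexists.
  have U0 : - (25 / 72) < (U : R).
    by have [_ V0 _] := U_cubic R; lra.
  have [_ /esym] := U_disc U0; rewrite eqxx qI_stdq qJ_stdq1 => /eqP UE.
  have gl : g (- (25 / 72)) < 0.
    have -> : g (- (25 / 72)) = - ((19 / 72) ^+ 3 * J ^+ 2) by rewrite /g; field.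
    by rewrite oppr_lt0 mulr_gt0// exprn_gt0//; lra.
  have gr : 0 < g U.
    have -> : g U = ((U + 25 / 72) / 6) ^+ 2 * (27 * J ^+ 2 - I ^+ 3).
      by rewrite /g UE; field.
    by rewrite mulr_gt0 ?subr_gt0// exprn_gt0//; lra.
  have [||K] := @IVT R g (- (25 / 72)) U 0 (ltW U0).
  + exact: continuous_subspaceT.
  + by rewrite ge_min le_max (ltW gl) (ltW gr) orbT.
  rewrite in_itv /= => /andP[lK KU] gK.
  have lK' : - (25 / 72) < K.
    by rewrite lt_neqAle lK andbT; apply: contraTneq gl => ->; rewrite gK ltxx.
  have KU' : K < U.
    by rewrite lt_neqAle KU andbT; apply: contraTneq gr => <-; rewrite gK ltxx.
  exists 1, K; split; first by apply: Or42; rewrite lK' KU'.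
  split; rewrite qJ_stdq1 ?qI_stdq.
    by move: gK; rewrite /g -/I -/J; lra.
  by rewrite (negPf J_neq0) mulNr oppr_eq0 mulf_eq0 invr_eq0 pnatr_eq0 orbF gt_eqF//; lra.
(* [K = 1/4 + n] turns the equation into a cubic in [n], whose constant term is negative by the case
   assumption. *)
- have c00 : J ^+ 2 / 27 - I ^+ 3 / 729 < 0 by lra.
  have [n n0 nE] := cubic_pos_root (J ^+ 2 - I ^+ 3 / 36)
      (J ^+ 2 / 3 - I ^+ 3 / 81) J2 c00.
  exists 0, (1 / 4 + n); split; first by apply: Or41; rewrite ltrDl.
  split; rewrite qJ_stdq0 ?qI_stdq.
    by rewrite -/I -/J; lra.
  by rewrite (negPf J_neq0) mulNr oppr_eq0 mulf_eq0 invr_eq0 pnatr_eq0 orbF gt_eqF//; lra.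
- have U0 : - (25 / 72) < (U : R).
    by have [_ V0 _] := U_cubic R; lra.
  have [_ /esym] := U_disc U0; rewrite eqxx => /eqP UE.
  exists 1, U; split; first by apply: Or44.
  split; first by rewrite UE -/I -/J disc; ring.
  rewrite (negPf J_neq0) qJ_stdq1.
  by rewrite mulNr oppr_eq0 mulf_eq0 invr_eq0 pnatr_eq0 orbF gt_eqF//; lra.
Qed.

Lemma listed_disc (R : realType) (L K : R) : listed L K ->
  [\/ [/\ L = 0, 1 / 4 < K, qJ (stdq L K) < 0 & 27 * qJ (stdq L K) ^+ 2 < qI (stdq L K) ^+ 3],
      [/\ L = 1, - (25 / 72) < K < U, qJ (stdq L K) < 0 & qI (stdq L K) ^+ 3 < 27 * qJ (stdq L K) ^+ 2],
      [/\ L = 1, K = - (25 / 72), qJ (stdq L K) = 0 & qI (stdq L K) < 0] |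
      [/\ L = 1, K = U, qJ (stdq L K) < 0 & qI (stdq L K) ^+ 3 = 27 * qJ (stdq L K) ^+ 2]].
Proof.
have U0 : - (25 / 72) < (U : R) by have [_ V0 _] := U_cubic R; lra.
case=> [[-> K0]|[-> /andP[K0 K1]]|[-> ->]|[-> ->]].
- apply: Or41; split=> //; first by rewrite qJ_stdq0; lra.
  rewrite qI_stdq qJ_stdq0 -subr_gt0.
  have -> : (K + 12^-1) ^+ 3 - 27 * (- (K - 36^-1) / 6) ^+ 2 = K * (K - 1 / 4) ^+ 2 by field.
  by rewrite mulr_gt0 ?exprn_gt0 ?subr_gt0//; lra.
- apply: Or42; split=> //; first by rewrite K0.
    by rewrite qJ_stdq1; lra.
  by have [<-] := U_disc K0.
- by apply: Or43; split=> //; [rewrite qJ_stdq1; field | rewrite qI_stdq; lra].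
- apply: Or44; split=> //; first by rewrite qJ_stdq1; lra.
  by have [_ /esym] := U_disc U0; rewrite eqxx => /eqP.
Qed.

(** Vanishing of [J] and the sign of the discriminant separate the four families. Inside a) and b)
    the difference of the two sides factors as [x - y] times a cofactor, [x] and [y] being [K] and
    [K'] shifted so as to be proportional to [J]; the cofactor has to be shown nonzero when [x] and
    [y] differ. *)
Lemma listed_unique (R : realType) (L K L' K' : R) :
  listed L K -> listed L' K' -> same_invariants (stdq L K) (stdq L' K') ->
  (L, K) = (L', K').
Proof.
move=> /listed_disc l /listed_disc l' [IJ J0].
set a := stdq L K in l IJ J0; set a' := stdq L' K' in l' IJ J0.
have disc : qJ a' ^+ 2 * (qI a ^+ 3 - 27 * qJ a ^+ 2) =
            qJ a ^+ 2 * (qI a' ^+ 3 - 27 * qJ a' ^+ 2).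
  by rewrite !mulrBr -IJ; ring.
have [aJ|aJ] := eqVneq (qJ a) 0.
  have a'J : qJ a' = 0 by apply/eqP; rewrite -J0 aJ.
  case: l => [[_ _]|[_ _]|[-> -> _ _]|[_ _]]; rewrite ?aJ ?ltxx//.
  by case: l' => [[_ _]|[_ _]|[-> -> _ _]|[_ _]]; rewrite ?a'J ?ltxx.
have a'J : qJ a' != 0 by rewrite -J0.
have p : 0 < qJ a ^+ 2 by rewrite exprn_even_gt0.
have p' : 0 < qJ a' ^+ 2 by rewrite exprn_even_gt0.
have sg : (0 < qI a ^+ 3 - 27 * qJ a ^+ 2) = (0 < qI a' ^+ 3 - 27 * qJ a' ^+ 2).
  by rewrite -(pmulr_rgt0 _ p') disc pmulr_rgt0.
have sl : (qI a ^+ 3 - 27 * qJ a ^+ 2 < 0) = (qI a' ^+ 3 - 27 * qJ a' ^+ 2 < 0).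
  by rewrite -(pmulr_rlt0 _ p') disc pmulr_rlt0.
rewrite !subr_gt0 in sg; rewrite !subr_lt0 in sl.
case: l => [[L0 K0 _ d]|[L1 K1 _ d]|[_ _ e]|[L1 K1 _ d]]; last 2 first.
- by rewrite e eqxx in aJ.
- rewrite d ltxx in sg sl.
  case: l' => [[_ _ _ d']|[_ _ _ d']|[_ _ e']|[-> -> _ d']].
  + by rewrite d' in sg.
  + by rewrite d' in sl.
  + by rewrite e' eqxx in a'J.
  + by rewrite L1 K1.
- rewrite d in sg; rewrite (lt_gtF d) in sl.
  case: l' => [[L0' K0' _ _]|[_ _ _ d']|[_ _ e']|[_ _ _ d']]; last 3 first.
  + by rewrite d' in sl.
  + by rewrite e' eqxx in a'J.
  + by rewrite d' ltxx in sg.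
  rewrite L0 L0'; congr (_, _); move: IJ; rewrite /a /a' L0 L0' !qI_stdq !qJ_stdq0.
  set x := K - 36^-1; set y := K' - 36^-1 => IJ.
  have x0 : 2 / 9 < x by rewrite /x; lra.
  have y0 : 2 / 9 < y by rewrite /y; lra.
  have e : (x - y) * (x ^+ 2 * y ^+ 2 - 3 * (1 / 9) ^+ 2 * (x * y)
      - (1 / 9) ^+ 3 * (x + y)) = 36 * ((- y / 6) ^+ 2 * (K + 12^-1) ^+ 3 -
        (- x / 6) ^+ 2 * (K' + 12^-1) ^+ 3).
    by rewrite /x /y; field.
  move: e; rewrite IJ subrr mulr0 => /eqP; rewrite mulf_eq0 subr_eq0 => /orP[/eqP xy|/eqP br].
    by move: xy; rewrite /x /y; lra.
  (* [x, y > 2/9] give [x y > 4/81] and [x + y <= 9 x y], so the cofactor is at least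
     [x y (x y - 4/81) > 0]. *)
  have xy : 4 / 81 < x * y by nra.
  have hx : x * (2 / 9) <= x * y by nra.
  have hy : y * (2 / 9) <= x * y by nra.
  by exfalso; nra.
rewrite d in sl; rewrite (lt_gtF d) in sg.
case: l' => [[_ _ _ d']|[L1' K1' _ _]|[_ _ e']|[_ _ _ d']].
- by rewrite d' in sg.
- rewrite L1 L1'; congr (_, _); move: IJ; rewrite /a /a' L1 L1' !qI_stdq !qJ_stdq1.
  set x := K + 25 / 72; set y := K' + 25 / 72 => IJ.
  have x0 : 0 < x by rewrite /x; lra.
  have y0 : 0 < y by rewrite /y; lra.
  pose c : R := 19 / 72; have c0 : 0 < c by rewrite /c; lra.
  have e : (x - y) * (x ^+ 2 * y ^+ 2 - 3 * c ^+ 2 * (x * y)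
      + c ^+ 3 * (x + y)) = 36 * ((- y / 6) ^+ 2 * (K + 12^-1) ^+ 3 -
        (- x / 6) ^+ 2 * (K' + 12^-1) ^+ 3).
    by rewrite /x /y /c; field.
  move: e; rewrite IJ subrr mulr0 => /eqP; rewrite mulf_eq0 subr_eq0 => /orP[/eqP xy|/eqP br].
    by move: xy; rewrite /x /y; lra.
  have [xy|xy] := eqVneq x y; first by move: xy; rewrite /x /y; lra.
  (* A zero of the cofactor means [c^3 (x + y) = u (3 c^2 - u)], whence [u < 3 c^2]. Squaring and
     using [4 u < (x + y)^2] gives [(u - c^2)^2 (u - 4 c^2) > 0], a contradiction. *)
  exfalso; pose u := x * y; have u0 : 0 < u by rewrite mulr_gt0.
  have c30 : 0 < c ^+ 3 by rewrite exprn_gt0.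
  have br' : c ^+ 3 * (x + y) = u * (3 * c ^+ 2 - u) by move: br; rewrite /u; lra.
  have cu : 0 < 3 * c ^+ 2 - u.
    by rewrite -(pmulr_rgt0 _ u0) -br' mulr_gt0// addr_gt0.
  have s4 : 4 * u < (x + y) ^+ 2.
    have : 0 < (x - y) ^+ 2 by rewrite exprn_even_gt0//= subr_eq0.
    by rewrite /u; lra.
  have : (c ^+ 3) ^+ 2 * (4 * u) < (u * (3 * c ^+ 2 - u)) ^+ 2.
    by rewrite -br' [ltRHS]exprMn ltr_pM2l// exprn_gt0.
  have -> : (u * (3 * c ^+ 2 - u)) ^+ 2 =
     (c ^+ 3) ^+ 2 * (4 * u) + u * ((u - c ^+ 2) ^+ 2 * (u - 4 * c ^+ 2)) by ring.
  rewrite ltrDl pmulr_rgt0//; apply/negP; rewrite -leNgt.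
  by rewrite mulr_ge0_le0 ?sqr_ge0//; have := sqr_ge0 c; lra.
- by rewrite e' eqxx in a'J.
- by rewrite d' ltxx in sl.
Qed.

(** * The classification *)

Lemma quartic_eq_on_interval (R : realType) (a b : quartic R) (d : R) : 0 < d ->
  (forall t, - d < t < d -> qf a 1 t = qf b 1 t) -> a = b.
Proof.
move=> d0 ab; pose h := d / 3; have h0 : h != 0 by rewrite gt_eqF// divr_gt0.
have e0 : qf a 1 0 = qf b 1 0 by apply: ab; lra.
have e1 : qf a 1 h = qf b 1 h by apply: ab; rewrite /h; lra.
have e2 : qf a 1 (- h) = qf b 1 (- h) by apply: ab; rewrite /h; lra.
have e3 : qf a 1 (2 * h) = qf b 1 (2 * h) by apply: ab; rewrite /h; lra.
have e4 : qf a 1 (- (2 * h)) = qf b 1 (- (2 * h)) by apply: ab; rewrite /h; lra.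
have {}e0 : q0 a = q0 b by move: e0; rewrite /qf; lra.
rewrite /qf e0 in e1 e2 e3 e4.
apply: quartic_eq => //.
- by apply: (mulIf h0); lra.
- by apply: (mulIf (expf_neq0 2 h0)); lra.
- by apply: (mulIf (expf_neq0 3 h0)); lra.
- by apply: (mulIf (expf_neq0 4 h0)); lra.
Qed.

Lemma automorphismsE (R : realType) (a : quartic R) (A : 'M[R]_2) :
  automorphisms (mform a) A <-> A \in unitmx /\ msubst a A = a.
Proof.
split=> [[Au h]|[Au h]]; split=> //.
  apply: (@quartic_eq_on_interval R _ _ 1) => // t _.
  have := h (vec 1 t); rewrite !ev_mform -qf_msubst.
  by rewrite coords_vec.
by move=> p; rewrite !ev_mform -qf_msubst h.
Qed.

Lemma equivalent_sym (R : realType) (H1 H2 : set 'cV[R]_2) :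
  equivalent H1 H2 -> equivalent H2 H1.
Proof.
move=> [A Au <-]; exists (invmx A); first by rewrite unitmx_inv.
by rewrite image_mulmx_id// mulVmx.
Qed.

Lemma equivalent_trans (R : realType) (H1 H2 H3 : set 'cV[R]_2) :
  equivalent H1 H2 -> equivalent H2 H3 -> equivalent H1 H3.
Proof.
move=> [A Au <-] [B Bu <-]; exists (B *m A); first by rewrite unitmx_mul Bu.
by rewrite image_comp; apply: eq_imagel => p _ /=; rewrite mulmxA.
Qed.

Lemma same_invariants_msubst (R : realType) (a : quartic R) (A : 'M[R]_2) :
  A \in unitmx -> same_invariants (msubst a A) a.
Proof.
rewrite unitmx2 => A0; rewrite /same_invariants /msubst qI_subst qJ_subst -det2.
split; first by ring.
by rewrite mulf_eq0 expf_eq0 /= (negPf A0).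
Qed.

Lemma same_invariants_sym (R : realType) (a b : quartic R) :
  same_invariants a b -> same_invariants b a.
Proof. by case=> h1 h2; split. Qed.

(** On the first curve both its own form and the pullback of the second are 1; by homogeneity they
    agree on an interval of slopes, hence are equal, and a pullback keeps the ratio of the
    invariants. *)
Lemma std_curve_equivalent (R : realType) (L K L' K' : R) :
  equivalent (std_curve L K) (std_curve L' K') ->
  same_invariants (stdq L K) (stdq L' K').
Proof.
move=> [A Au AE].
have [t0 [t1 [t00 t10 fh _ _]]] := stdq_arc L K.
suff <- : msubst (stdq L' K') A = stdq L K by exact: same_invariants_msubst.
pose d := Num.min (- t0) t1.
have d0 : 0 < d by rewrite lt_min oppr_gt0 t00.
have [d1 d2] : d <= - t0 /\ d <= t1 by rewrite !ge_min !lexx orbT.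
apply: (quartic_eq_on_interval d0) => t td.
have tt : t0 < t < t1 by lra.
have [ft _] := fh t tt.
have : std_curve L' K' (A *m pt (stdq L K) t).
  by rewrite -AE; exists (pt (stdq L K) t) => //; exact: stdq_curve_pt tt.
rewrite std_curveE => /connected_component_sub /hyperbolic_levelE[].
rewrite -qf_msubst coords_pt qf_scale rad4// => e _.
by apply: (mulfI (invr_neq0 (lt0r_neq0 ft))); rewrite e mulVf// gt_eqF.
Qed.

(** The exit slope is at most [T] and [qf] is positive there, so it is the Hessian that vanishes.
    This detects a flat end without locating it. *)
Lemma stdq_good_end_of (R : realType) (L K T : R) : 0 < T ->
  (forall t, 0 <= t <= T -> 0 < qf (stdq L K) 1 t) -> 0 <= qh (stdq L K) 1 T ->
  good_end (stdq L K) (std_curve L K).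
Proof.
move=> T0 fT hT; have [t0 [t1 [t00 t10 fh _ [_ h1 e1]]]] := stdq_arc L K.
have t1T : t1 <= T.
  rewrite leNgt; apply/negP => Tt1; have [|_] := fh T; first by lra.
  by rewrite ltNge hT.
have f1 : 0 < qf (stdq L K) 1 t1 by apply: fT; lra.
by apply: (stdq_good_end t00 t10 fh f1); case: e1 => // e; rewrite e ltxx in f1.
Qed.

Lemma listed_good_end (R : realType) (L K : R) : listed L K ->
  good_end (stdq L K) (std_curve L K).
Proof.
have case1 (K1 : R) : - (25 / 72) <= K1 -> good_end (stdq 1 K1) (std_curve 1 K1).
  (* For [K = - 25/72] the Hessian determinant is [- (T^2 - 9 T + 6)^2 / 216]; [T] is its smaller
     double root, and at this [T] the excess of [K] over [- 25/72] contributes a nonnegative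
     term. *)
  pose T : R := (9 - Num.sqrt 57) / 2.
  have s2 : (Num.sqrt 57 : R) ^+ 2 = 57 by rewrite sqr_sqrtr.
  have s0 : 0 <= (Num.sqrt 57 : R) by rewrite sqrtr_ge0.
  have s7 : 15 / 2 <= (Num.sqrt 57 : R) by nra.
  have s9 : (Num.sqrt 57 : R) < 9 by nra.
  have TE : T ^+ 2 = 9 * T - 6 by rewrite /T; field: s2.
  have T0 : 0 < T by rewrite /T; lra.
  have T1 : T <= 3 / 4 by rewrite /T; lra.
  move=> hK; apply: (@stdq_good_end_of _ _ _ T) => //.
    move=> t /andP[t0 tT]; have t1 := le_trans tT T1; rewrite /qf /=.
    have t2 : t ^+ 2 <= 9 / 16 by nra.
    have t2' : 0 <= t ^+ 2 by exact: sqr_ge0.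
    have t3 : 0 <= t ^+ 3 by exact: exprn_ge0.
    have t4 : 0 <= t ^+ 4 by exact: exprn_ge0.
    have t4' : t ^+ 4 <= 81 / 256 by rewrite (exprM _ 2 2); nra.
    have Kt : - (25 / 72) * t ^+ 4 <= K1 * t ^+ 4 by exact: ler_wpM2r.
    by lra.
  have -> : qh (stdq 1 K1) 1 T = (K1 + 25 / 72) * (T ^+ 2 * (1 - T ^+ 2 / 6))
      - (T ^+ 2 - (9 * T - 6)) ^+ 2 / 216 by rewrite /qh /=; field.
  have T2 : 0 <= T ^+ 2 * (1 - T ^+ 2 / 6).
    by rewrite mulr_ge0 ?sqr_ge0//; nra.
  by rewrite TE subrr expr0n mul0r subr0 -TE mulr_ge0//; lra.
case=> [[-> K0]|[-> /andP[K0 K1]]|[-> ->]|[-> ->]].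
- have Kp : 0 < K by lra.
  pose r := Num.sqrt K; have r2 : r ^+ 2 = K by rewrite sqr_sqrtr// ltW.
  have r0 : 0 < r by rewrite sqrtr_gt0.
  have r1 : 1 / 2 < r by nra.
  (* [T = K^(-1/4)] is the positive slope fixed by the automorphism [(x, y) -> (k y, x / k)] with
     [k^4 = K]. *)
  pose T := Num.sqrt r^-1; have T2 : T ^+ 2 = r^-1 by rewrite sqr_sqrtr// invr_ge0 ltW.
  apply: (@stdq_good_end_of _ _ _ T); first by rewrite sqrtr_gt0 invr_gt0.
    move=> t _; rewrite /qf /=.
    have : 0 <= (1 - t ^+ 2 / 2) ^+ 2 by exact: sqr_ge0.
    have : 0 <= (K - 1 / 4) * (t ^+ 2) ^+ 2 by rewrite mulr_ge0 ?sqr_ge0//; lra.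
    have [t0|t0] := eqVneq (t ^+ 2) 0; first by rewrite (exprM t 2 2) t0; lra.
    have : 0 < (K - 1 / 4) * (t ^+ 2) ^+ 2.
      by rewrite mulr_gt0 ?subr_gt0// exprn_even_gt0.
    by lra.
  have -> : qh (stdq 0 K) 1 T = (r - 1 / 2) * (r + 1 / 6) / r.
    have -> : qh (stdq 0 K) 1 T = - 6^-1 + (K - 12^-1) * T ^+ 2 - K / 6 * (T ^+ 2) ^+ 2.
      by rewrite /qh /=; field.
    by rewrite T2 -r2; field; rewrite gt_eqF.
  by rewrite divr_ge0 ?mulr_ge0 ?(ltW r0)//; lra.
- by apply: case1; lra.
- exact: case1.
- by apply: case1; have [_ V0 _] := U_cubic R; lra.
Qed.

Lemma good_end_qJ (R : realType) (a : quartic R) (H : set 'cV[R]_2) :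
  good_end a H -> qJ a <= 0.
Proof.
move=> [B [d [Bu _ [b0 b1 b2] _]]].
have [_ J1] := good_end_invariants H Bu b0 b1 b2.
have d6 : 0 < \det B ^+ 6 by rewrite exprn_even_gt0// -unitmx2.
by rewrite -(pmulr_rle0 _ d6) J1 oppr_le0 sqr_ge0.
Qed.

Lemma std_curve_maximal (R : realType) (L K : R) :
  maximal_quartic_gpsr (std_quartic L K) (std_curve L K).
Proof.
rewrite std_quarticE; split; last exact: components_std_curve.
  exact: mform_homog.
by exists (vec 1 0); have [] := stdq_level_e1 L K.
Qed.

Lemma classification (R : realType) (h : mpoly 2 R) (H : set 'cV[R]_2) :
  maximal_quartic_gpsr h H -> incomplete h H ->
  exists! LK : R * R,
    listed LK.1 LK.2 /\ equivalent H (std_curve LK.1 LK.2).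
Proof.
move=> [/homog_mform[a ->] _ cH] incH.
have gH := incomplete_good_end cH incH.
have [L [K [lLK inv]]] := listed_exists (good_end_qJ gH).
have [IJ J0] := inv.
have [A [Au AE HE]] := good_end_equiv cH (components_std_curve L K) gH
  (listed_good_end lLK) IJ J0.
have HLK : equivalent H (std_curve L K) by exists A.
exists (L, K); split=> // -[L' K'] /= [l' eq'].
apply: listed_unique => //; apply: std_curve_equivalent.
exact: equivalent_trans (equivalent_sym HLK) eq'.
Qed.

Lemma listed_incomplete (R : realType) (L K : R) : listed L K ->
  [/\ maximal_quartic_gpsr (std_quartic L K) (std_curve L K),
      incomplete (std_quartic L K) (std_curve L K) &
      in_standard_form (std_quartic L K) (std_curve L K)].
Proof.
move=> l; split; first exact: std_curve_maximal.
  rewrite std_quarticE; apply: good_end_incomplete; first exact: components_std_curve.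
  exact: listed_good_end.
split; last by exists L, K.
rewrite std_curveE; have -> : e1 R = vec 1 0.
  by apply: colP2; rewrite coords_vec /coords !mxE.
exact/connected_component_refl/stdq_level_e1.
Qed.

(** * Even normal forms *)

Definition even_quartic (R : realType) (m e : R) : quartic R := Quartic 1 0 m 0 e.

Lemma qf_even (R : realType) (m e x y : R) :
  qf (even_quartic m e) x y = x ^+ 4 + 6 * m * x ^+ 2 * y ^+ 2 + e * y ^+ 4.
Proof. by rewrite /qf /=; ring. Qed.

Lemma qh_even (R : realType) (m e x y : R) :
  qh (even_quartic m e) x y =
  m * x ^+ 4 + (e - 3 * m ^+ 2) * x ^+ 2 * y ^+ 2 + m * e * y ^+ 4.
Proof. by rewrite /qh /=; ring. Qed.

Lemma qI_even (R : realType) (m e : R) : qI (even_quartic m e) = e + 3 * m ^+ 2.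
Proof. by rewrite /qI /=; ring. Qed.

Lemma qJ_even (R : realType) (m e : R) : qJ (even_quartic m e) = m * e - m ^+ 3.
Proof. by rewrite /qJ /=; ring. Qed.

(* The four cases are a), b), c), d) of the classification, in this order. *)
Definition normal_params (R : realType) (m e : R) : Prop :=
  [\/ 1 < m /\ e = 1, 0 < m /\ e = -1, m = 0 /\ e = -1 | m = 1 /\ e = 0].

(** In families a) and b) the sign of the discriminant fixes [e], and equality of ratios becomes a
    cubic equation, in [m^2 - 1] for [e = 1] and in [m^2] for [e = -1], whose leading coefficient is
    the discriminant up to sign. *)
Lemma normal_params_exists (R : realType) (L K : R) : listed L K ->
  exists m e, [/\ normal_params m e, same_invariants (stdq L K) (even_quartic m e),
    L = 0 -> e = 1, L = 1 -> e <= 0 & L = 1 -> K = U -> m = 1 /\ e = 0].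
Proof.
move=> /listed_disc; set I := qI (stdq L K); set J := qJ (stdq L K).
have L01 : (1 : R) <> 0 by apply/eqP; exact: oner_neq0.
have sI m e : J != 0 -> m * e - m ^+ 3 != 0 ->
    J ^+ 2 * (e + 3 * m ^+ 2) ^+ 3 = (m * e - m ^+ 3) ^+ 2 * I ^+ 3 ->
    same_invariants (stdq L K) (even_quartic m e).
  move=> J0 J0' h; rewrite /same_invariants qI_even qJ_even -/I -/J; split=> //.
  by rewrite (negPf J0) (negPf J0').
case=> [[L0 K0 J0 D]|[L1 /andP[_ K1] J0 D]|[L1 K1 J0 I0]|[L1 K1 J0 D]].
- have c30 : 0 < I ^+ 3 - 27 * J ^+ 2 by rewrite subr_gt0.
  have J2 : 0 < J ^+ 2 by rewrite exprn_even_gt0//= lt_eqF.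
  have c00 : - (64 * J ^+ 2) < 0 by rewrite oppr_lt0 mulr_gt0.
  have [n n0 nE] := cubic_pos_root (I ^+ 3 - 108 * J ^+ 2) (- (144 * J ^+ 2)) c30 c00.
  pose m := Num.sqrt (1 + n); have m2 : m ^+ 2 = 1 + n by rewrite sqr_sqrtr//; lra.
  have m0 : 0 <= m by rewrite sqrtr_ge0.
  have m1 : 1 < m by nra.
  exists m, 1; split=> //; first exact: Or41; last first.
  + by move=> L1; rewrite L1 in L0; case: (L01 L0).
  + by move=> L1; rewrite L1 in L0; case: (L01 L0).
  apply: sI; first by rewrite lt_eqF.
    have -> : m * 1 - m ^+ 3 = - m * n by rewrite (exprS m 2) m2; ring.
    by rewrite mulf_neq0 ?oppr_eq0 ?gt_eqF//; lra.
  have -> : (m * 1 - m ^+ 3) ^+ 2 = m ^+ 2 * (1 - m ^+ 2) ^+ 2 by ring.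
  by rewrite m2; lra.
- have c30 : 0 < 27 * J ^+ 2 - I ^+ 3 by rewrite subr_gt0.
  have J2 : 0 < J ^+ 2 by rewrite exprn_even_gt0//= lt_eqF.
  have c00 : - J ^+ 2 < 0 by rewrite oppr_lt0.
  have [n n0 nE] := cubic_pos_root (- (27 * J ^+ 2) - 2 * I ^+ 3) (9 * J ^+ 2 - I ^+ 3) c30 c00.
  pose m := Num.sqrt n; have m2 : m ^+ 2 = n by rewrite sqr_sqrtr//; lra.
  have m0 : 0 < m by rewrite sqrtr_gt0.
  exists m, (-1); split.
  + exact: Or42.
  + apply: sI; first by rewrite lt_eqF.
      have -> : m * (-1) - m ^+ 3 = - m * (1 + n) by rewrite (exprS m 2) m2; ring.
      by rewrite mulf_neq0 ?oppr_eq0 ?gt_eqF//; lra.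
    have -> : (m * (-1) - m ^+ 3) ^+ 2 = m ^+ 2 * (1 + m ^+ 2) ^+ 2 by ring.
    by rewrite m2; lra.
  + by move=> L0; rewrite L0 in L1; case: L01.
  + by move=> _; lra.
  + by move=> _ KU; rewrite KU ltxx in K1.
- exists 0, (-1); split.
  + exact: Or43.
  + rewrite /same_invariants qI_even qJ_even -/I -/J J0.
    rewrite (_ : 0 * -1 - 0 ^+ 3 = 0 :> R); last by ring.
    by rewrite expr0n !mul0r.
  + by move=> L0; rewrite L0 in L1; case: L01.
  + by move=> _; lra.
  + by move=> _ KU; exfalso; have [_ V0 _] := U_cubic R; rewrite -KU K1 in V0; lra.
- exists 1, 0; split.
  + exact: Or44.
  + apply: sI; first by rewrite lt_eqF.
      by rewrite mulr0 expr1n sub0r oppr_eq0 oner_eq0.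
    by rewrite D; ring.
  + by move=> L0; rewrite L0 in L1; case: L01.
  + by [].
  + by [].
Qed.

Lemma normal_params_ge0 (R : realType) (m e : R) : normal_params m e -> 0 <= m.
Proof. by case=> [[m0 _]|[m0 _]|[-> _]|[-> _]]//; lra. Qed.

(** The fourth quadrant is chosen because there the arc approaches its flat end from smaller slopes,
    as [good_end_left_limit] requires. *)
Definition quadrant_arc (R : realType) (m e : R) : set 'cV[R]_2 :=
  hyperbolic_level (mform (even_quartic m e)) `&`
  [set p | 0 < (coords p).1 /\ (coords p).2 < 0].

(** On both axes [qh = m qf], which is nonnegative on the level 1. So the axes separate the level
    set into its quadrants. *)
Lemma even_level_axes (R : realType) (m e : R) (p : 'cV[R]_2) : 0 <= m ->
  hyperbolic_level (mform (even_quartic m e)) p ->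
  (coords p).1 != 0 /\ (coords p).2 != 0.
Proof.
move=> m0 /hyperbolic_levelE; case: (coords p) => x y /= [f1 h0].
split; apply/eqP => z; rewrite z qf_even in f1; rewrite z qh_even in h0.
  rewrite !expr0n /= !(mulr0, mul0r, add0r) in f1 h0.
  by move: h0; rewrite -mulrA f1 mulr1 ltNge m0.
rewrite !expr0n /= !(mulr0, addr0) in h0.
by move: h0; rewrite ltNge mulr_ge0// exprn_even_ge0.
Qed.

(** With [even_Phi], the values of [qf] and [qh] at slope [t] in terms of [w = t^2]. *)
Definition even_P (R : realType) (m e w : R) : R := 1 + 6 * m * w + e * w ^+ 2.
Definition even_Phi (R : realType) (m e w : R) : R :=
  m + (e - 3 * m ^+ 2) * w + m * e * w ^+ 2.

Lemma qf_even1 (R : realType) (m e t : R) :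
  qf (even_quartic m e) 1 t = even_P m e (t ^+ 2).
Proof. by rewrite qf_even /even_P; ring. Qed.

Lemma qh_even1 (R : realType) (m e t : R) :
  qh (even_quartic m e) 1 t = even_Phi m e (t ^+ 2).
Proof. by rewrite qh_even /even_Phi; ring. Qed.

(** For [e <= 0] both [even_P / w] and [even_Phi / w] are nonincreasing in [w], so the first is
    positive by its value at the larger end and the second negative by its value at the smaller one.
    For [e = 1] the first is positive for every [w > 0] and the second is convex. *)
Lemma even_between (R : realType) (m e w' u w : R) : normal_params m e ->
  0 < w' -> w' <= u -> u <= w ->
  0 < even_P m e w -> even_Phi m e w' < 0 -> even_Phi m e w < 0 ->
  0 < even_P m e u /\ even_Phi m e u < 0.
Proof.
move=> np w0 wu uw Pw Fw' Fw; have u0 : 0 < u by exact: lt_le_trans wu.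
have w0' : 0 < w by exact: lt_le_trans uw.
have low : 0 <= m -> e <= 0 -> 0 < even_P m e u /\ even_Phi m e u < 0.
  move=> m0 e0; split.
    have h : w * even_P m e u = (w - u) * (1 - e * (w * u)) + u * even_P m e w.
      by rewrite /even_P; ring.
    rewrite -(pmulr_rgt0 _ w0') h ltr_wpDl// ?mulr_gt0// mulr_ge0 ?subr_ge0//.
    by rewrite (le_trans _ ler01)// mulr_le0_ge0// mulr_ge0 ?ltW.
  have h : w' * even_Phi m e u = u * even_Phi m e w' - (u - w') * (m - m * e * (w' * u)).
    by rewrite /even_Phi; ring.
  rewrite -(pmulr_rlt0 _ w0) h subr_lt0 (lt_le_trans (y := 0))//; first by rewrite pmulr_rlt0.
  rewrite mulr_ge0 ?subr_ge0// (le_trans _ m0)// mulr_le0_ge0 ?mulr_ge0_le0//.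
  by rewrite mulr_ge0 ?ltW.
case: np => [[m1 e1]|[m0 ->]|[-> ->]|[-> ->]] in low *; first split.
- rewrite /even_P e1; have : 0 < m * u by rewrite mulr_gt0//; lra.
  by have := sqr_ge0 u; lra.
- have [wn|wn] := eqVneq w' w.
    by have -> : u = w by apply/eqP; rewrite eq_le uw -wn.
  have wp : 0 < w - w' by rewrite subr_gt0 lt_neqAle wn (le_trans wu).
  have h : (w - w') * even_Phi m e u = (w - u) * even_Phi m e w' + (u - w') * even_Phi m e w
      - m * e * ((w - u) * (u - w') * (w - w')) by rewrite /even_Phi; ring.
  rewrite -(pmulr_rlt0 _ wp) h e1 mulr1.
  have h3 : 0 <= m * ((w - u) * (u - w') * (w - w')).
    by rewrite !mulr_ge0 ?subr_ge0 ?(ltW wp)//; [lra | exact: le_trans uw].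
  rewrite e1 in Fw Fw'.
  have [uw'|uw'] := eqVneq u w'.
    by rewrite uw' in h3 *; rewrite subrr mul0r addr0; nra.
  have : 0 < u - w' by rewrite subr_gt0 lt_neqAle eq_sym uw'.
  have du : 0 <= w - u by rewrite subr_ge0.
  have k1 : (w - u) * even_Phi m 1 w' <= 0 by rewrite mulr_ge0_le0// ltW.
  move=> du'; have k2 : (u - w') * even_Phi m 1 w < 0 by rewrite pmulr_rlt0.
  by lra.
- by apply: low; rewrite ?ltW ?oppr_le0//.
- by apply: low; rewrite ?oppr_le0.
- by apply: low; rewrite ?ler01.
Qed.

(** For [m > 0] and [e <= 0], [m even_P = (9 m^2 - e) w] is positive at a positive root [w] of
    [even_Phi], and monotonicity of [even_Phi / w] keeps [even_Phi] negative beyond it. For [e = 1]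
    the root lies between 0 and 1, where [even_Phi] takes the values [m] and [(1 - m) (1 + 3 m)],
    and convexity is used instead. *)
Lemma even_root (R : realType) (m e : R) : normal_params m e ->
  exists w1 w2, [/\ 0 <= w1, w1 < w2, even_Phi m e w1 = 0, 0 < even_P m e w1 &
    forall w, w1 < w < w2 -> even_Phi m e w < 0].
Proof.
have low w1 : 0 < m -> e <= 0 -> 0 < w1 -> even_Phi m e w1 = 0 ->
    exists w1 w2, [/\ 0 <= w1, w1 < w2, even_Phi m e w1 = 0, 0 < even_P m e w1 &
      forall w, w1 < w < w2 -> even_Phi m e w < 0].
  move=> m0 e0 w0 Fw; exists w1, (w1 + 1); split=> //.
  - exact: ltW.
  - by rewrite ltrDl.
  - have h : m * even_P m e w1 = even_Phi m e w1 + (9 * m ^+ 2 - e) * w1.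
      by rewrite /even_P /even_Phi; ring.
    rewrite -(pmulr_rgt0 _ m0) h Fw add0r mulr_gt0//.
    have m2 : 0 < m ^+ 2 by rewrite exprn_gt0.
    by lra.
  - move=> w /andP[ww _].
    have h : w1 * even_Phi m e w = w * even_Phi m e w1 - (w - w1) * (m - m * e * (w1 * w)).
      by rewrite /even_Phi; ring.
    rewrite -(pmulr_rlt0 _ w0) h Fw mulr0 sub0r oppr_lt0 mulr_gt0 ?subr_gt0//.
    apply: (le_lt_trans _ m0); apply: mulr_le0_ge0.
      by rewrite mulr_ge0_le0// ltW.
    by rewrite mulr_ge0 ?(ltW w0)// (ltW (lt_trans w0 ww)).
case=> [[m1 e1]|[m0 e1]|[m0 e1]|[m0 e1]].
- pose g w := even_Phi m e w.
  have gc : continuous g by apply: is_derive_cont => r; rewrite /g /even_Phi; eexists.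
  have g0 : 0 < g 0 by rewrite /g /even_Phi expr0n /= !mulr0 !addr0; lra.
  have g1 : g 1 < 0 by rewrite /g /even_Phi e1; nra.
  have [||w1] := @IVT R g 0 1 0 ler01.
  + exact: continuous_subspaceT.
  + by rewrite ge_min le_max (ltW g0) (ltW g1) orbT.
  rewrite in_itv /= => /andP[w0 w1l] gw.
  have w1lt : w1 < 1.
    by rewrite lt_neqAle w1l andbT; apply: contraTneq g1 => h; rewrite -[X in g X]h gw ltxx.
  exists w1, 1; split=> //.
    by rewrite /even_P e1; have := sqr_ge0 w1; nra.
  move=> w /andP[ww w1']; have wp : 0 < 1 - w1 by rewrite subr_gt0.
  have h : (1 - w1) * g w = (1 - w) * g w1 + (w - w1) * g 1
      - m * e * ((1 - w) * (w - w1) * (1 - w1)) by rewrite /g /even_Phi; ring.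
  rewrite -/(g w) -(pmulr_rlt0 _ wp) h gw e1 mulr0 add0r mulr1.
  have h1 : (w - w1) * g 1 < 0 by rewrite pmulr_rlt0// subr_gt0.
  have h2 : 0 < m * ((1 - w) * (w - w1) * (1 - w1)) by rewrite !mulr_gt0 ?subr_gt0//; lra.
  by lra.
(* The quadratic [- even_Phi] is multiplied by [n + 1], which has no positive zero, to match the
   cubic lemma. *)
- have c30 : 0 < - (m * e) by rewrite e1; lra.
  have c00 : - m < 0 by rewrite oppr_lt0.
  have [n n0 nE] := cubic_pos_root (- (m * e) + 3 * m ^+ 2 - e)
      (3 * m ^+ 2 - e - m) c30 c00.
  apply: (low n) => //; first by rewrite e1; lra.
  have n1 : n + 1 != 0 by rewrite gt_eqF//; lra.
  by apply: (mulfI n1); rewrite mulr0 /even_Phi; lra.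
- exists 0, 1; split=> //.
  + by rewrite /even_Phi m0; ring.
  + by rewrite /even_P m0 !(mul0r, mulr0, expr0n, addr0) ltr01.
  + by move=> w /andP[w0 _]; rewrite /even_Phi m0 e1; lra.
- apply: (low 3^-1); rewrite ?m0 ?e1//; rewrite /even_Phi.
  by field.
Qed.

Lemma quadrant_component (R : realType) (m e : R) (p : 'cV[R]_2) :
  normal_params m e -> quadrant_arc m e p ->
  connected_component (hyperbolic_level (mform (even_quartic m e))) p =
  quadrant_arc m e.
Proof.
move=> np [Sp Op].
pose O := [set p : 'cV[R]_2 | 0 < 1 * (coords p).1 + 0 * (coords p).2] `&`
   [set p | 0 < 0 * (coords p).1 + (- 1) * (coords p).2].
pose F := [set p : 'cV[R]_2 | 0 <= 1 * (coords p).1 + 0 * (coords p).2] `&`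
   [set p | 0 <= 0 * (coords p).1 + (- 1) * (coords p).2].
have OE q : O q <-> 0 < (coords q).1 /\ (coords q).2 < 0.
  by rewrite /O /setI /mkset /=; case: (coords q) => x y /=; split=> -[? ?]; split; lra.
have FE q : F q <-> 0 <= (coords q).1 /\ (coords q).2 <= 0.
  by rewrite /F /setI /mkset /=; case: (coords q) => x y /=; split=> -[? ?]; split; lra.
have -> : quadrant_arc m e = hyperbolic_level (mform (even_quartic m e)) `&` O.
  by apply/seteqP; split=> q [Sq Oq]; split=> //; apply/OE.
apply: (@cone_component _ _ O F) => //.
- by apply: openI; exact: halfplane_open.
- by apply: closedI; exact: halfplane_closed.
- by move=> q /OE[? ?]; apply/FE; split; apply/ltW.
- move=> q [Sq /FE[x0 y0]]; apply/OE.
  have [x1 y1] := even_level_axes (normal_params_ge0 np) Sq.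
  by split; [rewrite lt_neqAle eq_sym x1 | rewrite lt_neqAle y1].
- move=> q /OE[x0 y0]; split=> //; apply/OE; rewrite coords_vec; split=> //=.
  by rewrite nmulr_rlt0// invr_gt0.
- move=> t /OE; rewrite OE coords_vec coords_pt /= => -[_ t0] f0.
  have r0 := rad_gt0 f0; split; first by rewrite mulr1.
  by rewrite pmulr_rlt0.
- move=> s t [/OE Os Ps Hs] [/OE Ot Pt Ht] u /andP[su ut] /=.
  rewrite !qf_even1 !qh_even1 !coords_vec /= in Os Ot Ps Hs Pt Ht *.
  have t0 : t < 0 by case: Ot.
  have u0 : u < 0 by exact: le_lt_trans t0.
  have [|||P H] := @even_between R m e (t ^+ 2) (u ^+ 2) (s ^+ 2) np _ _ _ Ps Ht Hs.
  + by rewrite exprn_even_gt0//= lt_eqF.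
  + by nra.
  + by nra.
  by split=> //; apply/OE; rewrite coords_vec.
- by apply/OE.
Qed.

Lemma quadrant_nonempty_end (R : realType) (m e : R) : normal_params m e ->
  exists t1 d, [/\ 0 < d, t1 <= 0, 0 < qf (even_quartic m e) 1 t1,
    qh (even_quartic m e) 1 t1 = 0 &
    forall t, t1 - d < t < t1 -> 0 < qf (even_quartic m e) 1 t /\
      quadrant_arc m e (pt (even_quartic m e) t)].
Proof.
move=> np; have [w1 [w2 [w10 w12 Fw Pw Hw]]] := even_root np.
pose t1 := - Num.sqrt w1; pose t2 := - Num.sqrt w2.
have t12 : t2 < t1 by rewrite ltrN2 ltr_sqrt// (le_lt_trans w10).
have t1E : t1 ^+ 2 = w1 by rewrite sqrrN sqr_sqrtr.
have t2E : t2 ^+ 2 = w2 by rewrite sqrrN sqr_sqrtr// ltW// (le_lt_trans w10).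
have t10 : t1 <= 0 by rewrite oppr_le0 sqrtr_ge0.
have f1 : 0 < qf (even_quartic m e) 1 t1 by rewrite qf_even1 t1E.
have /nbhs_ballP[d d0 dP] := @qf1_continuous R (even_quartic m e) t1 _
  (open_nbhs_nbhs (conj (@open_gt R 0) f1)).
exists t1, (Num.min d (t1 - t2)); split=> //.
- by rewrite lt_min d0 subr_gt0.
- by rewrite qh_even1 t1E.
move=> t /andP[td tt1].
have [md m2] : Num.min d (t1 - t2) <= d /\ Num.min d (t1 - t2) <= t1 - t2.
  by rewrite !ge_min !lexx orbT.
have ft : 0 < qf (even_quartic m e) 1 t.
  by apply: dP; rewrite /ball /= ger0_norm; lra.
split=> //; split; last first.
  have r0 := rad_gt0 ft; rewrite /mkset coords_pt /= mulr1; split=> //.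
  by rewrite pmulr_rlt0// (lt_le_trans tt1).
apply: level_pt => //; rewrite qh_even1; apply: Hw.
by rewrite -t1E -t2E; apply/andP; split; nra.
Qed.

Lemma components_quadrant (R : realType) (m e : R) : normal_params m e ->
  components (mform (even_quartic m e)) (quadrant_arc m e).
Proof.
move=> np; have [t1 [d [d0 _ _ _ Hd]]] := quadrant_nonempty_end np.
have [|_ G] := Hd (t1 - d / 2); first by lra.
exists (pt (even_quartic m e) (t1 - d / 2)); first by have [] := G.
exact: quadrant_component.
Qed.

Lemma quadrant_good_end (R : realType) (m e : R) : normal_params m e ->
  good_end (even_quartic m e) (quadrant_arc m e).
Proof.
move=> np; have [t1 [d [d0 _ f1 h1 Hd]]] := quadrant_nonempty_end np.
exact: good_end_left_limit d0 f1 h1 Hd.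
Qed.

Definition diag2 (R : realType) (s t : bool) : 'M[R]_2 :=
  mx2 ((-1) ^+ s) 0 0 ((-1) ^+ t).

Lemma diag2_unit (R : realType) (s t : bool) : diag2 R s t \in unitmx.
Proof.
by rewrite unitmx2 det_mx2 mul0r subr0 -signr_addb signr_eq0.
Qed.

Lemma diag2K (R : realType) (s t : bool) : diag2 R s t *m diag2 R s t = 1%:M.
Proof.
apply/matrixP => i j; rewrite !mxE sum_ord2 !mxE.
by case: (ord2E i) => ->; case: (ord2E j) => -> /=;
  rewrite ?mulr0 ?mul0r ?addr0 ?add0r// -signr_addb addbb.
Qed.

Lemma coords_diag2 (R : realType) (s t : bool) (p : 'cV[R]_2) :
  coords (diag2 R s t *m p) = ((-1) ^+ s * (coords p).1, (-1) ^+ t * (coords p).2).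
Proof. by rewrite mulmx_coords !mxE /= !mul0r addr0 add0r. Qed.

Lemma msubst_diag2 (R : realType) (m e : R) (s t : bool) :
  msubst (even_quartic m e) (diag2 R s t) = even_quartic m e.
Proof.
rewrite msubst_mx2; case: s; case: t;
  by apply: quartic_eq; rewrite /= /polar /=; ring.
Qed.

Definition signed_quadrant (R : realType) (m e : R) (b : bool * bool) :
  set 'cV[R]_2 := [set diag2 R b.1 b.2 *m p | p in quadrant_arc m e].

Lemma normalize_signs (R : realType) (x y : R) : x != 0 -> y != 0 ->
  0 < (-1) ^+ (x < 0)%R * x /\ (-1) ^+ (0 < y)%R * y < 0.
Proof.
move=> x0 y0; rewrite !mulr_sign; split.
  by have [xn|xp|xz] := ltgtP x 0; rewrite ?oppr_gt0//; rewrite xz eqxx in x0.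
by have [yn|yp|yz] := ltgtP y 0; rewrite ?oppr_lt0//; rewrite yz eqxx in y0.
Qed.

(** A diagonal sign matrix moves any point of the level set to the fourth quadrant without changing
    the form. *)
Lemma components_even (R : realType) (m e : R) : normal_params m e ->
  components (mform (even_quartic m e)) = range (signed_quadrant m e).
Proof.
move=> np; apply/seteqP; split=> [C [p Sp <-]|_ [b _ <-]]; last first.
  apply: components_msubst; first exact: diag2_unit.
  by rewrite msubst_diag2; exact: components_quadrant.
pose s := (coords p).1 < 0; pose t := 0 < (coords p).2.
exists (s, t) => //.
have [x0 y0] := even_level_axes (normal_params_ge0 np) Sp.
pose p' := diag2 R s t *m p.
have Sp' : hyperbolic_level (mform (even_quartic m e)) p'.
  by apply: (iffLR (hyperbolic_level_msubst _ _ (diag2_unit R s t))); rewrite msubst_diag2.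
have Qp' : quadrant_arc m e p'.
  by split=> //; rewrite /mkset coords_diag2; exact: normalize_signs.
rewrite /signed_quadrant -(quadrant_component np Qp') /=.
have := connected_component_msubst (diag2_unit R s t) (a := even_quartic m e) (p := p').
rewrite msubst_diag2 => /(_ Sp') ->.
by rewrite /p' mulmxA diag2K mul1mx.
Qed.

Lemma signed_quadrant_inj (R : realType) (m e : R) : normal_params m e ->
  injective (signed_quadrant m e).
Proof.
move=> np [s t] [s' t'] E.
have [p0 Sp0 QE] := components_quadrant np.
have Qp : quadrant_arc m e p0 by rewrite -QE; exact: connected_component_refl.
have : signed_quadrant m e (s', t') (diag2 R s t *m p0).
  by rewrite -E; exists p0.
move: Qp => [_ [x0 y0]] [q [_ [x1 y1]]] /(congr1 (@coords R)).
rewrite !coords_diag2.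
case: (coords p0) x0 y0 => x y x0 y0; case: (coords q) x1 y1 => x' y' x1 y1.
move=> /= [] h1 h2; move: h1 h2 x0 y0 x1 y1 => /=; clear.
by case: s; case: s'; case: t; case: t' => //=;
  rewrite !(expr0, expr1, mul1r, mulN1r) => h1 h2 x0 y0 x1 y1; exfalso; lra.
Qed.

Lemma even_four_components (R : realType) (m e : R) : normal_params m e ->
  four_equivalent_components (mform (even_quartic m e)).
Proof.
move=> np; rewrite /four_equivalent_components components_even//; split.
  pose g n := (odd n, (1 < n)%N).
  have -> : range (signed_quadrant m e) = (signed_quadrant m e \o g) @` `I_4.
    apply/seteqP; split=> [_ [[s t] _ <-]|_ [n _ <-]]; last by exists (g n).
    by case: s; case: t; [exists 3%N|exists 1%N|exists 2%N|exists 0%N].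
  apply: inj_card_eq => i j; rewrite !inE /= => i4 j4 /(signed_quadrant_inj np).
  by case: i i4 => [|[|[|[|//]]]] _; case: j j4 => [|[|[|[|//]]]].
move=> _ _ [[s t] _ <-] [[s' t'] _ <-].
exists (diag2 R s' t' *m diag2 R s t); first by rewrite unitmx_mul !diag2_unit.
rewrite /signed_quadrant image_comp; apply: eq_imagel => p _ /=.
by rewrite -!mulmxA [diag2 R s t *m (_ *m _)]mulmxA diag2K mul1mx.
Qed.

(** * Automorphisms and points at infinity *)

Lemma image_mulmx_inj (R : realType) (B : 'M[R]_2) : B \in unitmx ->
  injective (fun H : set 'cV[R]_2 => [set B *m p | p in H]).
Proof.
move=> Bu H1 H2 E; rewrite -(@image_mulmx_id _ (invmx B) B H1) ?mulVmx//.
by rewrite E image_mulmx_id// mulVmx.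
Qed.

Lemma four_equivalent_components_msubst (R : realType) (b : quartic R)
    (B : 'M[R]_2) : B \in unitmx ->
  four_equivalent_components (mform b) ->
  four_equivalent_components (mform (msubst b B)).
Proof.
move=> Bu [c4 ce].
have Vu : invmx B \in unitmx by rewrite unitmx_inv.
have bE : msubst (msubst b B) (invmx B) = b by rewrite msubstM mulmxV// msubst1.
split.
  apply: card_eq_trans c4; rewrite card_eq_sym.
  have -> : components (mform b) =
      (fun H : set 'cV[R]_2 => [set B *m p | p in H]) @` components (mform (msubst b B)).
    apply/seteqP; split=> [H cH|_ [H cH <-]]; last exact: components_msubst.
    exists [set invmx B *m p | p in H]; last by rewrite image_mulmx_id// mulmxV.
    by have := @components_msubst R (msubst b B) (invmx B) H Vu; rewrite bE; exact.
  by apply: inj_card_eq => H1 H2 _ _; exact: image_mulmx_inj.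
move=> C1 C2 c1 c2.
have e1 : equivalent C1 [set B *m p | p in C1] by exists B.
have e2 : equivalent C2 [set B *m p | p in C2] by exists B.
apply: (equivalent_trans e1); apply: equivalent_trans (equivalent_sym e2).
by apply: ce; exact: components_msubst.
Qed.

Lemma isomorphic_to_msubst (R : realType) (b : quartic R) (B : 'M[R]_2)
    (gT : finGroupType) : B \in unitmx ->
  isomorphic_to (automorphisms (mform b)) gT ->
  isomorphic_to (automorphisms (mform (msubst b B))) gT.
Proof.
move=> Bu [f [finj frange fM]].
exists (fun x => invmx B *m f x *m B); split.
- move=> x y E; apply: finj.
  have := congr1 (fun M => B *m M *m invmx B) E.
  by rewrite !mulmxA !mulmxK// mulmxV// !mul1mx.
- apply/seteqP; split=> [_ [x _ <-]|A /automorphismsE[Au AE]].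
    have /automorphismsE[fu fE] : automorphisms (mform b) (f x) by rewrite -frange; exists x.
    apply/automorphismsE; rewrite !unitmx_mul unitmx_inv Bu fu; split=> //.
    by rewrite msubstM !mulmxA mulmxV// mul1mx -msubstM fE.
  have : automorphisms (mform b) (B *m A *m invmx B).
    apply/automorphismsE; rewrite !unitmx_mul unitmx_inv Bu Au; split=> //.
    by rewrite -!msubstM AE msubstM mulmxV// msubst1.
  rewrite -frange => -[x _ xE]; exists x => //.
  by rewrite xE !mulmxA mulVmx// mul1mx mulmxKV.
- by move=> x y; rewrite fM !mulmxA mulmxK.
Qed.

Definition swapmx (R : realType) : 'M[R]_2 := mx2 0 1 1 0.

Lemma matrix2P (R : realType) (A : 'M[R]_2) :
  A = mx2 (A ord0 ord0) (A ord0 ord_max) (A ord_max ord0) (A ord_max ord_max).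
Proof.
apply/matrixP => i j; rewrite !mxE.
by case: (ord2E i) => ->; case: (ord2E j) => ->.
Qed.

Lemma mulmx2 (R : realType) (p q r s p' q' r' s' : R) :
  mx2 p q r s *m mx2 p' q' r' s' =
  mx2 (p * p' + q * r') (p * q' + q * s') (r * p' + s * r') (r * q' + s * s').
Proof.
apply/matrixP => i j; rewrite !mxE sum_ord2 !mxE.
by case: (ord2E i) => ->; case: (ord2E j) => ->.
Qed.

Lemma sqr1_sign (R : realType) (x : R) : x ^+ 2 = 1 -> exists s : bool, x = (-1) ^+ s.
Proof.
by move/eqP; rewrite sqrf_eq1 => /orP[]/eqP->; [exists false|exists true].
Qed.

Lemma fourth1_sqr (R : realType) (x : R) : x ^+ 4 = 1 -> x ^+ 2 = 1.
Proof.
move=> x4; have : (x ^+ 2 - 1) * (x ^+ 2 + 1) = 0.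
  by rewrite -subr_sqr -exprM x4 expr1n subrr.
move/eqP; rewrite mulf_eq0 subr_eq0 => /orP[/eqP//|].
by rewrite gt_eqF// ltr_wpDl// sqr_ge0.
Qed.

(* The Hessian of Q = x^4 + 6m x^2 y^2 + e y^4 minus m Q is (e - 9 m^2) x^2 y^2,
   so an automorphism preserves x^2 y^2 and is therefore monomial. *)
Lemma even_automorphism (R : realType) (m e : R) (A : 'M[R]_2) :
  normal_params m e -> A \in unitmx -> msubst (even_quartic m e) A = even_quartic m e ->
  (exists s t, A = diag2 R s t) \/ e = 1 /\ (exists s t, A = swapmx R *m diag2 R s t).
Proof.
move=> np; rewrite unitmx2 => dA AE.
set Q := even_quartic m e in AE.
have dI : \det A ^+ 4 * qI Q = qI Q by rewrite -[RHS](congr1 (@qI R) AE) det2 -qI_subst.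
have dJ : \det A ^+ 6 * qJ Q = qJ Q by rewrite -[RHS](congr1 (@qJ R) AE) det2 -qJ_subst.
have e9 : e - 9 * m ^+ 2 != 0.
  case: np => [[m1 ->]|[m0 ->]|[-> ->]|[-> ->]].
  - by rewrite lt_eqF//; nra.
  - by rewrite lt_eqF//; have := sqr_ge0 m; lra.
  - by rewrite lt_eqF// expr0n; lra.
  - by rewrite lt_eqF// expr1n; lra.
(* [qh] is preserved only up to [det^2]. Since [I] or [J] is nonzero, [det^4 = 1] or [det^6 = 1],
   and either gives [det^2 = 1]. *)
have d2 : \det A ^+ 2 = 1.
  have [J0|J0] := eqVneq (qJ Q) 0.
    have I0 : qI Q != 0.
      rewrite qI_even; move: J0; rewrite qJ_even => J0.
      clear AE dI dJ Q; case: np J0 => [[m1 ->]|[m0 ->]|[-> ->]|[-> ->]] J0.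
      - by rewrite gt_eqF//; have := sqr_ge0 m; lra.
      - by exfalso; have := exprn_gt0 3 m0; lra.
      - by rewrite expr0n mulr0 addr0 oppr_eq0 oner_eq0.
      - by rewrite add0r expr1n mulr1 pnatr_eq0.
    by apply: fourth1_sqr; apply: (mulIf I0); rewrite mul1r.
  apply: cube_inj; rewrite -exprM expr1n.
  by apply: (mulIf J0); rewrite mul1r.
have qfE x y : qf Q (A ord0 ord0 * x + A ord0 ord_max * y)
    (A ord_max ord0 * x + A ord_max ord_max * y) = qf Q x y.
  by rewrite -qf_subst -/(msubst Q A) AE.
have qhE x y : qh Q (A ord0 ord0 * x + A ord0 ord_max * y)
    (A ord_max ord0 * x + A ord_max ord_max * y) = qh Q x y.
  by rewrite -[RHS](congr1 (fun q => qh q x y) AE) qh_subst -det2 d2 mul1r.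
move: (matrix2P A) d2 qfE qhE; rewrite det2.
set p := A ord0 ord0; set q := A ord0 ord_max.
set r := A ord_max ord0; set s := A ord_max ord_max.
move=> AM d2 qfE qhE.
have mono x y : ((p * x + q * y) * (r * x + s * y)) ^+ 2 = (x * y) ^+ 2.
  apply: (mulfI e9).
  have key u v : (e - 9 * m ^+ 2) * (u * v) ^+ 2 = qh Q u v - m * qf Q u v.
    by rewrite qf_even qh_even; ring.
  by rewrite !key qfE qhE.
have pr : p * r = 0.
  by apply/eqP; rewrite -sqrf_eq0; have := mono 1 0; rewrite !(mulr0, mulr1, addr0) expr0n => ->.
have qs : q * s = 0.
  by apply/eqP; rewrite -sqrf_eq0; have := mono 0 1; rewrite !(mulr0, mulr1, add0r) expr0n => ->.
have f10 : qf Q p r = 1.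
  by have := qfE 1 0; rewrite !(mulr0, mulr1, addr0) => ->; rewrite qf_even; ring.
have [r0|r0] := eqVneq r 0.
  have p1 : p ^+ 2 = 1.
    apply: fourth1_sqr; rewrite -f10 r0 qf_even; ring.
  have p0 : p != 0 by rewrite -sqrf_eq0 p1 oner_eq0.
  have s1 : s ^+ 2 = 1.
    by move: d2; rewrite r0 mulr0 subr0 exprMn p1 mul1r.
  have s0 : s != 0 by rewrite -sqrf_eq0 s1 oner_eq0.
  have q0' : q = 0 by apply/eqP; move/eqP: qs; rewrite mulf_eq0 (negPf s0) orbF.
  have [b1 pE] := sqr1_sign p1; have [b2 sE] := sqr1_sign s1.
  by left; exists b1, b2; rewrite AM pE sE q0' r0.
have p0 : p = 0 by apply/eqP; move/eqP: pr; rewrite mulf_eq0 (negPf r0) orbF.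
have r4 : e * r ^+ 4 = 1 by rewrite -f10 p0 qf_even; ring.
have e1 : e = 1.
  case: np r4 => [[_ ->]//|[_ ->]|[_ ->]|[_ ->]] h; exfalso; move: h.
  - by rewrite mulN1r => /eqP; rewrite lt_eqF// (le_lt_trans _ ltr01)// oppr_le0 exprn_even_ge0.
  - by rewrite mulN1r => /eqP; rewrite lt_eqF// (le_lt_trans _ ltr01)// oppr_le0 exprn_even_ge0.
  - by rewrite mul0r => /esym/eqP; rewrite oner_eq0.
have r1 : r ^+ 2 = 1 by apply: fourth1_sqr; rewrite -r4 e1 mul1r.
have q1' : q ^+ 2 = 1.
  by move: d2; rewrite p0 mul0r sub0r sqrrN exprMn r1 mulr1.
have q0' : q != 0 by rewrite -sqrf_eq0 q1' oner_eq0.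
have s0 : s = 0 by apply/eqP; move/eqP: qs; rewrite mulf_eq0 (negPf q0').
have [b1 rE] := sqr1_sign r1; have [b2 qE] := sqr1_sign q1'.
right; split=> //; exists b1, b2; rewrite AM p0 s0 rE qE mulmx2.
by congr mx2; ring.
Qed.

Lemma msubst_swapmx (R : realType) (m : R) :
  msubst (even_quartic m 1) (swapmx R) = even_quartic m 1.
Proof. by rewrite msubst_mx2; apply: quartic_eq; rewrite /= /polar /=; ring. Qed.

Lemma swapmx_unit (R : realType) : swapmx R \in unitmx.
Proof. by rewrite unitmx2 det_mx2 mul0r mul1r sub0r oppr_eq0 oner_eq0. Qed.

Lemma diag2_inj (R : realType) (s t s' t' : bool) :
  diag2 R s t = diag2 R s' t' -> s = s' /\ t = t'.
Proof.
move=> E; have := congr1 (fun M : 'M[R]_2 => M ord0 ord0) E.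
have := congr1 (fun M : 'M[R]_2 => M ord_max ord_max) E.
rewrite !mxE /=; case: s {E}; case: s'; case: t; case: t' => //=;
  rewrite !(expr0, expr1) => h1 h2; exfalso; lra.
Qed.

Lemma diag2M (R : realType) (s t s' t' : bool) :
  diag2 R s t *m diag2 R s' t' = diag2 R (s (+) s') (t (+) t').
Proof. by rewrite mulmx2 !mulr0 !mul0r !addr0 !add0r -!signr_addb. Qed.

Lemma swapmxM_diag2 (R : realType) (s t : bool) :
  diag2 R s t *m swapmx R = swapmx R *m diag2 R t s.
Proof. by rewrite !mulmx2; congr mx2; ring. Qed.

Lemma even_automorphisms_Z2xZ2 (R : realType) (m e : R) :
  normal_params m e -> e <= 0 ->
  isomorphic_to (automorphisms (mform (even_quartic m e))) Z2xZ2.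
Proof.
move=> np e0; exists (fun u : Z2xZ2 => diag2 R (u.1 != 0%R) (u.2 != 0%R)); split.
- move=> [a b] [a' b'] /diag2_inj /= [].
  by case: a => [[|[|//]] ?]; case: b => [[|[|//]] ?]; case: a' => [[|[|//]] ?];
    case: b' => [[|[|//]] ?] //= _ _; congr (_, _); apply: val_inj.
- apply/seteqP; split=> [_ [u _ <-]|A /automorphismsE[Au AE]].
    by apply/automorphismsE; split; [exact: diag2_unit | exact: msubst_diag2].
  have [[s [t ->]]|[e1]] := even_automorphism np Au AE; last first.
    by rewrite e1 leNgt ltr01 in e0.
  exists (if s then 1%R else 0%R, if t then 1%R else 0%R) => //=.
  by case: s; case: t.
- move=> [a b] [a' b']; rewrite diag2M /=.
  by case: a => [[|[|//]] ?]; case: b => [[|[|//]] ?]; case: a' => [[|[|//]] ?];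
    case: b' => [[|[|//]] ?].
Qed.

Lemma even_automorphisms_dihedral (R : realType) (m : R) :
  normal_params m 1 ->
  isomorphic_to (automorphisms (mform (even_quartic m 1))) Z2_sdprod_Z2xZ2.
Proof.
move=> np.
pose g (a : 'Z_2) (u : 'Z_2 * 'Z_2) : 'M[R]_2 :=
  (if a == 0%R then 1%:M else swapmx R) *m diag2 R (u.1 != 0%R) (u.2 != 0%R).
(* This is the product rule of the semidirect product: moving a diagonal sign matrix past [swapmx]
   exchanges its two signs. *)
have gM a u b v : g (a * b)%g (swap u b * v)%g = g a u *m g b v.
  have Sw s t M : diag2 R s t *m (swapmx R *m M) = swapmx R *m (diag2 R t s *m M).
    by rewrite !mulmxA swapmxM_diag2.
  have SS M : swapmx R *m (swapmx R *m M) = M.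
    rewrite mulmxA [swapmx R *m _](_ : _ = 1%:M) ?mul1mx// mulmx2.
    by apply/matrixP => i j; rewrite !mxE; case: (ord2E i) => ->; case: (ord2E j) => -> /=;
      rewrite !(mulr0, mul0r, mulr1, addr0, add0r).
  rewrite /g /swap; case: a => [[|[|//]] ?]; case: b => [[|[|//]] ?] /=;
    rewrite ?mul1mx -?mulmxA ?Sw ?SS ?diag2M;
    case: u => [[[|[|//]] ?] [[|[|//]] ?]]; case: v => [[[|[|//]] ?] [[|[|//]] ?]] //=.
exists (fun x : Z2_sdprod_Z2xZ2 => g (val x).1 (val x).2); split.
- move=> x y; have Sinj a b s t s' t' :
      (if a == 0%R :> 'Z_2 then 1%:M else swapmx R) *m diag2 R s t =
      (if b == 0%R :> 'Z_2 then 1%:M else swapmx R) *m diag2 R s' t' ->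
      [/\ (a == 0%R) = (b == 0%R), s = s' & t = t'].
    have w s1 t1 : (swapmx R *m diag2 R s1 t1) ord0 ord0 = 0.
      by rewrite mulmx2 mxE /= mul0r mulr0 addr0.
    have z s1 t1 : diag2 R s1 t1 ord0 ord0 != 0 by rewrite !mxE signr_eq0.
    case: (a == 0%R); case: (b == 0%R); rewrite ?mul1mx.
    + by move=> /diag2_inj[-> ->].
    + move=> /(congr1 (fun M : 'M[R]_2 => M ord0 ord0)) E; exfalso.
      by have := z s t; rewrite E w eqxx.
    + move=> /(congr1 (fun M : 'M[R]_2 => M ord0 ord0)) E; exfalso.
      by have := z s' t'; rewrite -E w eqxx.
    + move=> /(congr1 (mulmx (invmx (swapmx R)))).
      by rewrite !mulKmx ?swapmx_unit// => /diag2_inj[-> ->].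
  move=> /Sinj; case: x => [[a [u1 u2]] ax]; case: y => [[b [v1 v2]] bx] /= [ab uv1 uv2].
  apply: val_inj => /=; congr (_, (_, _)); apply: val_inj => /=.
  + by move: ab; clear; case: a => [[|[|//]] ?]; case: b => [[|[|//]] ?].
  + by move: uv1; clear; case: u1 => [[|[|//]] ?]; case: v1 => [[|[|//]] ?].
  + by move: uv2; clear; case: u2 => [[|[|//]] ?]; case: v2 => [[|[|//]] ?].
- apply/seteqP; split=> [_ [[[a [u1 u2]] ax] _ <-]|A /automorphismsE[Au AE]].
    apply/automorphismsE; rewrite /g /=; case: (a == 0%R).
      by rewrite mul1mx; split; [exact: diag2_unit | exact: msubst_diag2].
    by rewrite unitmx_mul swapmx_unit diag2_unit -msubstM msubst_swapmx msubst_diag2.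
  pose z (b : bool) : 'Z_2 := if b then 1%R else 0%R.
  have zE b : (z b != 0%R) = b by case: b.
  have mem (ax : 'Z_2 * ('Z_2 * 'Z_2)) : ax \in finset.setX [set: 'Z_2]%SET [set: 'Z_2 * 'Z_2]%SET.
    by rewrite inE !finset.in_setT.
  have [[s [t ->]]|[_ [s [t ->]]]] := even_automorphism np Au AE.
    exists (SdPair swap_groupAction (mem (0%R, (z s, z t)))) => //.
    by rewrite /g /= !zE mul1mx.
  exists (SdPair swap_groupAction (mem (1%R, (z s, z t)))) => //.
  by rewrite /g /= !zE.
- by case=> [[a u] ax] [[b v] bx]; rewrite -gM.
Qed.

(** At a zero [p] of [h] and [dh], an orthogonal frame starting with [p] has [q0 = q1 = 0], so
    [I = 3 q2^2] and [J = - q2^3] in this frame, and the discriminant vanishes. *)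
Lemma not_singular_at_infinity (R : realType) (a : quartic R) (H : set 'cV[R]_2) :
  qI a ^+ 3 != 27 * qJ a ^+ 2 -> ~ singular_at_infinity (mform a) H.
Proof.
move=> D [p [_ p0 f0 df0]]; case/eqP: D.
case PE : (coords p) => [x y].
have xy : x ^+ 2 + y ^+ 2 != 0.
  apply: contraNneq p0 => h; have [x0 y0] : x = 0 /\ y = 0.
    by have := sqr_ge0 x; have := sqr_ge0 y => y2 x2;
      split; apply/eqP; rewrite -sqrf_eq0 eq_le; apply/andP; split=> //; lra.
  by apply/eqP; apply: colP2; rewrite PE x0 y0 /coords !mxE.
have c0 : polar a (x, y) (x, y) (x, y) (x, y) = 0.
  by move: f0; rewrite ev_mform PE polar_diag.
have c1 : polar a (x, y) (x, y) (x, y) (- y, x) = 0.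
  move: (df0 (vec (- y) x)); rewrite d1_mform PE coords_vec => /eqP.
  by rewrite mulf_eq0 pnatr_eq0 /= => /eqP.
pose b := qsubst a x (- y) y x.
have b0 : q0 b = 0 by exact: c0.
have b1 : q1 b = 0 by exact: c1.
have det : x * x - - y * y = x ^+ 2 + y ^+ 2 by ring.
have : qI b ^+ 3 = 27 * qJ b ^+ 2 by rewrite /qI /qJ b0 b1; ring.
rewrite qI_subst qJ_subst det => h.
apply: (mulfI (expf_neq0 12 xy)).
transitivity (((x ^+ 2 + y ^+ 2) ^+ 4 * qI a) ^+ 3); first by ring.
by rewrite h; ring.
Qed.

Lemma singular_at_infinity_msubst (R : realType) (a : quartic R) (A : 'M[R]_2)
    (H : set 'cV[R]_2) (p : 'cV[R]_2) : A \in unitmx ->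
  closure (cone H) p -> ~ cone H p -> p != 0 ->
  ev (mform (msubst a A)) p = 0 -> (forall v, d1 (mform (msubst a A)) p v = 0) ->
  singular_at_infinity (mform a) [set A *m q | q in H].
Proof.
move=> Au clp ncp p0 f0 df0.
have coneE q : cone [set A *m q | q in H] (A *m q) <-> cone H q.
  split=> [[r [_ [r0 [q' Hq' <-] e]]]|[r [q' [r0 Hq' ->]]]].
    exists r, q'; split=> //; rewrite -(mulKmx Au q) e -scalemxAr mulKmx//.
  by exists r, (A *m q'); split=> //; [exists q' | rewrite scalemxAr].
exists (A *m p); split.
- split; last by move=> /interior_subset/coneE.
  move=> N /(@mulmx_continuous R A p) /clp [q [Hq Nq]].
  by exists (A *m q); split=> //; apply/coneE.
- by apply: contraNneq p0 => e; rewrite -(mulKmx Au p) e mulmx0.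
- by rewrite -f0 !ev_mform qf_msubst.
- by move=> v; have := df0 (invmx A *m v); rewrite !d1_mform polar_msubst mulKVmx.
Qed.

(** The comparison of flat ends, applied to a listed curve and a quadrant arc; what is computed on
    even forms is transferred along [A]. *)
Lemma listed_normal_form (R : realType) (L K : R) : listed L K ->
  exists m e (A : 'M[R]_2), [/\ normal_params m e, A \in unitmx,
    stdq L K = msubst (even_quartic m e) (invmx A) /\ msubst (stdq L K) A = even_quartic m e,
    std_curve L K = [set A *m p | p in quadrant_arc m e] &
    [/\ L = 0 -> e = 1, L = 1 -> e <= 0 & L = 1 -> K = U -> m = 1 /\ e = 0]].
Proof.
move=> l; have [m [e [np si e1 e0 me]]] := normal_params_exists l.
have [si1 si2] := same_invariants_sym si.
have [A [Au AE HE]] := good_end_equiv (components_quadrant np)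
  (components_std_curve L K) (quadrant_good_end np) (listed_good_end l) si1 si2.
by exists m, e, A; split=> //; split=> //; rewrite -AE msubstM mulmxV// msubst1.
Qed.

Lemma listed_four_components (R : realType) (L K : R) : listed L K ->
  four_equivalent_components (std_quartic L K).
Proof.
move=> /listed_normal_form[m [e [A [np Au [AE _] _ _]]]].
rewrite std_quarticE -/(stdq L K) AE; apply: four_equivalent_components_msubst.
  by rewrite unitmx_inv.
exact: even_four_components.
Qed.

Lemma automorphisms_L0 (R : realType) (K : R) : listed 0 K ->
  isomorphic_to (automorphisms (std_quartic 0 K)) Z2_sdprod_Z2xZ2.
Proof.
move=> /listed_normal_form[m [e [A [np Au [AE _] _ [e1 _ _]]]]].
rewrite std_quarticE -/(stdq 0 K) AE; apply: isomorphic_to_msubst.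
  by rewrite unitmx_inv.
by move: np; rewrite e1//; exact: even_automorphisms_dihedral.
Qed.

Lemma automorphisms_L1 (R : realType) (K : R) : listed 1 K ->
  isomorphic_to (automorphisms (std_quartic 1 K)) Z2xZ2.
Proof.
move=> /listed_normal_form[m [e [A [np Au [AE _] _ [_ e0 _]]]]].
rewrite std_quarticE -/(stdq 1 K) AE; apply: isomorphic_to_msubst.
  by rewrite unitmx_inv.
by apply: even_automorphisms_Z2xZ2 => //; exact: e0.
Qed.

(** For [m = 1], [e = 0] the form is [x^2 (x^2 + 6 y^2)], with a double zero on the axis [x = 0].
    The vectors [(x, -1)] with [0 < x < 1] lie in the cone, since [even_Phi = 1 - 3 t^2] is negative
    for [t = - 1 / x]. *)
Lemma cone_quadrant_limit (R : realType) : closure (cone (quadrant_arc (1 : R) 0)) (vec 0 (-1)).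
Proof.
have coneE (x : R) : 0 < x < 1 -> cone (quadrant_arc 1 0) (vec x (-1)).
  case/andP=> x0 x1; pose a := even_quartic (1 : R) 0; set t := - x^-1.
  have t1 : 1 < t ^+ 2 by rewrite sqrrN exprn_egt1// invf_gt1.
  have f0 : 0 < qf a 1 t by rewrite qf_even; lra.
  have r0 := rad_gt0 f0.
  exists (x / rad (qf a 1 t)), (pt a t); split; first by rewrite divr_gt0.
    split; first by apply: level_pt => //; rewrite qh_even; lra.
    rewrite /mkset coords_pt; split; first by rewrite mulr1.
    by rewrite pmulr_rlt0// oppr_lt0 invr_gt0.
  apply: colP2; rewrite coords_vec /coords !mxE /= divfK ?gt_eqF//.
  by rewrite mulrA divfK ?gt_eqF// mulrN divff ?gt_eqF.
move=> N Np.
have c : {for 0, continuous (fun x : R => x *: vec 1 0 + vec 0 (-1) : 'cV[R]_2)}.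
  by apply: continuousD; [apply: continuousZl; exact: cvg_id | exact: cvg_cst].
have vecE (x : R) : x *: vec 1 0 + vec 0 (-1) = vec x (-1).
  by apply: colP2; rewrite coords_vec /coords !mxE /= mulr1 mulr0 addr0 add0r.
have : \forall x \near 0^'+, N (x *: vec 1 0 + vec 0 (-1)).
  by apply: (cvg_at_right_filter c); rewrite vecE.
move=> near_N; have : \forall x \near (0 : R)^'+,
    0 < x < 1 /\ N (x *: vec 1 0 + vec 0 (-1)).
  near=> x; split; last by near: x.
  by apply/andP; split; [near: x; exact: nbhs_right_gt | near: x; exact: nbhs_right_lt].
case/filter_ex => x [x01]; rewrite vecE => Nx.
by exists (vec x (-1)); split=> //; exact: coneE.
Unshelve. all: by end_near. Qed.

Lemma singular_curve (R : realType) :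
  singular_at_infinity (std_quartic 1 U : mpoly 2 R) (std_curve 1 U).
Proof.
have l : listed (1 : R) U by apply: Or44.
have [m [e [A [np Au [_ AE] HE [_ _ me]]]]] := listed_normal_form l.
have [m1 e0] := me erefl erefl; rewrite {}m1 {}e0 in np AE HE.
rewrite std_quarticE -/(stdq 1 U) HE.
apply: (@singular_at_infinity_msubst _ _ _ _ (vec 0 (-1))) => //.
- exact: cone_quadrant_limit.
- case=> r [p [r0 [_ [x0 _]]]] /(congr1 (@coords R)).
  rewrite coords_vec => -[+ _]; rewrite mxE => /esym/eqP.
  by rewrite gt_eqF// mulr_gt0.
- apply/eqP => /(congr1 (fun p => (coords p).2)); rewrite coords_vec /coords /= mxE.
  by move/eqP; rewrite oppr_eq0 oner_eq0.
- by rewrite AE ev_mform coords_vec qf_even /=; ring.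
- by move=> v; rewrite AE d1_mform coords_vec; case: (coords v) => x y; rewrite /polar /=; ring.
Qed.

Lemma listed_not_singular (R : realType) (L K : R) : listed L K -> ~ (L = 1 /\ K = U) ->
  ~ singular_at_infinity (std_quartic L K) (std_curve L K).
Proof.
move=> l nU; rewrite std_quarticE -/(stdq L K); apply: not_singular_at_infinity.
case: (listed_disc l) => [[_ _ _ D]|[_ _ _ D]|[_ _ J0 I0]|[L1 KU _ _]].
- by rewrite gt_eqF.
- by rewrite lt_eqF.
- by rewrite J0 expr0n mulr0 expf_neq0// lt_eqF.
- by case: nU.
Qed.

Theorem theorem3p2 (R : realType) :
  (forall (h : mpoly 2 R) (H : set 'cV[R]_2),
     maximal_quartic_gpsr h H -> incomplete h H ->
     exists! LK : R * R,
       listed LK.1 LK.2 /\ equivalent H (std_curve LK.1 LK.2)) /\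
  (forall L K : R, listed L K ->
     [/\ maximal_quartic_gpsr (std_quartic L K) (std_curve L K),
         incomplete (std_quartic L K) (std_curve L K) &
         in_standard_form (std_quartic L K) (std_curve L K)]) /\
  (forall K : R, 1 / 4 < K ->
     four_equivalent_components (std_quartic 0 K) /\
     isomorphic_to (automorphisms (std_quartic 0 K)) Z2_sdprod_Z2xZ2) /\
  (forall K : R, - (25 / 72) < K < U ->
     four_equivalent_components (std_quartic 1 K) /\
     isomorphic_to (automorphisms (std_quartic 1 K)) Z2xZ2) /\
  (four_equivalent_components (std_quartic 1 (- (25 / 72)) : mpoly 2 R) /\
     isomorphic_to (automorphisms (std_quartic 1 (- (25 / 72)) : mpoly 2 R))
       Z2xZ2) /\
  (four_equivalent_components (std_quartic 1 U : mpoly 2 R) /\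
     isomorphic_to (automorphisms (std_quartic 1 U : mpoly 2 R)) Z2xZ2) /\
  (singular_at_infinity (std_quartic 1 U : mpoly 2 R) (std_curve 1 U)) /\
  (forall K : R, 1 / 4 < K ->
     ~ singular_at_infinity (std_quartic 0 K) (std_curve 0 K)) /\
  (forall K : R, - (25 / 72) < K < U ->
     ~ singular_at_infinity (std_quartic 1 K) (std_curve 1 K)) /\
  (~ singular_at_infinity (std_quartic 1 (- (25 / 72)) : mpoly 2 R)
       (std_curve 1 (- (25 / 72)))).
Proof.
have la (K : R) : 1 / 4 < K -> listed 0 K by move=> ?; exact: Or41.
have lb (K : R) : - (25 / 72) < K < U -> listed 1 K by move=> ?; exact: Or42.
have lc : listed 1 (- (25 / 72) : R) by exact: Or43.
have ld : listed 1 (U : R) by exact: Or44.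
split; first exact: classification.
split; first exact: listed_incomplete.
split=> [K /la l|]; first by split; [exact: listed_four_components | exact: automorphisms_L0].
split=> [K /lb l|]; first by split; [exact: listed_four_components | exact: automorphisms_L1].
do 2 (split; first by split; [exact: listed_four_components | exact: automorphisms_L1]).
split; first exact: singular_curve.
split=> [K /la l|]; first by apply: listed_not_singular => // -[/esym/eqP]; rewrite oner_eq0.
have U0 : - (25 / 72) < (U : R) by have [_ V0 _] := U_cubic R; lra.
split=> [K KU|]; apply: listed_not_singular => //.
- exact: lb.
- by case=> _ KE; move: KU; rewrite KE ltxx andbF.
- by case=> _ KE; move: U0; rewrite KE ltxx.
Qed.
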